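(* Let $f\not\equiv 0$ be a weakly holomorphic modular function for $\mathrm{SL}(2,\mathbb{Z})$ such that $f(e^{it})$ is real and non-negative for all $t\in[\pi/3,2\pi/3]$. Let $x=[a_1;a_2,\ldots,a_r,\overline{b_1,\ldots,b_\ell}]$ be a real quadratic irrationality in $(0,\infty)$ with $\ell\ge2$ even. Then \[\Lambda_f(x)=\frac{\mathrm{Re}\big(I_f(T^{b_1}V^{b_2}\cdots T^{b_{\ell-1}}V^{b_\ell})\big)}{b_1+\dots+b_\ell}.\] In particular, $\Lambda_f(x)>0$.
   Context: Let $T=\begin{pmatrix}1&1\\0&1\end{pmatrix}$, $V=\begin{pmatrix}1&0\\1&1\end{pmatrix}$, acting by Möbius transformations. For a hyperbolic $A\in\mathrm{SL}(2,\mathbb{Z})$ let $w,\tilde w$ be its repelling and attracting fixed points, $Q(x,y)=ax^2+bxy+cy^2$ the primitive integral form vanishing at $(w,1),(\tilde w,1)$ with $\mathrm{sgn}(a)=\mathrm{sgn}(w-\tilde w)$, $D=b^2-4ac$, and $I_f(A)=\int_{\tau_0}^{A\tau_0}\frac{f(\tau)\sqrt D}{Q(\tau,1)}d\tau$ for any $\tau_0\in\mathbb{H}$; $I_f(A)=0$ if $A$ is not hyperbolic. For irrational $x=[a_1;a_2,\ldots]\in(0,\infty)$ define $A_n=T^n$ for $0\le n\le a_1$; $A_n=T^{a_1}V^{a_2}\cdots V^{a_i}T^k$ if $n=a_1+\dots+a_i+k$, $0\le k\le a_{i+1}$, $i$ even; $A_n=T^{a_1}V^{a_2}\cdots T^{a_i}V^k$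 if $n=a_1+\dots+a_i+k$, $0\le k\le a_{i+1}$, $i$ odd. Then $\Lambda_f(x)=\limsup_{n\to\infty}\mathrm{Re}(I_f(A_n))/n$ (the $f$-Lyapunov exponent). *)

(* Defs.v *)
From Stdlib Require Import Reals ZArith List Arith Lia ClassicalEpsilon.
From Coquelicot Require Import Coquelicot.
Open Scope R_scope.

(** ** Integer matrices and Möbius transformations *)

Record mat2 : Set := Mat2 { m11 : Z; m12 : Z; m21 : Z; m22 : Z }.

Definition mat_id : mat2 := Mat2 1 0 0 1.
Definition mat_T : mat2 := Mat2 1 1 0 1.
Definition mat_V : mat2 := Mat2 1 0 1 1.

Definition mat_mul (A B : mat2) : mat2 :=
  Mat2 (m11 A * m11 B + m12 A * m21 B) (m11 A * m12 B + m12 A * m22 B)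
       (m21 A * m11 B + m22 A * m21 B) (m21 A * m12 B + m22 A * m22 B).

Fixpoint mat_pow (A : mat2) (n : nat) : mat2 :=
  match n with
  | O => mat_id
  | S k => mat_mul A (mat_pow A k)
  end.

Definition mat_det (A : mat2) : Z := (m11 A * m22 A - m12 A * m21 A)%Z.
Definition mat_tr (A : mat2) : Z := (m11 A + m22 A)%Z.

Definition SL2Z (A : mat2) : Prop := mat_det A = 1%Z.
Definition hyperbolic (A : mat2) : Prop := SL2Z A /\ (2 < Z.abs (mat_tr A))%Z.

Definition mobius (A : mat2) (tau : C) : C :=
  ((IZR (m11 A) * tau + IZR (m12 A)) / (IZR (m21 A) * tau + IZR (m22 A)))%C.

Definition mobius_real (A : mat2) (x : R) : R :=
  (IZR (m11 A) * x + IZR (m12 A)) / (IZR (m21 A) * x + IZR (m22 A)).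

(** A hyperbolic element of SL(2,Z) never fixes the point at infinity, so both
    its fixed points are found among the reals. *)
Definition fixed_point (A : mat2) (w : R) : Prop :=
  IZR (m21 A) * w + IZR (m22 A) <> 0 /\ mobius_real A w = w.
Definition attracting_fixed_point (A : mat2) (w : R) : Prop :=
  fixed_point A w /\ Rabs (Derive (mobius_real A) w) < 1.
Definition repelling_fixed_point (A : mat2) (w : R) : Prop :=
  fixed_point A w /\ 1 < Rabs (Derive (mobius_real A) w).

(** ** The quadratic form of a hyperbolic matrix *)

Record qform : Set := QForm { qa : Z; qb : Z; qc : Z }.

Definition qdisc (Q : qform) : Z := (qb Q * qb Q - 4 * (qa Q * qc Q))%Z.

Definition qprimitive (Q : qform) : Prop :=
  Z.gcd (Z.gcd (qa Q) (qb Q)) (qc Q) = 1%Z.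

Definition qeval (Q : qform) (x y : C) : C :=
  (IZR (qa Q) * x * x + IZR (qb Q) * x * y + IZR (qc Q) * y * y)%C.

Definition is_form_of (A : mat2) (Q : qform) : Prop :=
  exists w w' : R,
    repelling_fixed_point A w /\ attracting_fixed_point A w' /\
    qprimitive Q /\
    qeval Q (RtoC w) (RtoC 1) = RtoC 0 /\
    qeval Q (RtoC w') (RtoC 1) = RtoC 0 /\
    IZR (Z.sgn (qa Q)) = sign (w - w').

(** [is_form_of A] has exactly one solution when [A] is hyperbolic. *)
Definition form_of (A : mat2) : qform :=
  epsilon (inhabits (QForm 0 0 0)) (is_form_of A).

(** ** Weakly holomorphic modular functions *)

Definition nome (tau : C) : C :=
  let r := exp (- (2 * PI * Im tau)) in
  (r * cos (2 * PI * Re tau), r * sin (2 * PI * Re tau)).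

Record weakly_holomorphic_modular_function (f : C -> C) : Prop := {
  whm_holomorphic :
    forall tau : C, 0 < Im tau ->
      ex_derive (K := C_AbsRing) (V := C_NormedModule) f tau;
  whm_modular :
    forall (A : mat2) (tau : C), SL2Z A -> 0 < Im tau ->
      f (mobius A tau) = f tau;
  (** Meromorphy at the cusp: f = q^(-N) (c_0 + c_1 q + c_2 q^2 + ...). *)
  whm_cusp :
    exists (N : nat) (c : nat -> C), forall tau : C, 0 < Im tau ->
      is_series (K := C_AbsRing) (V := C_NormedModule)
        (fun n => (c n * nome tau ^ n)%C) (nome tau ^ N * f tau)%C
}.

(** ** Cycle integrals *)

Definition segment_integral (g : C -> C) (z1 z2 : C) : C :=
  RInt (V := C_R_CompleteNormedModule)
    (fun t : R => (g (z1 + t * (z2 - z1)) * (z2 - z1))%C) 0 1.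

(** [I_f(A)], computed from the base point [tau0] along a straight segment; for
    a weakly holomorphic modular [f] it depends neither on the path in the
    upper half-plane nor on [tau0]. *)
Definition cycle_integral (f : C -> C) (tau0 : C) (A : mat2) : C :=
  if excluded_middle_informative (hyperbolic A) then
    let Q := form_of A in
    segment_integral
      (fun tau => (f tau * sqrt (IZR (qdisc Q)) / qeval Q tau (RtoC 1))%C)
      tau0 (mobius A tau0)
  else RtoC 0.

(** ** Continued fractions

    Partial quotients are indexed from 0: [a i] is a_(i+1). *)

Fixpoint cf_convergent (a : nat -> nat) (n : nat) : R :=
  match n with
  | O => INR (a O)
  | S k => INR (a O) + / cf_convergent (fun i => a (S i)) k
  end.

Definition is_cf (a : nat -> nat) (x : R) : Prop :=
  (forall i, (1 <= a (S i))%nat) /\ is_lim_seq (cf_convergent a) x.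

Fixpoint complete_quotient (x : R) (i : nat) : R :=
  match i with
  | O => x
  | S j => / frac_part (complete_quotient x j)
  end.

(** The continued fraction expansion of an irrational [x > 0]. *)
Definition partial_quotient (x : R) (i : nat) : nat :=
  Z.to_nat (Int_part (complete_quotient x i)).

(** Partial quotients of [a_1; a_2, ..., a_r, b_1, ..., b_l, b_1, ..., b_l, ...]. *)
Definition eventually_periodic (a b : list nat) (i : nat) : nat :=
  if (i <? length a)%nat then nth i a O
  else nth ((i - length a) mod length b) b O.

Definition quadratic_irrational (x : R) : Prop :=
  (forall p q : Z, q <> 0%Z -> x <> IZR p / IZR q) /\
  exists a b c : Z, a <> 0%Z /\
    IZR a * x * x + IZR b * x + IZR c = 0.

(** ** The matrices A_n and the Lyapunov exponent *)

Definition letter (i : nat) : mat2 := if Nat.even i then mat_T else mat_V.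

(** T^(a 0) V^(a 1) T^(a 2) ..., with [i] blocks *)
Fixpoint cf_word (a : nat -> nat) (i : nat) : mat2 :=
  match i with
  | O => mat_id
  | S j => mat_mul (cf_word a j) (mat_pow (letter j) (a j))
  end.

Fixpoint cf_matrix_from (a : nat -> nat) (i fuel n : nat) : mat2 :=
  match fuel with
  | O => mat_id
  | S m =>
      if (n <=? a i)%nat then mat_pow (letter i) n
      else mat_mul (mat_pow (letter i) (a i))
                   (cf_matrix_from a (S i) m (n - a i))
  end.

(** The product of the first [n] letters of the infinite word
    T^(a 0) V^(a 1) T^(a 2) ...; see [cf_matrix_spec]. Only [a 0] may vanish,
    so [S n] blocks suffice. *)
Definition cf_matrix (a : nat -> nat) (n : nat) : mat2 :=
  cf_matrix_from a O (S n) n.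

Fixpoint quotient_sum (a : nat -> nat) (i : nat) : nat :=
  match i with
  | O => O
  | S j => (quotient_sum a j + a j)%nat
  end.

Lemma mat_mul_id_l (A : mat2) : mat_mul mat_id A = A.
Proof. destruct A; unfold mat_mul, mat_id; cbn [m11 m12 m21 m22]; f_equal; ring. Qed.

Lemma mat_mul_id_r (A : mat2) : mat_mul A mat_id = A.
Proof. destruct A; unfold mat_mul, mat_id; cbn [m11 m12 m21 m22]; f_equal; ring. Qed.

Lemma mat_mul_assoc (A B D : mat2) :
  mat_mul A (mat_mul B D) = mat_mul (mat_mul A B) D.
Proof. unfold mat_mul; cbn [m11 m12 m21 m22]; f_equal; ring. Qed.

Lemma quotient_sum_mono (a : nat -> nat) (i d : nat) :
  (quotient_sum a i <= quotient_sum a (i + d))%nat.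
Proof.
induction d as [|d IH].
- rewrite Nat.add_0_r; lia.
- rewrite Nat.add_succ_r; cbn; lia.
Qed.

Lemma cf_matrix_from_spec (a : nat -> nat) (i k : nat) :
  (forall j, (1 <= a (S j))%nat) -> (k <= a i)%nat ->
  forall d j fuel, (j + d = i)%nat ->
    (quotient_sum a i + k - quotient_sum a j
       + (if (j =? 0)%nat then 1 else 0) <= fuel)%nat ->
    (1 <= fuel)%nat ->
    mat_mul (cf_word a j)
      (cf_matrix_from a j fuel (quotient_sum a i + k - quotient_sum a j)) =
    mat_mul (cf_word a i) (mat_pow (letter i) k).
Proof.
intros Ha Hk d; induction d as [|d IH]; intros j fuel Hj Hf Hf1;
  (destruct fuel as [|m]; [lia|]).
- replace j with i by lia.
  replace (quotient_sum a i + k - quotient_sum a i)%nat with k by lia.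
  cbn. now rewrite (proj2 (Nat.leb_le k (a i)) Hk).
- assert (Hm : (quotient_sum a (S j) <= quotient_sum a i)%nat).
  { replace i with (S j + d)%nat by lia. apply quotient_sum_mono. }
  assert (Hs : quotient_sum a (S j) = (quotient_sum a j + a j)%nat)
    by reflexivity.
  cbn [cf_matrix_from].
  destruct (Nat.leb_spec (quotient_sum a i + k - quotient_sum a j) (a j))
    as [Hle|Hlt].
  + assert (Hk0 : k = O) by lia.
    assert (He : quotient_sum a i = quotient_sum a (S j)) by lia.
    assert (Hi : i = S j).
    { destruct d as [|d]; [lia|].
      assert (H2 : (quotient_sum a (S (S j)) <= quotient_sum a i)%nat).
      { replace i with (S (S j) + d)%nat by lia. apply quotient_sum_mono. }
      assert (H3 : quotient_sum a (S (S j))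
                   = (quotient_sum a (S j) + a (S j))%nat) by reflexivity.
      specialize (Ha j); lia. }
    rewrite Hk0, He, Hi; cbn [mat_pow cf_word].
    rewrite mat_mul_id_r. f_equal. f_equal. lia.
  + rewrite mat_mul_assoc.
    change (mat_mul (cf_word a j) (mat_pow (letter j) (a j)))
      with (cf_word a (S j)).
    replace (quotient_sum a i + k - quotient_sum a j - a j)%nat
      with (quotient_sum a i + k - quotient_sum a (S j))%nat by lia.
    apply IH; [lia| |]; destruct j as [|j]; cbn [Nat.eqb] in *; try lia;
      specialize (Ha j); lia.
Qed.

Lemma cf_matrix_spec (a : nat -> nat) (i k : nat) :
  (forall j, (1 <= a (S j))%nat) -> (k <= a i)%nat ->
  cf_matrix a (quotient_sum a i + k) =
  mat_mul (cf_word a i) (mat_pow (letter i) k).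
Proof.
intros Ha Hk.
rewrite <- (cf_matrix_from_spec a i k Ha Hk i O (S (quotient_sum a i + k)));
  cbn [Nat.eqb quotient_sum cf_word]; try lia.
rewrite mat_mul_id_l, Nat.sub_0_r; reflexivity.
Qed.

(** The term [n = 0] (division by zero) does not affect the limsup. *)
Definition lyapunov (f : C -> C) (tau0 : C) (x : R) : Rbar :=
  LimSup_seq (fun n =>
    Re (cycle_integral f tau0 (cf_matrix (partial_quotient x) n)) / INR n).

(* Main.v *)
(** Both [T] and [V] map [rho = e^(2 pi i / 3)] to [rho + 1].  Hence for a word [A = L_1 ... L_n] in
    [T] and [V] the path from [rho] to [A rho] may be taken through the points [L_1 ... L_k rho], and
    [I_f(A)] becomes a sum of [n] integrals over the unit arc from [rho] to [rho + 1], the k-th one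
    of [f(tau) (1/(tau - w_k) - 1/(tau - v_k))] with [w_k < 0 < v_k] the fixed points of the k-th
    cyclic rotation of [A].  On the arc [f] is real, and the real part of the remaining kernel is
    positive and invariant under [(w, v) -> (1/w, 1/v)], that is under exchanging [T] and [V].  Hence
    [Re I_f(A) > 0] unless [f] vanishes on the arc, and the parity of the length of the preperiod is
    irrelevant.  If [f] vanished on the arc, then by Cauchy's theorem so would all its Fourier
    coefficients, which are integrals of [f q^k] from [rho] to [rho + 1].

    The matrices [A_n] have the form [P B^m S] with [B] the period and [P], [S] words of bounded
    length.  Since [B] contracts the positive half-line and its inverse the negative one, the fixed
    points of most cyclic rotations of [A_n] are exponentially close to those of the corresponding
    rotation of [B], so [I_f(A_n) = m I_f(B) + O(1)]. *)

Require Import Defs.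
From Stdlib Require Import Reals ZArith List Arith Lra Lia Psatz ClassicalEpsilon.
From Stdlib Require Import FunctionalExtensionality.
From Coquelicot Require Import Coquelicot.
Open Scope R_scope.

(** * Complex derivatives *)

(** The cutting is done by a cocycle whose poles need not be fixed by anything: for any w < 0 < v,
    [cocycle f z0 M w v] integrates f against the kernel with poles w and Mv, and its value on a
    product MN is the value of M at (w, Nv) plus that of N at (M^-1 w, v). Nonnegative entries
    preserve the signs of the poles. All estimates are uniform in such pairs, so the axis of A_n,
    which varies with n, never has to be located. Every integral is treated as the increment of a
    primitive on the half-plane, whose existence comes from Goursat's argument. Invariance then
    becomes a statement about the derivative of P(Mz), and an integral over the arc becomes an
    increment of the real function Re P(e^(it)), to which the mean value theorem applies. The
    bounded error gives a genuine limit, of which the limsup is a special case. *)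

Notation Cderive f z l := (is_derive (K := C_AbsRing) (V := C_NormedModule) f z l).

Lemma Cderive_iff (f : C -> C) (z l : C) :
  Cderive f z l <->
  forall eps, 0 < eps -> exists delta, 0 < delta /\ forall y,
    Cmod (y - z) < delta -> Cmod (f y - f z - (y - z) * l)%C <= eps * Cmod (y - z).
Proof.
split.
- intros [_ H] eps He.
  destruct (H z (fun P HP => HP) (mkposreal eps He)) as [d Hd].
  exists d; split; [apply cond_pos|intros y Hy; exact (Hd y Hy)].
- intros H; split; [apply is_linear_scal_l|].
  intros x Hx eps.
  rewrite <- (is_filter_lim_locally_unique (V := AbsRing_NormedModule C_AbsRing) z x Hx).
  destruct (H eps (cond_pos eps)) as (d & Hd & H').
  exists (mkposreal d Hd); intros y Hy; exact (H' y Hy).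
Qed.

(* [C_NormedModule] and [AbsRing_NormedModule C_AbsRing] share their norm but not their balls. *)
Lemma Cderive_abs (f : C -> C) (z l : C) :
  Cderive f z l <-> is_derive (K := C_AbsRing) (V := AbsRing_NormedModule C_AbsRing) f z l.
Proof. split; intros [_ H]; (split; [apply is_linear_scal_l|exact H]). Qed.

Lemma Cderive_mult (f g : C -> C) (z df dg : C) :
  Cderive f z df -> Cderive g z dg ->
  Cderive (fun t => f t * g t)%C z (df * g z + f z * dg)%C.
Proof.
intros Hf%Cderive_abs Hg%Cderive_abs; apply Cderive_abs.
exact (is_derive_mult (K := C_AbsRing) f g z df dg Hf Hg Cmult_comm).
Qed.

Lemma Cderive_comp (f g : C -> C) (z df dg : C) :
  Cderive f (g z) df -> Cderive g z dg -> Cderive (fun t => f (g t)) z (dg * df)%C.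
Proof.
intros Hf Hg%Cderive_abs.
exact (is_derive_comp (K := C_AbsRing) (V := C_NormedModule) f g z df dg Hf Hg).
Qed.

Lemma Cderive_plus (f g : C -> C) (z df dg : C) :
  Cderive f z df -> Cderive g z dg -> Cderive (fun t => f t + g t)%C z (df + dg)%C.
Proof. intros Hf Hg; exact (is_derive_plus (K := C_AbsRing) (V := C_NormedModule) f g z df dg Hf Hg). Qed.

Lemma Cderive_minus (f g : C -> C) (z df dg : C) :
  Cderive f z df -> Cderive g z dg -> Cderive (fun t => f t - g t)%C z (df - dg)%C.
Proof. intros Hf Hg; exact (is_derive_minus (K := C_AbsRing) (V := C_NormedModule) f g z df dg Hf Hg). Qed.

Lemma Cderive_const (a z : C) : Cderive (fun _ => a) z (RtoC 0).
Proof. exact (is_derive_const (K := C_AbsRing) (V := C_NormedModule) a z). Qed.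

Lemma Cderive_id (z : C) : Cderive (fun t => t) z (RtoC 1).
Proof. apply Cderive_abs; exact (is_derive_id (K := C_AbsRing) z). Qed.

Lemma Cderive_affine (a b z : C) : Cderive (fun t => a * t + b)%C z a.
Proof.
assert (E : (RtoC 0 * z + a * RtoC 1 + RtoC 0)%C = a) by ring.
refine (eq_ind _ (fun l => Cderive (fun t => a * t + b)%C z l) _ _ E).
apply (Cderive_plus (fun t => a * t)%C (fun _ => b)); [|apply Cderive_const].
apply (Cderive_mult (fun _ => a) (fun t => t)); [apply Cderive_const|apply Cderive_id].
Qed.

Lemma Cderive_bound (f : C -> C) (z l : C) :
  Cderive f z l -> exists delta, 0 < delta /\ forall y, Cmod (y - z) < delta ->
    Cmod (f y - f z) <= (Cmod l + 1) * Cmod (y - z).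
Proof.
intros H; destruct (proj1 (Cderive_iff _ _ _) H 1 Rlt_0_1) as (d & Hd & H').
exists d; split; [exact Hd|intros y Hy; specialize (H' y Hy)].
replace (f y - f z)%C with ((f y - f z - (y - z) * l) + (y - z) * l)%C by ring.
eapply Rle_trans; [apply Cmod_triangle|]. rewrite Cmod_mult; nra.
Qed.

Lemma Cderive_inv (z : C) : z <> RtoC 0 -> Cderive Cinv z (- / (z * z))%C.
Proof.
intros Hz; apply Cderive_iff; intros eps He.
assert (Hm : 0 < Cmod z) by now apply Cmod_gt_0.
set (m := Cmod z) in *.
(* The remainder is exactly (y - z)^2 / (z^2 y). The first radius keeps |y| >= m / 2; the second
   makes the resulting bound 2 |y - z|^2 / m^3 at most eps |y - z|. *)
exists (Rmin (m / 2) (eps * (m * m * m) / 2)); split.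
{ apply Rmin_pos; [lra|]. apply Rdiv_lt_0_compat; [|lra]. repeat apply Rmult_lt_0_compat; lra. }
intros y Hy.
assert (Hy1 : Cmod (y - z) < m / 2) by (eapply Rlt_le_trans; [exact Hy|apply Rmin_l]).
assert (Hy2 : Cmod (y - z) < eps * (m * m * m) / 2) by (eapply Rlt_le_trans; [exact Hy|apply Rmin_r]).
assert (Hym : m / 2 <= Cmod y).
{ assert (H := Cmod_triangle y (z - y)).
  replace (y + (z - y))%C with z in H by ring.
  rewrite <- (Cmod_opp (z - y)) in H.
  replace (- (z - y))%C with (y - z)%C in H by ring. fold m in H; lra. }
assert (Hy0 : y <> RtoC 0) by (apply Cmod_gt_0; lra).
replace (/ y - / z - (y - z) * - / (z * z))%C with ((y - z) * (y - z) * / (z * z * y))%C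
  by (field; split; assumption).
assert (Hzzy : (z * z * y)%C <> RtoC 0) by (repeat apply Cmult_neq_0; assumption).
rewrite !Cmod_mult, Cmod_inv, !Cmod_mult by assumption. fold m.
set (d := Cmod (y - z)) in *. assert (0 <= d) by apply Cmod_ge_0.
assert (H1 : / (m * m * Cmod y) <= / (m * m * (m / 2))).
{ apply Rinv_le_contravar; [repeat apply Rmult_lt_0_compat; lra|].
  apply Rmult_le_compat_l; [nra|exact Hym]. }
apply Rle_trans with (d * d * / (m * m * (m / 2))); [apply Rmult_le_compat_l; [nra|exact H1]|].
rewrite (Rmult_comm eps), Rmult_assoc. apply Rmult_le_compat_l; [assumption|].
apply Rmult_le_reg_r with (m * m * (m / 2)); [repeat apply Rmult_lt_0_compat; lra|].
rewrite Rmult_assoc, Rinv_l by (apply Rgt_not_eq; repeat apply Rmult_lt_0_compat; lra). lra.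
Qed.

(** * Curves in the plane, differentiated over the reals *)

Notation Rderive_C g t l := (is_derive (K := R_AbsRing) (V := C_R_NormedModule) g t l).

Lemma Rderive_C_iff (g : R -> C) (t : R) (l : C) :
  Rderive_C g t l <->
  forall eps, 0 < eps -> exists delta, 0 < delta /\ forall s,
    Rabs (s - t) < delta -> Cmod (g s - g t - RtoC (s - t) * l)%C <= eps * Rabs (s - t).
Proof.
assert (Hs : forall s, Cmod (g s - g t - RtoC (s - t) * l)%C
   = norm (K := R_AbsRing) (V := C_R_NormedModule)
      (minus (minus (g s) (g t)) (scal (minus s t) l))).
{ intros s; rewrite <- scal_R_Cmult; apply Cmod_norm. }
split.
- intros [_ H] eps He.
  destruct (H t (fun P HP => HP) (mkposreal eps He)) as [d Hd].
  exists d; split; [apply cond_pos|intros s Hy; rewrite Hs; exact (Hd s Hy)].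
- intros H; split; [apply is_linear_scal_l|].
  intros x Hx eps.
  rewrite <- (is_filter_lim_locally_unique (V := R_NormedModule) t x Hx).
  destruct (H eps (cond_pos eps)) as (d & Hd & H').
  exists (mkposreal d Hd); intros s Hy.
  specialize (H' s Hy). rewrite Hs in H'. exact H'.
Qed.

(** Mixed chain rule: the outer derivative is C-linear, the inner one R-linear. The increment is the
    remainder of f at [g s] plus df times the remainder of g, and each is held below half of eps |s
    - t|. *)
Lemma Rderive_C_comp (f : C -> C) (g : R -> C) (t : R) (df dg : C) :
  Cderive f (g t) df -> Rderive_C g t dg -> Rderive_C (fun s => f (g s)) t (dg * df)%C.
Proof.
intros Hf Hg; apply Rderive_C_iff; intros eps He.
set (A := Cmod dg + 1). set (B := Cmod df + 1).
assert (HA : 0 < A) by (unfold A; generalize (Cmod_ge_0 dg); lra).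
assert (HB : 0 < B) by (unfold B; generalize (Cmod_ge_0 df); lra).
destruct (proj1 (Cderive_iff _ _ _) Hf (eps / (2 * A))) as (d1 & Hd1 & H1).
{ apply Rdiv_lt_0_compat; lra. }
destruct (proj1 (Rderive_C_iff _ _ _) Hg 1 Rlt_0_1) as (d2 & Hd2 & H2).
destruct (proj1 (Rderive_C_iff _ _ _) Hg (eps / (2 * B))) as (d3 & Hd3 & H3).
{ apply Rdiv_lt_0_compat; lra. }
assert (Hd1A : 0 < d1 / A) by (apply Rdiv_lt_0_compat; lra).
exists (Rmin (Rmin d2 d3) (d1 / A)); split.
{ repeat apply Rmin_pos; assumption. }
intros s Hs.
assert (Hs1 : Rabs (s - t) < d1 / A) by (eapply Rlt_le_trans; [exact Hs|apply Rmin_r]).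
assert (Hs' : Rabs (s - t) < Rmin d2 d3) by (eapply Rlt_le_trans; [exact Hs|apply Rmin_l]).
assert (Hs2 : Rabs (s - t) < d2) by (eapply Rlt_le_trans; [exact Hs'|apply Rmin_l]).
assert (Hs3 : Rabs (s - t) < d3) by (eapply Rlt_le_trans; [exact Hs'|apply Rmin_r]).
specialize (H2 s Hs2); specialize (H3 s Hs3).
assert (H0 := Rabs_pos (s - t)).
assert (Hgs : Cmod (g s - g t) <= A * Rabs (s - t)).
{ replace (g s - g t)%C with ((g s - g t - RtoC (s - t) * dg) + RtoC (s - t) * dg)%C by ring.
  eapply Rle_trans; [apply Cmod_triangle|]. rewrite Cmod_mult, Cmod_R; unfold A; nra. }
assert (Hlt : Cmod (g s - g t) < d1).
{ eapply Rle_lt_trans; [exact Hgs|]. replace d1 with (A * (d1 / A)) by (field; lra).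
  apply Rmult_lt_compat_l; assumption. }
specialize (H1 (g s) Hlt).
replace (f (g s) - f (g t) - RtoC (s - t) * (dg * df))%C with
  ((f (g s) - f (g t) - (g s - g t) * df) + (g s - g t - RtoC (s - t) * dg) * df)%C by ring.
eapply Rle_trans; [apply Cmod_triangle|]. rewrite Cmod_mult.
apply Rle_trans with (eps / (2 * A) * (A * Rabs (s - t)) + (eps / (2 * B) * Rabs (s - t)) * B).
- apply Rplus_le_compat.
  + eapply Rle_trans; [exact H1|]. apply Rmult_le_compat_l; [|exact Hgs].
    apply Rlt_le, Rdiv_lt_0_compat; lra.
  + apply Rmult_le_compat; try apply Cmod_ge_0; [exact H3|unfold B; lra].
- right; field; lra.
Qed.

Lemma Rderive_C_Re (g : R -> C) (t : R) (l : C) :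
  Rderive_C g t l -> is_derive (fun s => Re (g s)) t (Re l).
Proof.
intros H.
apply (filterdiff_comp g (fst : C -> R) (fun y => scal y l) fst H).
apply filterdiff_linear, is_linear_fst.
Qed.

Lemma Rderive_C_Im (g : R -> C) (t : R) (l : C) :
  Rderive_C g t l -> is_derive (fun s => Im (g s)) t (Im l).
Proof.
intros H.
apply (filterdiff_comp g (snd : C -> R) (fun y => scal y l) snd H).
apply filterdiff_linear, is_linear_snd.
Qed.

Lemma Rderive_C_pair (u v : R -> R) (t du dv : R) :
  is_derive u t du -> is_derive v t dv -> Rderive_C (fun s => (u s, v s)) t (du, dv).
Proof.
intros Hu Hv; apply Rderive_C_iff; intros eps He.
destruct Hu as [_ Hu]; destruct Hv as [_ Hv].
assert (He2 : 0 < eps / 2) by lra.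
destruct (Hu t (fun P HP => HP) (mkposreal _ He2)) as [d1 H1].
destruct (Hv t (fun P HP => HP) (mkposreal _ He2)) as [d2 H2].
exists (Rmin d1 d2); split; [apply Rmin_pos; apply cond_pos|].
intros s Hs.
specialize (H1 s (Rlt_le_trans _ _ _ Hs (Rmin_l _ _))).
specialize (H2 s (Rlt_le_trans _ _ _ Hs (Rmin_r _ _))).
change (Rabs (u s - u t - (s - t) * du) <= eps / 2 * Rabs (s - t)) in H1.
change (Rabs (v s - v t - (s - t) * dv) <= eps / 2 * Rabs (s - t)) in H2.
replace ((u s, v s) - (u t, v t) - RtoC (s - t) * (du, dv))%C with
  (RtoC (u s - u t - (s - t) * du) + Ci * RtoC (v s - v t - (s - t) * dv))%C
  by (apply injective_projections; simpl; ring).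
eapply Rle_trans; [apply Cmod_triangle|]. rewrite Cmod_mult, Cmod_Ci, !Cmod_R. lra.
Qed.

(** * Cauchy's theorem on the upper half-plane *)

Notation CInt := (RInt (V := C_R_CompleteNormedModule)).

Definition holomorphic_H (g : C -> C) : Prop :=
  forall z, 0 < Im z -> exists l, Cderive g z l.

Definition primitive_H (g P : C -> C) : Prop :=
  forall z, 0 < Im z -> Cderive P z (g z).

Lemma Rderive_C_continuous (u : R -> C) (t : R) (l : C) :
  Rderive_C u t l -> continuous (U := C_R_NormedModule) u t.
Proof. intros H; apply (ex_derive_continuous (V := C_R_NormedModule)); exists l; exact H. Qed.

(** The integrand p integrates exactly to the increment of P, so only u - p has to be estimated.
    Both orders of the endpoints are allowed because a primitive is later tested in all
    directions. *)
Lemma CInt_diff_bound (u p P : R -> C) (a b M : R) :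
  (forall t, Rmin a b <= t <= Rmax a b -> continuous (U := C_R_NormedModule) u t) ->
  (forall t, Rmin a b <= t <= Rmax a b -> continuous (U := C_R_NormedModule) p t) ->
  (forall t, Rmin a b <= t <= Rmax a b -> Rderive_C P t (p t)) ->
  (forall t, Rmin a b <= t <= Rmax a b -> Cmod (u t - p t) <= M) ->
  Cmod (CInt u a b - (P b - P a)) <= Rabs (b - a) * M.
Proof.
intros Hu Hp HP HM.
assert (Iu : is_RInt (V := C_R_CompleteNormedModule) u a b (CInt u a b)).
{ apply RInt_correct, ex_RInt_continuous; exact Hu. }
assert (Ip : is_RInt (V := C_R_CompleteNormedModule) p a b (P b - P a)%C).
{ exact (is_RInt_derive (V := C_R_CompleteNormedModule) P p a b HP Hp). }
assert (I := is_RInt_minus (V := C_R_CompleteNormedModule) u p a b _ _ Iu Ip).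
change (minus (CInt u a b) (P b - P a)%C) with (CInt u a b - (P b - P a))%C in I.
assert (HM' : forall t, Rmin a b <= t <= Rmax a b ->
  norm (K := R_AbsRing) (V := C_R_NormedModule) (minus (u t) (p t)) <= M).
{ intros t Ht; specialize (HM t Ht); rewrite Cmod_norm in HM; exact HM. }
clear HM; rename HM' into HM.
destruct (Rle_dec a b) as [Hab|Hab].
- rewrite Rmin_left, Rmax_right in HM by lra.
  rewrite Rabs_pos_eq by lra.
  rewrite Cmod_norm.
  exact (norm_RInt_le_const (V := C_R_NormedModule) _ _ _ _ _ Hab HM I).
- rewrite Rmin_right, Rmax_left in HM by lra.
  rewrite Rabs_left by lra. replace (- (b - a)) with (a - b) by ring.
  apply is_RInt_swap in I.
  rewrite <- Cmod_opp, Cmod_norm.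
  refine (norm_RInt_le_const (V := C_R_NormedModule) _ _ _ _ _ _ HM I); lra.
Qed.

Lemma Rderive_C_horizontal (t y : R) : Rderive_C (fun s => (s, y)) t (RtoC 1).
Proof.
apply (Rderive_C_pair (fun s => s) (fun _ => y) t 1 0);
  [exact (is_derive_id (K := R_AbsRing) t)|].
exact (is_derive_const (K := R_AbsRing) (V := R_NormedModule) y t).
Qed.

Lemma Rderive_C_vertical (x t : R) : Rderive_C (fun s => (x, s)) t Ci.
Proof.
apply (Rderive_C_pair (fun _ => x) (fun s => s) t 0 1);
  [|exact (is_derive_id (K := R_AbsRing) t)].
exact (is_derive_const (K := R_AbsRing) (V := R_NormedModule) x t).
Qed.

Lemma Rderive_C_linear (a b : C) (t : R) : Rderive_C (fun s => b + RtoC s * a)%C t a.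
Proof.
apply Rderive_C_iff; intros eps He; exists 1; split; [lra|intros s _].
replace (b + RtoC s * a - (b + RtoC t * a) - RtoC (s - t) * a)%C with (RtoC 0)
  by (rewrite RtoC_minus; ring).
rewrite Cmod_0. apply Rmult_le_pos; [lra|apply Rabs_pos].
Qed.

Lemma holomorphic_horizontal (g : C -> C) (t y : R) :
  holomorphic_H g -> 0 < y -> continuous (U := C_R_NormedModule) (fun s => g (s, y)) t.
Proof.
intros Hg Hy; destruct (Hg (t, y) Hy) as [l Hl].
eapply Rderive_C_continuous, (Rderive_C_comp g (fun s => (s, y))); [exact Hl|].
apply Rderive_C_horizontal.
Qed.

Lemma holomorphic_vertical (g : C -> C) (x t : R) :
  holomorphic_H g -> 0 < t -> continuous (U := C_R_NormedModule) (fun s => g (x, s)) t.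
Proof.
intros Hg Hy; destruct (Hg (x, t) Hy) as [l Hl].
eapply Rderive_C_continuous, (Rderive_C_comp g (fun s => (x, s))); [exact Hl|].
apply Rderive_C_vertical.
Qed.

Definition hor_integral (g : C -> C) (x0 x1 y : R) : C := CInt (fun t => g (t, y)) x0 x1.
Definition vert_integral (g : C -> C) (x y0 y1 : R) : C := CInt (fun t => g (x, t)) y0 y1.

(** Counterclockwise contour integral, with dz = i dt on the vertical sides. *)
Definition rect_integral (g : C -> C) (x0 x1 y0 y1 : R) : C :=
  (hor_integral g x0 x1 y0 - hor_integral g x0 x1 y1 +
   Ci * (vert_integral g x1 y0 y1 - vert_integral g x0 y0 y1))%C.

Lemma hor_integral_Chasles (g : C -> C) (x0 x1 x2 y : R) :
  holomorphic_H g -> 0 < y -> (hor_integral g x0 x1 y + hor_integral g x1 x2 y)%C = hor_integral g x0 x2 y.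
Proof.
intros Hg Hy; apply (RInt_Chasles (V := C_R_CompleteNormedModule));
  apply (ex_RInt_continuous (V := C_R_CompleteNormedModule));
  intros t _; now apply holomorphic_horizontal.
Qed.

Lemma Rmin_pos_le (y0 y1 t : R) : 0 < y0 -> 0 < y1 -> Rmin y0 y1 <= t <= Rmax y0 y1 -> 0 < t.
Proof. intros H0 H1 [H _]; eapply Rlt_le_trans; [|exact H]; now apply Rmin_pos. Qed.

Lemma vert_integral_Chasles (g : C -> C) (x y0 y1 y2 : R) :
  holomorphic_H g -> 0 < y0 -> 0 < y1 -> 0 < y2 ->
  (vert_integral g x y0 y1 + vert_integral g x y1 y2)%C = vert_integral g x y0 y2.
Proof.
intros Hg H0 H1 H2; apply (RInt_Chasles (V := C_R_CompleteNormedModule));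
  apply (ex_RInt_continuous (V := C_R_CompleteNormedModule));
  intros t Ht; apply holomorphic_vertical; trivial;
  eapply Rmin_pos_le; [| |exact Ht| | |exact Ht]; assumption.
Qed.

Lemma rect_integral_quarters (g : C -> C) (x0 x1 x2 y0 y1 y2 : R) :
  holomorphic_H g -> 0 < y0 -> 0 < y1 -> 0 < y2 ->
  rect_integral g x0 x2 y0 y2 =
  (rect_integral g x0 x1 y0 y1 + rect_integral g x1 x2 y0 y1 +
   (rect_integral g x0 x1 y1 y2 + rect_integral g x1 x2 y1 y2))%C.
Proof.
intros Hg H0 H1 H2; unfold rect_integral.
rewrite <- (hor_integral_Chasles g x0 x1 x2 y0), <- (hor_integral_Chasles g x0 x1 x2 y2) by assumption.
rewrite <- (vert_integral_Chasles g x0 y0 y1 y2), <- (vert_integral_Chasles g x2 y0 y1 y2) by assumption.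
ring.
Qed.

(** The affine part [L'] of g at p has the primitive [L] and contributes nothing round a closed
    contour. The rest is at most eps / 2 times w + h on a boundary of length 2 (w + h). *)
Lemma rect_integral_local (g : C -> C) (p l : C) (eps : R) :
  holomorphic_H g -> 0 < eps -> Cderive g p l ->
  exists delta, 0 < delta /\ forall x y w h, 0 <= w -> 0 <= h -> w + h < delta -> 0 < y ->
    x <= Re p <= x + w -> y <= Im p <= y + h ->
    Cmod (rect_integral g x (x + w) y (y + h)) <= eps * (w + h) ^ 2.
Proof.
intros Hg He Hl.
destruct (proj1 (Cderive_iff _ _ _) Hl (eps / 2)) as (d & Hd & H); [lra|].
exists d; split; [exact Hd|]; intros x y w h Hw Hh Hwh Hy Hx Hyp.
set (L := fun z : C => (g p * z + l * ((z - p) * (z - p)) / 2)%C).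
set (L' := fun z : C => (g p + l * (z - p))%C).
assert (HL' : forall z, Cderive L' z l).
{ intros z.
  assert (E : forall t, (l * t + (g p - l * p))%C = L' t) by (intros t; unfold L'; ring).
  eapply (is_derive_ext (K := C_AbsRing) (V := C_NormedModule)); [exact E|apply Cderive_affine]. }
assert (HL : forall z, Cderive L z (L' z)).
{ intros z.
  assert (E : forall t, ((g p * t + RtoC 0) + (l / 2 * t + (- (l / 2) * p)) * (1 * t + (- p)))%C = L t).
  { intros t; unfold L; field. }
  eapply (is_derive_ext (K := C_AbsRing) (V := C_NormedModule)); [exact E|].
  assert (E' : (g p + (l / 2 * (1 * z + - p) + (l / 2 * z + - (l / 2) * p) * 1))%C = L' z)
    by (unfold L'; field).
  rewrite <- E'.
  apply (Cderive_plus (fun t => g p * t + RtoC 0)%C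
    (fun t => (l / 2 * t + - (l / 2) * p) * (1 * t + - p))%C); [apply Cderive_affine|].
  apply (Cderive_mult (fun t => l / 2 * t + - (l / 2) * p)%C (fun t => 1 * t + - p)%C);
    apply Cderive_affine. }
assert (Hz : forall s t, x <= s <= x + w -> y <= t <= y + h ->
   Cmod (g (s, t) - L' (s, t)) <= eps / 2 * (w + h)).
{ intros s t Hs Ht.
  assert (Hc : Cmod ((s, t) - p) <= w + h).
  { replace ((s, t) - p)%C with (RtoC (s - Re p) + Ci * RtoC (t - Im p))%C
      by (destruct p; apply injective_projections; simpl; ring).
    eapply Rle_trans; [apply Cmod_triangle|].
    rewrite Cmod_mult, Cmod_Ci, !Cmod_R, Rmult_1_l.
    apply Rplus_le_compat; apply Rabs_le; lra. }
  specialize (H (s, t)).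
  replace (g (s, t) - L' (s, t))%C with (g (s, t) - g p - ((s, t) - p) * l)%C
    by (unfold L'; ring).
  eapply Rle_trans; [apply H; lra|]. apply Rmult_le_compat_l; lra. }
assert (Hh' : forall t, y <= t <= y + h ->
  Cmod (hor_integral g x (x + w) t - (L (x + w, t)%R - L (x, t)))
   <= w * (eps / 2 * (w + h))).
{ intros t Ht.
  apply Rle_trans with (Rabs (x + w - x) * (eps / 2 * (w + h)));
    [|rewrite Rabs_pos_eq by lra; right; ring].
  apply (CInt_diff_bound (fun s => g (s, t)) (fun s => L' (s, t)) (fun s => L (s, t)));
    rewrite Rmin_left, Rmax_right by lra; intros s Hs.
  - apply holomorphic_horizontal; [assumption|lra].
  - eapply Rderive_C_continuous, (Rderive_C_comp L' (fun s => (s, t))); [apply HL'|].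
    apply Rderive_C_horizontal.
  - replace (L' (s, t)) with (RtoC 1 * L' (s, t))%C by ring.
    apply (Rderive_C_comp L (fun s => (s, t))); [apply HL|apply Rderive_C_horizontal].
  - apply Hz; lra. }
assert (Hv' : forall s, x <= s <= x + w ->
  Cmod (vert_integral g s y (y + h) - (- Ci * L (s, y + h)%R - - Ci * L (s, y)))
   <= h * (eps / 2 * (w + h))).
{ intros s Hs.
  apply Rle_trans with (Rabs (y + h - y) * (eps / 2 * (w + h)));
    [|rewrite Rabs_pos_eq by lra; right; ring].
  apply (CInt_diff_bound (fun t => g (s, t)) (fun t => L' (s, t)) (fun t => - Ci * L (s, t))%C);
    rewrite Rmin_left, Rmax_right by lra; intros t Ht.
  - apply holomorphic_vertical; [assumption|lra].
  - eapply Rderive_C_continuous, (Rderive_C_comp L' (fun t => (s, t))); [apply HL'|].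
    apply Rderive_C_vertical.
  - assert (E : (Ci * (L' (s, t) * - Ci))%C = L' (s, t)).
    { replace (Ci * (L' (s, t) * - Ci))%C with (- (Ci * Ci) * L' (s, t))%C by ring.
      apply injective_projections; simpl; ring. }
    rewrite <- E.
    apply (Rderive_C_comp (fun z => - Ci * L z)%C (fun t => (s, t))); [|apply Rderive_C_vertical].
    replace (L' (s, t) * - Ci)%C with (RtoC 0 * L (s, t) + - Ci * L' (s, t))%C by ring.
    apply (Cderive_mult (fun _ => - Ci)%C L); [apply Cderive_const|apply HL].
  - apply Hz; lra. }
unfold rect_integral.
assert (B1 := Hh' y ltac:(lra)). assert (B2 := Hh' (y + h) ltac:(lra)).
assert (B3 := Hv' x ltac:(lra)). assert (B4 := Hv' (x + w) ltac:(lra)).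
set (a1 := hor_integral g x (x + w) y) in *. set (a2 := hor_integral g x (x + w) (y + h)) in *.
set (a3 := vert_integral g x y (y + h)) in *. set (a4 := vert_integral g (x + w) y (y + h)) in *.
assert (Hi : (Ci * Ci)%C = RtoC (-1)) by (apply injective_projections; simpl; ring).
match type of B1 with Cmod ?c <= _ => set (c1 := c) in B1 end.
match type of B2 with Cmod ?c <= _ => set (c2 := c) in B2 end.
match type of B3 with Cmod ?c <= _ => set (c3 := c) in B3 end.
match type of B4 with Cmod ?c <= _ => set (c4 := c) in B4 end.
(* The values of [L] at the four corners cancel, with total coefficient 1 + i^2. *)
replace (a1 - a2 + Ci * (a4 - a3))%C with (c1 - c2 + Ci * (c4 - c3))%C.
2: { unfold c1, c2, c3, c4.
  set (La := L (x + w, y)). set (Lb := L (x, y)). set (Lc := L (x + w, y + h)).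
  set (Ld := L (x, y + h)).
  transitivity (a1 - a2 + Ci * (a4 - a3) + (1 + Ci * Ci) * (Lc - La - Ld + Lb))%C; [ring|].
  rewrite Hi; apply injective_projections; simpl; ring. }
assert (T : Cmod (c1 - c2 + Ci * (c4 - c3)) <= Cmod c1 + Cmod c2 + (Cmod c4 + Cmod c3)).
{ eapply Rle_trans; [apply Cmod_triangle|]. rewrite Cmod_mult, Cmod_Ci, Rmult_1_l.
  apply Rplus_le_compat; (eapply Rle_trans; [apply Cmod_triangle|]; rewrite Cmod_opp; lra). }
nra.
Qed.

(** Serves to pick, generation after generation, a quarter rectangle on which the estimate fails. *)
Lemma dependent_choice_nat {T : Type} (Q : nat -> T -> Prop) (step : nat -> T -> T -> Prop) (p0 : T) :
  Q O p0 -> (forall n p, Q n p -> exists q, Q (S n) q /\ step n p q) ->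
  exists s : nat -> T, s O = p0 /\ forall n, Q n (s n) /\ step n (s n) (s (S n)).
Proof.
intros H0 HS.
set (s := fix s n := match n with O => p0
  | S k => epsilon (inhabits p0) (fun q => Q (S k) q /\ step k (s k) q) end).
assert (H : forall n, Q n (s n)).
{ induction n as [|n IH]; [exact H0|].
  exact (proj1 (epsilon_spec (inhabits p0) _ (HS n (s n) IH))). }
exists s; split; [reflexivity|intros n; split; [apply H|]].
exact (proj2 (epsilon_spec (inhabits p0) _ (HS n (s n) (H n)))).
Qed.

(** The common point is the supremum of the left ends, since the right ends x n + w / 2^n
    decrease. *)
Lemma nested_halving (x : nat -> R) (w : R) :
  (forall n, x n <= x (S n) <= x n + w / 2 ^ S n) ->
  exists p, forall n, x n <= p <= x n + w / 2 ^ n.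
Proof.
intros H.
assert (Hw : 0 <= w) by (specialize (H O); simpl in H; lra).
assert (Hpow : forall n, w / 2 ^ n = 2 * (w / 2 ^ S n)).
{ intros n; simpl; field. apply pow_nonzero; lra. }
assert (Hpp : forall n, 0 <= w / 2 ^ n).
{ intros n. apply Rmult_le_pos; [exact Hw|].
  apply Rlt_le, Rinv_0_lt_compat, pow_lt; lra. }
assert (Hinc : forall n k, x n <= x (n + k)%nat).
{ intros n; induction k as [|k IH]; [rewrite Nat.add_0_r; lra|].
  rewrite Nat.add_succ_r; specialize (H (n + k)%nat); lra. }
assert (Hdec : forall n k, x (n + k)%nat + w / 2 ^ (n + k) <= x n + w / 2 ^ n).
{ intros n; induction k as [|k IH]; [rewrite Nat.add_0_r; lra|].
  rewrite Nat.add_succ_r; specialize (H (n + k)%nat); specialize (Hpow (n + k)%nat); lra. }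
destruct (completeness (fun y => exists n, y = x n)) as [p [Hp1 Hp2]].
- exists (x O + w / 2 ^ 0); intros y [n ->]. specialize (Hdec O n); specialize (Hpp n).
  simpl in *; lra.
- exists (x O), O; reflexivity.
- exists p; intros n; split; [apply Hp1; now exists n|].
  apply Hp2; intros y [m ->].
  destruct (Nat.le_ge_cases n m) as [Hm|Hm].
  + replace m with (n + (m - n))%nat by lia.
    specialize (Hdec n (m - n)%nat); specialize (Hpp (n + (m - n))%nat); lra.
  + specialize (Hinc m (n - m)%nat). replace (m + (n - m))%nat with n in Hinc by lia.
    specialize (Hpp n); lra.
Qed.

(** Goursat: a nonzero contour integral leaves, at every scale, a subrectangle whose integral is
    large compared with the square of its size. At the common point of these rectangles this
    contradicts [rect_integral_local]. *)
Lemma rect_integral_zero_le (g : C -> C) (x y w h : R) :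
  holomorphic_H g -> 0 < y -> 0 <= w -> 0 <= h -> rect_integral g x (x + w) y (y + h) = RtoC 0.
Proof.
intros Hg Hy Hw Hh.
destruct (Req_dec (Cmod (rect_integral g x (x + w) y (y + h))) 0) as [E|E];
  [now apply Cmod_eq_0|exfalso].
set (m := Cmod (rect_integral g x (x + w) y (y + h))) in *.
assert (Hm : 0 < m) by (generalize (Cmod_ge_0 (rect_integral g x (x + w) y (y + h))); fold m; lra).
(* Small enough for the whole rectangle to violate the local estimate; the 1 covers a degenerate
   rectangle with w + h = 0. *)
set (eps := m / (2 * ((w + h) ^ 2 + 1))).
assert (Hsq : 0 <= (w + h) ^ 2) by apply pow2_ge_0.
assert (He : 0 < eps) by (apply Rdiv_lt_0_compat; lra).
assert (Hem : eps * (w + h) ^ 2 < m).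
{ unfold eps. apply Rmult_lt_reg_r with (2 * ((w + h) ^ 2 + 1)); [lra|].
  replace (m / (2 * ((w + h) ^ 2 + 1)) * (w + h) ^ 2 * (2 * ((w + h) ^ 2 + 1)))
    with (m * (w + h) ^ 2) by (field; lra). nra. }
(* The threshold is quadratic in the side lengths, so it is divided by exactly 4 at each halving. *)
set (bad := fun n (p : R * R) => y <= snd p /\
   eps * (w / 2 ^ n + h / 2 ^ n) ^ 2 <
   Cmod (rect_integral g (fst p) (fst p + w / 2 ^ n) (snd p) (snd p + h / 2 ^ n))).
set (near := fun n (p q : R * R) =>
   fst p <= fst q <= fst p + w / 2 ^ S n /\ snd p <= snd q <= snd p + h / 2 ^ S n).
assert (Hpow : forall v n, v / 2 ^ n = v / 2 ^ S n + v / 2 ^ S n).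
{ intros v n; simpl; field. apply pow_nonzero; lra. }
assert (Hpp : forall v n, 0 <= v -> 0 <= v / 2 ^ n).
{ intros v n Hv. apply Rmult_le_pos; [exact Hv|].
  apply Rlt_le, Rinv_0_lt_compat, pow_lt; lra. }
destruct (dependent_choice_nat bad near (x, y)) as (s & _ & Hs).
- split; simpl; [lra|]. rewrite !Rdiv_1_r. exact Hem.
- intros n [a b] [Hb Hbad]; simpl in Hb; cbn [fst snd] in Hbad.
  assert (Hw' := Hpp w (S n) Hw). assert (Hh' := Hpp h (S n) Hh).
  assert (Hwn := Hpow w n). assert (Hhn := Hpow h n).
  set (w' := w / 2 ^ S n) in *. set (h' := h / 2 ^ S n) in *.
  rewrite Hwn, Hhn, <- !Rplus_assoc in Hbad.
  rewrite (rect_integral_quarters g a (a + w') (a + w' + w') b (b + h') (b + h' + h'))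
    in Hbad by (assumption || lra).
  assert (Hx : forall a' b', a <= a' <= a + w' -> b <= b' <= b + h' ->
    eps * (w' + h') ^ 2 < Cmod (rect_integral g a' (a' + w') b' (b' + h')) ->
    exists q, bad (S n) q /\ near n (a, b) q).
  { intros a' b' Ha Hb' H'. exists (a', b'). unfold bad, near; simpl fst; simpl snd.
    fold w' h'. repeat split; lra. }
  destruct (Rlt_dec (eps * (w' + h') ^ 2)
    (Cmod (rect_integral g a (a + w') b (b + h')))) as [H1|H1];
    [apply (Hx a b); try lra; exact H1|].
  destruct (Rlt_dec (eps * (w' + h') ^ 2)
    (Cmod (rect_integral g (a + w') (a + w' + w') b (b + h')))) as [H2|H2];
    [apply (Hx (a + w') b); try lra; exact H2|].
  destruct (Rlt_dec (eps * (w' + h') ^ 2)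
    (Cmod (rect_integral g a (a + w') (b + h') (b + h' + h')))) as [H3|H3];
    [apply (Hx a (b + h')); try lra; exact H3|].
  destruct (Rlt_dec (eps * (w' + h') ^ 2)
    (Cmod (rect_integral g (a + w') (a + w' + w') (b + h') (b + h' + h')))) as [H4|H4];
    [apply (Hx (a + w') (b + h')); try lra; exact H4|].
  (* If no quarter is bad, the four bounds add up to the bound for the parent: 4 (w' + h')^2 = (2 w'
     + 2 h')^2. *)
  exfalso. apply (Rlt_not_le _ _ Hbad).
  eapply Rle_trans; [apply Cmod_triangle|].
  eapply Rle_trans; [apply Rplus_le_compat; apply Cmod_triangle|]. nra.
- destruct (nested_halving (fun n => fst (s n)) w) as [px Hpx];
    [intros n; exact (proj1 (proj2 (Hs n)))|].
  destruct (nested_halving (fun n => snd (s n)) h) as [py Hpy];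
    [intros n; exact (proj2 (proj2 (Hs n)))|].
  assert (Hpy0 : 0 < py) by (destruct (Hs O) as [[H0 _] _]; specialize (Hpy O); lra).
  destruct (Hg (px, py) Hpy0) as [l Hl].
  destruct (rect_integral_local g (px, py) l eps Hg He Hl) as (d & Hd & H).
  assert (Hn : exists n, (w + h) / 2 ^ n < d).
  { destruct (pow_lt_1_zero (/ 2) ltac:(rewrite Rabs_pos_eq; lra) (d / (w + h + 1)))
      as [n Hn]; [apply Rdiv_lt_0_compat; lra|].
    exists n. specialize (Hn n (le_n n)). rewrite pow_inv in Hn.
    assert (Hip : 0 < / 2 ^ n) by (apply Rinv_0_lt_compat, pow_lt; lra).
    rewrite Rabs_pos_eq in Hn by lra.
    apply Rle_lt_trans with ((w + h + 1) * / 2 ^ n); [unfold Rdiv; nra|].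
    replace d with ((w + h + 1) * (d / (w + h + 1))) by (field; lra).
    apply Rmult_lt_compat_l; [lra|exact Hn]. }
  destruct Hn as [n Hn].
  destruct (Hs n) as [[H0 Hb] _].
  apply (Rlt_not_le _ _ Hb). apply H; try (apply Hpp; assumption); [|lra|apply Hpx|apply Hpy].
  unfold Rdiv in *; lra.
Qed.

Lemma hor_integral_swap (g : C -> C) (x0 x1 y : R) :
  holomorphic_H g -> 0 < y -> hor_integral g x1 x0 y = (- hor_integral g x0 x1 y)%C.
Proof.
intros Hg Hy; symmetry; apply (opp_RInt_swap (V := C_R_CompleteNormedModule)).
apply (ex_RInt_continuous (V := C_R_CompleteNormedModule)).
intros t _; now apply holomorphic_horizontal.
Qed.

Lemma vert_integral_swap (g : C -> C) (x y0 y1 : R) :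
  holomorphic_H g -> 0 < y0 -> 0 < y1 -> vert_integral g x y1 y0 = (- vert_integral g x y0 y1)%C.
Proof.
intros Hg H0 H1; symmetry; apply (opp_RInt_swap (V := C_R_CompleteNormedModule)).
apply (ex_RInt_continuous (V := C_R_CompleteNormedModule)).
intros t Ht; apply holomorphic_vertical; trivial.
eapply Rmin_pos_le; [| |exact Ht]; assumption.
Qed.

Theorem rect_integral_zero (g : C -> C) (x0 x1 y0 y1 : R) :
  holomorphic_H g -> 0 < y0 -> 0 < y1 -> rect_integral g x0 x1 y0 y1 = RtoC 0.
Proof.
intros Hg.
assert (H1 : forall x0 x1 y0 y1, 0 < y0 -> x0 <= x1 -> y0 <= y1 ->
  rect_integral g x0 x1 y0 y1 = RtoC 0).
{ intros a a' b b' Hb Ha Hb'.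
  replace a' with (a + (a' - a)) by ring. replace b' with (b + (b' - b)) by ring.
  apply rect_integral_zero_le; trivial; lra. }
assert (H2 : forall x0 x1 y0 y1, 0 < y0 -> 0 < y1 -> x0 <= x1 ->
  rect_integral g x0 x1 y0 y1 = RtoC 0).
{ intros a a' b b' Hb Hb' Ha. destruct (Rle_dec b b') as [H|H]; [now apply H1|].
  transitivity (- rect_integral g a a' b' b)%C; [|rewrite H1 by lra; ring].
  unfold rect_integral. rewrite (vert_integral_swap g a b' b),
    (vert_integral_swap g a' b' b) by assumption. ring. }
intros Hy0 Hy1. destruct (Rle_dec x0 x1) as [H|H]; [now apply H2|].
transitivity (- rect_integral g x1 x0 y0 y1)%C; [|rewrite H2 by lra; ring].
unfold rect_integral. rewrite (hor_integral_swap g x1 x0 y0),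
  (hor_integral_swap g x1 x0 y1) by assumption. ring.
Qed.

Lemma Cmod_le_sum (z : C) : Cmod z <= Rabs (Re z) + Rabs (Im z).
Proof.
replace z with (RtoC (Re z) + Ci * RtoC (Im z))%C at 1
  by (destruct z; apply injective_projections; simpl; ring).
eapply Rle_trans; [apply Cmod_triangle|]. rewrite Cmod_mult, Cmod_Ci, !Cmod_R; lra.
Qed.

Lemma im_le_Cmod (z : C) : Rabs (Im z) <= Cmod z.
Proof. eapply Rle_trans; [|apply Rmax_Cmod]; apply Rmax_r. Qed.

Lemma between_dist (a b t : R) : Rmin a b <= t <= Rmax a b -> Rabs (t - a) <= Rabs (b - a).
Proof.
unfold Rmin, Rmax; destruct (Rle_dec a b); intros H;
  [rewrite !Rabs_pos_eq by lra; lra|rewrite (Rabs_left1 (t - a)), (Rabs_left1 (b - a)) by lra; lra].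
Qed.

(** P integrates from i along the height 1 and then vertically; [rect_integral_zero] allows the
    other corner, up along Re = 0 and then across. Using both forms, P y - P z is an integral over
    an L-shaped path close to z. *)
Theorem exists_primitive_H (g : C -> C) : holomorphic_H g -> exists P, primitive_H g P.
Proof.
intros Hg.
set (P := fun z : C => (hor_integral g 0 (Re z) 1 + Ci * vert_integral g (Re z) 1 (Im z))%C).
assert (HP2 : forall z, 0 < Im z ->
  P z = (hor_integral g 0 (Re z) (Im z) + Ci * vert_integral g 0 1 (Im z))%C).
{ intros z Hz. unfold P.
  assert (H := rect_integral_zero g 0 (Re z) 1 (Im z) Hg Rlt_0_1 Hz).
  unfold rect_integral in H.
  match goal with |- ?l = ?r =>
    transitivity (r + (hor_integral g 0 (Re z) 1 - hor_integral g 0 (Re z) (Im z) +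
      Ci * (vert_integral g (Re z) 1 (Im z) - vert_integral g 0 1 (Im z))))%C end;
    [ring|rewrite H; ring]. }
exists P; intros z Hz. apply Cderive_iff; intros eps He.
destruct (Hg z Hz) as [l Hl].
destruct (Cderive_bound _ _ _ Hl) as (d1 & Hd1 & H1).
set (K := Cmod l + 1) in H1.
assert (HK : 0 < K) by (unfold K; generalize (Cmod_ge_0 l); lra).
(* The bounds keep the L-shaped path within d1 of z, keep it in the half-plane, and make g vary by
   at most eps / 2 along it. *)
set (d := Rmin (Rmin (d1 / 2) (Im z)) (eps / (4 * K))).
assert (Hd : 0 < d).
{ repeat apply Rmin_pos; try lra. apply Rdiv_lt_0_compat; lra. }
assert (Hda : d <= d1 / 2) by (unfold d; eapply Rle_trans; [apply Rmin_l|apply Rmin_l]).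
assert (Hdb : d <= Im z) by (unfold d; eapply Rle_trans; [apply Rmin_l|apply Rmin_r]).
assert (Hdc : K * (2 * d) <= eps / 2).
{ apply Rle_trans with (K * (2 * (eps / (4 * K)))); [|right; field; lra].
  apply Rmult_le_compat_l; [lra|]. apply Rmult_le_compat_l; [lra|apply Rmin_r]. }
assert (Hclose : forall s t, Rabs (s - Re z) < d -> Rabs (t - Im z) < d ->
  Cmod (g (s, t) - g z) <= eps / 2).
{ intros s t Hs Ht.
  assert (Hc : Cmod ((s, t) - z) <= 2 * d).
  { eapply Rle_trans; [apply Cmod_le_sum|].
    replace (Re ((s, t) - z)) with (s - Re z) by (destruct z; reflexivity).
    replace (Im ((s, t) - z)) with (t - Im z) by (destruct z; reflexivity). lra. }
  assert (Hc' : Cmod ((s, t) - z) < d1).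
  { eapply Rle_lt_trans; [apply Cmod_le_sum|].
    replace (Re ((s, t) - z)) with (s - Re z) by (destruct z; reflexivity).
    replace (Im ((s, t) - z)) with (t - Im z) by (destruct z; reflexivity). lra. }
  eapply Rle_trans; [apply H1, Hc'|].
  eapply Rle_trans; [|exact Hdc]. apply Rmult_le_compat_l; lra. }
exists d; split; [exact Hd|intros y Hy].
assert (Hre : Rabs (Re y - Re z) <= Cmod (y - z)).
{ replace (Re y - Re z) with (Re (y - z)) by (destruct y, z; reflexivity). apply re_le_Cmod. }
assert (Him : Rabs (Im y - Im z) <= Cmod (y - z)).
{ replace (Im y - Im z) with (Im (y - z)) by (destruct y, z; reflexivity). apply im_le_Cmod. }
assert (Hy0 : 0 < Im y).
{ assert (H := Rabs_def2 (Im y - Im z) d ltac:(lra)). lra. }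
assert (Hh : Cmod (hor_integral g (Re z) (Re y) (Im y) - (0 + RtoC (Re y) * g z - (0 + RtoC (Re z) * g z))%C)
   <= Rabs (Re y - Re z) * (eps / 2)).
{ apply (CInt_diff_bound (fun s => g (s, Im y)) (fun _ => g z) (fun s => 0 + RtoC s * g z)%C).
  - intros t _; now apply holomorphic_horizontal.
  - intros t _; apply continuous_const.
  - intros t _; apply Rderive_C_linear.
  - intros t Ht%between_dist. apply Hclose; lra. }
assert (Hv : Cmod (vert_integral g (Re z) (Im z) (Im y) - (0 + RtoC (Im y) * g z - (0 + RtoC (Im z) * g z))%C)
   <= Rabs (Im y - Im z) * (eps / 2)).
{ apply (CInt_diff_bound (fun s => g (Re z, s)) (fun _ => g z) (fun s => 0 + RtoC s * g z)%C).
  - intros t Ht; apply holomorphic_vertical; [assumption|].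
    eapply Rmin_pos_le; [| |exact Ht]; assumption.
  - intros t _; apply continuous_const.
  - intros t _; apply Rderive_C_linear.
  - intros t Ht%between_dist. apply Hclose; [rewrite Rminus_diag, Rabs_R0; exact Hd|lra]. }
match type of Hh with Cmod ?c <= _ => set (ch := c) in Hh end.
match type of Hv with Cmod ?c <= _ => set (cv := c) in Hv end.
replace (P y - P z - (y - z) * g z)%C with (ch + Ci * cv)%C.
- eapply Rle_trans; [apply Cmod_triangle|]. rewrite Cmod_mult, Cmod_Ci. nra.
- rewrite (HP2 y Hy0), (HP2 z Hz).
  (* The corner of the L-shaped path is where the two expressions for P are glued. *)
  assert (E1 : P (Re z, Im y) = (hor_integral g 0 (Re z) (Im y) + Ci * vert_integral g 0 1 (Im y))%C)
    by (apply (HP2 (Re z, Im y)); exact Hy0).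
  assert (E2 := HP2 z Hz).
  unfold P in E1, E2. cbn [Re Im fst snd] in E1. change (fst z) with (Re z) in *.
  unfold ch, cv.
  assert (C1 := hor_integral_Chasles g 0 (Re z) (Re y) (Im y) Hg Hy0).
  assert (C2 := vert_integral_Chasles g (Re z) 1 (Im z) (Im y) Hg Rlt_0_1 Hz Hy0).
  rewrite <- C1.
  match goal with |- ?l = _ => transitivity (l + 0)%C; [ring|] end.
  replace (RtoC 0) with ((hor_integral g 0 (Re z) (Im y) + Ci * vert_integral g 0 1 (Im y))
     - (hor_integral g 0 (Re z) 1 + Ci * vert_integral g (Re z) 1 (Im y)))%C
    by (rewrite <- E1; unfold Re, Im; simpl; ring).
  rewrite <- E2, <- C2.
  assert (Ey : y = (RtoC (Re y) + Ci * RtoC (Im y))%C)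
    by (destruct y; apply injective_projections; simpl; ring).
  assert (Ez : z = (RtoC (Re z) + Ci * RtoC (Im z))%C)
    by (destruct z; apply injective_projections; simpl; ring).
  set (yr := Re y) in *; set (yi := Im y) in *; set (zr := Re z) in *; set (zi := Im z) in *.
  replace ((y - z) * g z)%C with (((RtoC yr + Ci * RtoC yi) - (RtoC zr + Ci * RtoC zi)) * g z)%C
    by (rewrite <- Ey, <- Ez; reflexivity).
  ring.
Qed.

(** * Segment integrals and the cocycle of a matrix *)

Lemma Im_segment (z1 z2 : C) (t : R) :
  Im (z1 + RtoC t * (z2 - z1))%C = (1 - t) * Im z1 + t * Im z2.
Proof. destruct z1, z2; unfold Im; simpl; ring. Qed.

Lemma Im_segment_ge (z1 z2 : C) (t m : R) :
  0 <= t <= 1 -> m <= Im z1 -> m <= Im z2 -> m <= Im (z1 + RtoC t * (z2 - z1))%C.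
Proof. intros Ht H1 H2; rewrite Im_segment; nra. Qed.

Lemma Im_segment_pos (z1 z2 : C) (t : R) :
  0 <= t <= 1 -> 0 < Im z1 -> 0 < Im z2 -> 0 < Im (z1 + RtoC t * (z2 - z1))%C.
Proof.
intros Ht H1 H2; apply Rlt_le_trans with (Rmin (Im z1) (Im z2)); [now apply Rmin_pos|].
apply Im_segment_ge; [exact Ht|apply Rmin_l|apply Rmin_r].
Qed.

Lemma unit_interval (t : R) : Rmin 0 1 <= t <= Rmax 0 1 -> 0 <= t <= 1.
Proof. rewrite Rmin_left, Rmax_right by lra; tauto. Qed.

Lemma segment_integrand_continuous (g : C -> C) (z1 z2 : C) (t : R) :
  holomorphic_H g -> 0 < Im z1 -> 0 < Im z2 -> 0 <= t <= 1 ->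
  continuous (U := C_R_NormedModule)
    (fun s : R => (g (z1 + RtoC s * (z2 - z1)) * (z2 - z1))%C) t.
Proof.
intros Hg H1 H2 Ht.
destruct (Hg _ (Im_segment_pos z1 z2 t Ht H1 H2)) as [l Hl].
eapply Rderive_C_continuous.
apply (Rderive_C_comp (fun z => g z * (z2 - z1))%C (fun s => z1 + RtoC s * (z2 - z1))%C);
  [|apply Rderive_C_linear].
apply (Cderive_mult g (fun _ => z2 - z1)%C); [exact Hl|apply Cderive_const].
Qed.

(** From here on, additivity and independence of the path are read off primitives. *)
Lemma segment_integral_primitive (g P : C -> C) (z1 z2 : C) :
  holomorphic_H g -> primitive_H g P -> 0 < Im z1 -> 0 < Im z2 ->
  segment_integral g z1 z2 = (P z2 - P z1)%C.
Proof.
intros Hg HP H1 H2.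
apply (is_RInt_unique (V := C_R_CompleteNormedModule)).
replace (P z2) with (P (z1 + RtoC 1 * (z2 - z1))%C) by (f_equal; ring).
replace (P z1) with (P (z1 + RtoC 0 * (z2 - z1))%C) by (f_equal; ring).
apply (is_RInt_derive (V := C_R_CompleteNormedModule)
  (fun t => P (z1 + RtoC t * (z2 - z1))%C)); intros t Ht%unit_interval.
- rewrite Cmult_comm.
  apply (Rderive_C_comp P (fun s => z1 + RtoC s * (z2 - z1))%C);
    [apply HP; now apply Im_segment_pos|apply Rderive_C_linear].
- now apply segment_integrand_continuous.
Qed.

Lemma segment_integral_bound (g : C -> C) (z1 z2 : C) (M : R) :
  holomorphic_H g -> 0 < Im z1 -> 0 < Im z2 ->
  (forall t, 0 <= t <= 1 -> Cmod (g (z1 + RtoC t * (z2 - z1))%C) <= M) ->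
  Cmod (segment_integral g z1 z2) <= M * Cmod (z2 - z1).
Proof.
intros Hg H1 H2 HM.
assert (H := CInt_diff_bound (fun s : R => (g (z1 + RtoC s * (z2 - z1)) * (z2 - z1))%C)
  (fun _ => RtoC 0) (fun _ => RtoC 0) 0 1 (M * Cmod (z2 - z1))).
replace (Rabs (1 - 0)) with 1 in H by (rewrite Rminus_0_r, Rabs_R1; reflexivity).
replace (segment_integral g z1 z2) with (segment_integral g z1 z2 - (RtoC 0 - RtoC 0))%C by ring.
rewrite Rmult_1_l in H. apply H; intros t Ht%unit_interval.
- now apply segment_integrand_continuous.
- apply continuous_const.
- exact (is_derive_const (K := R_AbsRing) (V := C_R_NormedModule) (RtoC 0) t).
- replace (g (z1 + RtoC t * (z2 - z1)) * (z2 - z1) - 0)%C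
    with (g (z1 + RtoC t * (z2 - z1)) * (z2 - z1))%C by ring.
  rewrite Cmod_mult. apply Rmult_le_compat_r; [apply Cmod_ge_0|now apply HM].
Qed.

Lemma primitive_H_increment (P : C -> C) (z1 z2 : C) :
  primitive_H (fun _ => RtoC 0) P -> 0 < Im z1 -> 0 < Im z2 -> P z2 = P z1.
Proof.
intros HP H1 H2.
assert (Hh : holomorphic_H (fun _ => RtoC 0)) by (intros z _; exists (RtoC 0); apply Cderive_const).
assert (H := segment_integral_bound _ z1 z2 0 Hh H1 H2).
rewrite (segment_integral_primitive _ P) in H by assumption.
assert (E : (P z2 - P z1)%C = RtoC 0).
{ apply Cmod_eq_0, Rle_antisym; [|apply Cmod_ge_0].
  rewrite Rmult_0_l in H; apply H; intros; rewrite Cmod_0; lra. }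
replace (P z2) with (P z2 - P z1 + P z1)%C by ring. rewrite E; ring.
Qed.

Lemma holomorphic_bounded_segment (g : C -> C) (z1 z2 : C) :
  holomorphic_H g -> 0 < Im z1 -> 0 < Im z2 ->
  exists M, 0 <= M /\ forall t, 0 <= t <= 1 -> Cmod (g (z1 + RtoC t * (z2 - z1))%C) <= M.
Proof.
intros Hg H1 H2.
destruct (continuity_ab_maj (fun t => Cmod (g (z1 + RtoC t * (z2 - z1))%C)) 0 1 Rle_0_1)
  as (m & Hm & _).
- intros t Ht. apply continuity_pt_filterlim.
  apply (continuous_comp (V := C_R_NormedModule) (fun t => g (z1 + RtoC t * (z2 - z1))%C) Cmod).
  + destruct (Hg _ (Im_segment_pos z1 z2 t Ht H1 H2)) as [l Hl].
    eapply Rderive_C_continuous.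
    apply (Rderive_C_comp g (fun s => z1 + RtoC s * (z2 - z1))%C); [exact Hl|].
    apply Rderive_C_linear.
  + apply (continuous_ext (T := C_R_NormedModule) norm Cmod); [intros z; symmetry; apply Cmod_norm|].
    exact (filterlim_norm (V := C_R_NormedModule) _).
- exists (Cmod (g (z1 + RtoC m * (z2 - z1))%C)); split; [apply Cmod_ge_0|exact Hm].
Qed.

(** * The kernel with two real poles *)

(** Partial fractions of sqrt(D) / Q(z, 1), with the poles as free parameters not tied to a
    matrix. *)
Definition kern (w v : R) (z : C) : C := (/ (z - RtoC w) - / (z - RtoC v))%C.

Lemma Im_minus_real (z : C) (w : R) : Im (z - RtoC w)%C = Im z.
Proof. destruct z; unfold Im; simpl; ring. Qed.

Lemma H_neq_0 (z : C) : 0 < Im z -> z <> RtoC 0.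
Proof. intros H E; rewrite E in H; unfold Im in H; simpl in H; lra. Qed.

Lemma H_minus_real_neq_0 (z : C) (w : R) : 0 < Im z -> (z - RtoC w)%C <> RtoC 0.
Proof. intros H; apply H_neq_0; now rewrite Im_minus_real. Qed.

Lemma Cmod_inv_le (z : C) (w m : R) : 0 < m -> m <= Im z -> Cmod (/ (z - RtoC w)) <= / m.
Proof.
intros Hm Hz. rewrite Cmod_inv by (apply H_minus_real_neq_0; lra).
apply Rinv_le_contravar; [exact Hm|].
eapply Rle_trans; [|apply im_le_Cmod]. rewrite Im_minus_real, Rabs_pos_eq; lra.
Qed.

Lemma Cderive_inv_shift (w : R) (z : C) : 0 < Im z ->
  Cderive (fun t => / (t - RtoC w))%C z (- / ((z - RtoC w) * (z - RtoC w)))%C.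
Proof.
intros Hz.
assert (H : Cderive (fun t => t - RtoC w)%C z (RtoC 1)).
{ assert (E : forall t, (1 * t + (- RtoC w))%C = (t - RtoC w)%C) by (intros; ring).
  eapply (is_derive_ext (K := C_AbsRing) (V := C_NormedModule)); [exact E|apply Cderive_affine]. }
assert (H' := Cderive_comp Cinv (fun t => t - RtoC w)%C z _ _
  (Cderive_inv _ (H_minus_real_neq_0 z w Hz)) H).
rewrite Cmult_1_l in H'. exact H'.
Qed.

Lemma holomorphic_H_mult (f g : C -> C) :
  holomorphic_H f -> holomorphic_H g -> holomorphic_H (fun z => f z * g z)%C.
Proof.
intros Hf Hg z Hz. destruct (Hf z Hz) as [l Hl]; destruct (Hg z Hz) as [m Hm].
eexists; apply (Cderive_mult f g); [exact Hl|exact Hm].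
Qed.

Lemma holomorphic_H_kern (w v : R) : holomorphic_H (kern w v).
Proof.
intros z Hz; eexists.
apply (Cderive_minus (fun t => / (t - RtoC w))%C (fun t => / (t - RtoC v))%C);
  apply Cderive_inv_shift; exact Hz.
Qed.

Lemma kern_bound (w v m : R) (z : C) : 0 < m -> m <= Im z -> Cmod (kern w v z) <= 2 * / m.
Proof.
intros Hm Hz. eapply Rle_trans; [apply Cmod_triangle|]. rewrite Cmod_opp.
assert (H1 := Cmod_inv_le z w m Hm Hz). assert (H2 := Cmod_inv_le z v m Hm Hz). lra.
Qed.

Lemma kern_lipschitz (w v w' v' m : R) (z : C) : 0 < m -> m <= Im z ->
  Cmod (kern w v z - kern w' v' z) <= (/ m * / m) * (Rabs (w - w') + Rabs (v - v')).
Proof.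
intros Hm Hz.
assert (L : forall a b, Cmod (/ (z - RtoC a) - / (z - RtoC b)) <= / m * / m * Rabs (a - b)).
{ intros a b.
  replace (/ (z - RtoC a) - / (z - RtoC b))%C
    with (/ (z - RtoC a) * / (z - RtoC b) * RtoC (a - b))%C
    by (rewrite RtoC_minus; field; split; apply H_minus_real_neq_0; lra).
  rewrite !Cmod_mult, Cmod_R. apply Rmult_le_compat_r; [apply Rabs_pos|].
  apply Rmult_le_compat; try apply Cmod_ge_0; now apply Cmod_inv_le. }
unfold kern.
replace (/ (z - RtoC w) - / (z - RtoC v) - (/ (z - RtoC w') - / (z - RtoC v')))%C
  with ((/ (z - RtoC w) - / (z - RtoC w')) + - (/ (z - RtoC v) - / (z - RtoC v')))%C by ring.
eapply Rle_trans; [apply Cmod_triangle|]. rewrite Cmod_opp, Rmult_plus_distr_l.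
apply Rplus_le_compat; apply L.
Qed.

(** The segment stays above the height m, which bounds 1 / (z - u) by 1 / m for every real u. Hence
    one K controls both the size and the dependence on the poles, however large or close to each
    other these are. *)
Lemma segment_kern_bounds (f : C -> C) (z1 z2 : C) :
  holomorphic_H f -> 0 < Im z1 -> 0 < Im z2 ->
  exists K, 0 <= K /\ forall w v,
    Cmod (segment_integral (fun z => f z * kern w v z)%C z1 z2) <= K /\
    forall w' v',
    Cmod (segment_integral (fun z => f z * kern w v z)%C z1 z2
          - segment_integral (fun z => f z * kern w' v' z)%C z1 z2)
      <= K * (Rabs (w - w') + Rabs (v - v')).
Proof.
intros Hf H1 H2.
destruct (holomorphic_bounded_segment f z1 z2 Hf H1 H2) as (M & HM0 & HM).
set (m := Rmin (Im z1) (Im z2)). assert (Hm : 0 < m) by now apply Rmin_pos.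
assert (Hmi : 0 < / m) by now apply Rinv_0_lt_compat.
assert (Hmm : forall t, 0 <= t <= 1 -> m <= Im (z1 + RtoC t * (z2 - z1))%C).
{ intros t Ht; apply Im_segment_ge; [exact Ht|apply Rmin_l|apply Rmin_r]. }
assert (HD := Cmod_ge_0 (z2 - z1)). set (D := Cmod (z2 - z1)) in *.
assert (HMD : 0 <= M * D) by now apply Rmult_le_pos.
exists (M * (2 * / m) * D + M * (/ m * / m) * D); split.
{ assert (0 <= M * D * (/ m * / m)) by (apply Rmult_le_pos; nra). nra. }
assert (Hh : forall w v, holomorphic_H (fun z => f z * kern w v z)%C).
{ intros; apply holomorphic_H_mult; [exact Hf|apply holomorphic_H_kern]. }
assert (P1 : 0 <= M * (2 * / m) * D) by nra.
assert (P2 : 0 <= M * (/ m * / m) * D).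
{ replace (M * (/ m * / m) * D) with (M * D * (/ m * / m)) by ring. apply Rmult_le_pos; nra. }
intros w v; split.
- apply Rle_trans with (M * (2 * / m) * D); [|lra].
  apply segment_integral_bound; trivial; intros t Ht.
  rewrite Cmod_mult. apply Rmult_le_compat; try apply Cmod_ge_0; [now apply HM|].
  apply kern_bound; [exact Hm|now apply Hmm].
- intros w' v'.
  destruct (exists_primitive_H _ (Hh w v)) as [P HP].
  destruct (exists_primitive_H _ (Hh w' v')) as [P' HP'].
  rewrite (segment_integral_primitive _ P), (segment_integral_primitive _ P') by trivial.
  (* The difference of the two integrals is the integral of the difference, obtained by subtracting
     primitives. *)
  set (g := fun z => (f z * kern w v z - f z * kern w' v' z)%C).
  assert (Hg : holomorphic_H g).
  { intros z Hz. destruct (Hh w v z Hz) as [l Hl]. destruct (Hh w' v' z Hz) as [l' Hl'].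
    eexists; apply (Cderive_minus _ _ _ _ _ Hl Hl'). }
  replace (P z2 - P z1 - (P' z2 - P' z1))%C with (segment_integral g z1 z2).
  2: { rewrite (segment_integral_primitive g (fun z => P z - P' z)%C); trivial; [ring|].
       intros z Hz; apply Cderive_minus; [now apply HP|now apply HP']. }
  set (S := Rabs (w - w') + Rabs (v - v')).
  assert (HS : 0 <= S) by (unfold S; generalize (Rabs_pos (w - w')) (Rabs_pos (v - v')); lra).
  apply Rle_trans with (M * (/ m * / m * S) * D).
  + apply segment_integral_bound; trivial; intros t Ht. unfold g.
    set (z := (z1 + RtoC t * (z2 - z1))%C) in *.
    replace (f z * kern w v z - f z * kern w' v' z)%C
      with (f z * (kern w v z - kern w' v' z))%C by ring.
    rewrite Cmod_mult. apply Rmult_le_compat; try apply Cmod_ge_0; [now apply HM|].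
    apply kern_lipschitz; [exact Hm|now apply Hmm].
  + replace (M * (/ m * / m * S) * D) with (M * (/ m * / m) * D * S) by ring.
    apply Rmult_le_compat_r; [exact HS|lra].
Qed.

(** * Cocycles of nonnegative matrices *)

(** Such matrices map the positive half-line into itself, and their inverses do so with the negative
    one. *)
Definition nonneg_SL2 (M : mat2) : Prop :=
  SL2Z M /\ (0 <= m11 M /\ 0 <= m12 M /\ 0 <= m21 M /\ 0 <= m22 M)%Z.

(** The inverse of a matrix of determinant 1. *)
Definition mat_adj (M : mat2) : mat2 := Mat2 (m22 M) (- m12 M) (- m21 M) (m11 M).

(** The poles are w and Mv, so that pulling back by M gives the poles M^-1 w and v. If M fixes both
    w and v, repelling and attracting, this is I_f(M). *)
Definition cocycle (f : C -> C) (z0 : C) (M : mat2) (w v : R) : C :=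
  segment_integral (fun z => f z * kern w (mobius_real M v) z)%C z0 (mobius M z0).

Lemma SL2Z_R (M : mat2) : SL2Z M ->
  IZR (m11 M) * IZR (m22 M) - IZR (m12 M) * IZR (m21 M) = 1.
Proof. unfold SL2Z, mat_det; intros H; rewrite <- !mult_IZR, <- minus_IZR, H; reflexivity. Qed.

Lemma nonneg_SL2_R (M : mat2) : nonneg_SL2 M ->
  IZR (m11 M) * IZR (m22 M) - IZR (m12 M) * IZR (m21 M) = 1 /\
  0 <= IZR (m11 M) /\ 0 <= IZR (m12 M) /\ 0 <= IZR (m21 M) /\ 0 <= IZR (m22 M).
Proof.
intros [H (H1 & H2 & H3 & H4)]; split; [now apply SL2Z_R|].
repeat split; now apply IZR_le.
Qed.

Lemma SL2Z_mul (M N : mat2) : SL2Z M -> SL2Z N -> SL2Z (mat_mul M N).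
Proof.
unfold SL2Z, mat_det, mat_mul; destruct M as [a b c d], N as [a' b' c' d']; simpl; intros H1 H2.
replace ((a * a' + b * c') * (c * b' + d * d') - (a * b' + b * d') * (c * a' + d * c'))%Z
  with ((a * d - b * c) * (a' * d' - b' * c'))%Z by ring.
rewrite H1, H2; reflexivity.
Qed.

Lemma nonneg_SL2_mul (M N : mat2) : nonneg_SL2 M -> nonneg_SL2 N -> nonneg_SL2 (mat_mul M N).
Proof.
intros [H1 H1'] [H2 H2']; split; [now apply SL2Z_mul|].
unfold mat_mul; cbn [m11 m12 m21 m22]; nia.
Qed.

Lemma Im_mobius_den (c d : R) (z : C) : Im (RtoC c * z + RtoC d)%C = c * Im z.
Proof. destruct z; unfold Im; simpl; ring. Qed.

Lemma mobius_den_neq_0 (M : mat2) (z : C) : SL2Z M -> 0 < Im z ->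
  (RtoC (IZR (m21 M)) * z + RtoC (IZR (m22 M)))%C <> RtoC 0.
Proof.
intros HM%SL2Z_R Hz E.
assert (E1 : Im (RtoC (IZR (m21 M)) * z + RtoC (IZR (m22 M)))%C = 0) by (rewrite E; reflexivity).
assert (E2 : Re (RtoC (IZR (m21 M)) * z + RtoC (IZR (m22 M)))%C = 0) by (rewrite E; reflexivity).
rewrite Im_mobius_den in E1.
assert (Hc : IZR (m21 M) = 0) by nra.
rewrite Hc in E2; destruct z; unfold Re in E2; simpl in E2. nra.
Qed.

Lemma Im_mobius_pos (M : mat2) (z : C) : SL2Z M -> 0 < Im z -> 0 < Im (mobius M z).
Proof.
intros HM Hz. assert (Hn := mobius_den_neq_0 M z HM Hz).
assert (HR := SL2Z_R M HM). unfold mobius.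
set (a := IZR (m11 M)) in *; set (b := IZR (m12 M)) in *;
set (c := IZR (m21 M)) in *; set (d := IZR (m22 M)) in *.
apply Cmod_gt_0 in Hn. rewrite <- sqrt_0 in Hn; apply sqrt_lt_0_alt in Hn.
destruct z as [x y]. unfold Im in *. simpl in *.
match goal with |- 0 < ?e => replace e with
  ((a * d - b * c) * y / ((c * x - 0 * y + d) ^ 2 + (c * y + 0 * x + 0) ^ 2)) end.
- rewrite HR; apply Rdiv_lt_0_compat; [lra|]; nra.
- field; simpl. nra.
Qed.

Lemma mobius_mul (M N : mat2) (z : C) : SL2Z M -> SL2Z N -> 0 < Im z ->
  mobius (mat_mul M N) z = mobius M (mobius N z).
Proof.
intros HM HN Hz.
assert (H1 := mobius_den_neq_0 N z HN Hz).
assert (H2 := mobius_den_neq_0 M _ HM (Im_mobius_pos N z HN Hz)).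
assert (H3 := mobius_den_neq_0 _ z (SL2Z_mul _ _ HM HN) Hz).
unfold mobius in *; unfold mat_mul in *; cbn [m11 m12 m21 m22] in *.
rewrite !plus_IZR, !mult_IZR, !RtoC_plus, !RtoC_mult in *.
field. repeat split; trivial.
intros E; apply H3.
match type of E with ?l = _ => transitivity l; [ring|exact E] end.
Qed.

Lemma Cderive_mobius (M : mat2) (z : C) : SL2Z M -> 0 < Im z ->
  Cderive (mobius M) z
   (/ ((RtoC (IZR (m21 M)) * z + RtoC (IZR (m22 M))) * (RtoC (IZR (m21 M)) * z + RtoC (IZR (m22 M)))))%C.
Proof.
intros HM Hz. assert (Hn := mobius_den_neq_0 M z HM Hz). assert (HR := SL2Z_R M HM).
set (a := IZR (m11 M)) in *; set (b := IZR (m12 M)) in *;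
set (c := IZR (m21 M)) in *; set (d := IZR (m22 M)) in *.
assert (H := Cderive_mult (fun t => RtoC a * t + RtoC b)%C (fun t => / (RtoC c * t + RtoC d))%C z
  _ _ (Cderive_affine _ _ z)
  (Cderive_comp Cinv (fun t => RtoC c * t + RtoC d)%C z _ _ (Cderive_inv _ Hn) (Cderive_affine _ _ z))).
match type of H with is_derive _ _ ?l => replace (/ _)%C with l end; [exact H|].
field_simplify_eq; [|exact Hn].
assert (E : (RtoC a * RtoC d - RtoC b * RtoC c)%C = RtoC 1)
  by (rewrite <- !RtoC_mult, <- RtoC_minus, HR; reflexivity).
rewrite <- E; ring.
Qed.

Lemma mobius_real_pos (M : mat2) (v : R) : nonneg_SL2 M -> 0 < v ->
  0 < IZR (m21 M) * v + IZR (m22 M) /\ 0 < mobius_real M v.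
Proof.
intros (H & Ha & Hb & Hc & Hd)%nonneg_SL2_R Hv. unfold mobius_real.
set (a := IZR (m11 M)) in *; set (b := IZR (m12 M)) in *;
set (c := IZR (m21 M)) in *; set (d := IZR (m22 M)) in *.
assert (0 < c * v + d) by (destruct (Rle_lt_or_eq_dec _ _ Hd) as [|E]; [nra|rewrite <- E in *; nra]).
split; [assumption|]. apply Rdiv_lt_0_compat; [|assumption].
destruct (Rle_lt_or_eq_dec _ _ Ha) as [|E]; [nra|rewrite <- E in *; nra].
Qed.

(** The third claim is the chain rule for M after M^-1: their denominators, at M^-1 w and at w, are
    inverse to each other. It later yields both nonvanishing denominators and the repelling
    derivative. *)
Lemma mobius_adj_neg (M : mat2) (w : R) : nonneg_SL2 M -> w < 0 ->
  0 < IZR (m11 M) - IZR (m21 M) * w /\ mobius_real (mat_adj M) w < 0 /\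
  IZR (m21 M) * mobius_real (mat_adj M) w + IZR (m22 M) = / (IZR (m11 M) - IZR (m21 M) * w) /\
  mobius_real M (mobius_real (mat_adj M) w) = w.
Proof.
intros (H & Ha & Hb & Hc & Hd)%nonneg_SL2_R Hw. unfold mobius_real, mat_adj.
cbn [m11 m12 m21 m22]. rewrite !opp_IZR.
set (a := IZR (m11 M)) in *; set (b := IZR (m12 M)) in *;
set (c := IZR (m21 M)) in *; set (d := IZR (m22 M)) in *.
assert (H0 : 0 < a - c * w) by (destruct (Rle_lt_or_eq_dec _ _ Ha) as [|E]; [nra|rewrite <- E in *; nra]).
assert (H1 : d * w + - b < 0) by (destruct (Rle_lt_or_eq_dec _ _ Hd) as [|E]; [nra|rewrite <- E in *; nra]).
assert (E : c * ((d * w + - b) / (- c * w + a)) + d = / (a - c * w)).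
{ transitivity ((a * d - b * c) / (a - c * w)); [field; lra|rewrite H; field; lra]. }
split; [exact H0|split; [|split; [exact E|]]].
- replace (- c * w + a) with (a - c * w) by ring.
  apply Ropp_lt_cancel; rewrite Ropp_0. unfold Rdiv; rewrite Ropp_mult_distr_l.
  apply Rdiv_lt_0_compat; lra.
- rewrite E. transitivity ((a * d - b * c) * w); [field; lra|rewrite H; ring].
Qed.

Lemma mobius_real_mul (M N : mat2) (v : R) : nonneg_SL2 M -> nonneg_SL2 N -> 0 < v ->
  mobius_real (mat_mul M N) v = mobius_real M (mobius_real N v).
Proof.
intros HM HN Hv.
destruct (mobius_real_pos N v HN Hv) as [H1 H2].
destruct (mobius_real_pos M _ HM H2) as [H3 _].
destruct (mobius_real_pos _ v (nonneg_SL2_mul _ _ HM HN) Hv) as [H4 _].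
unfold mobius_real in *; unfold mat_mul in *; cbn [m11 m12 m21 m22] in *.
rewrite !plus_IZR, !mult_IZR in *.
field. repeat split; apply Rgt_not_eq; lra.
Qed.

(** A single pole is not invariant under the change of variable, but the defect c / (cz + d) does
    not depend on the pole and cancels in the difference forming [kern]. *)
Lemma kern_pole_mobius (a b c d u : R) (z : C) :
  a * d - b * c = 1 -> c * u + d <> 0 -> 0 < Im z -> (RtoC c * z + RtoC d)%C <> RtoC 0 ->
  (/ ((RtoC a * z + RtoC b) / (RtoC c * z + RtoC d) - RtoC ((a * u + b) / (c * u + d)))
    * / ((RtoC c * z + RtoC d) * (RtoC c * z + RtoC d)))%C
  = (/ (z - RtoC u) - RtoC c / (RtoC c * z + RtoC d))%C.
Proof.
intros H Hu Hz Hn.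
assert (Hzu := H_minus_real_neq_0 z u Hz).
assert (Hu' : (RtoC c * RtoC u + RtoC d)%C <> RtoC 0).
{ rewrite <- RtoC_mult, <- RtoC_plus; intros E; apply Hu; now apply RtoC_inj. }
assert (HC : (RtoC a * RtoC d - RtoC b * RtoC c)%C = RtoC 1)
  by (rewrite <- !RtoC_mult, <- RtoC_minus, H; reflexivity).
rewrite RtoC_div, !RtoC_plus, !RtoC_mult by exact Hu.
replace ((RtoC a * z + RtoC b) / (RtoC c * z + RtoC d) -
         (RtoC a * RtoC u + RtoC b) / (RtoC c * RtoC u + RtoC d))%C
  with ((RtoC a * RtoC d - RtoC b * RtoC c) * (z - RtoC u) /
        ((RtoC c * z + RtoC d) * (RtoC c * RtoC u + RtoC d)))%C by (field; split; assumption).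
rewrite HC. field. repeat split; assumption.
Qed.

Lemma kern_mobius (M : mat2) (w v : R) (z : C) : nonneg_SL2 M -> w < 0 -> 0 < v -> 0 < Im z ->
  (/ ((RtoC (IZR (m21 M)) * z + RtoC (IZR (m22 M))) * (RtoC (IZR (m21 M)) * z + RtoC (IZR (m22 M))))
    * kern w (mobius_real M v) (mobius M z))%C = kern (mobius_real (mat_adj M) w) v z.
Proof.
intros HM Hw Hv Hz.
assert (Hn := mobius_den_neq_0 M z (proj1 HM) Hz).
destruct (mobius_adj_neg M w HM Hw) as (H1 & _ & H2 & H3).
destruct (mobius_real_pos M v HM Hv) as [H4 _].
assert (HR := SL2Z_R M (proj1 HM)).
set (u := mobius_real (mat_adj M) w) in *. rewrite <- H3 at 1.
unfold kern, mobius, mobius_real.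
match goal with |- (?k * (?x - ?y))%C = _ => replace (k * (x - y))%C with (x * k - y * k)%C by ring end.
rewrite !kern_pole_mobius; trivial; [ring|lra|].
rewrite H2. apply Rgt_not_eq, Rinv_0_lt_compat, H1.
Qed.

Lemma whm_holomorphic_H (f : C -> C) : weakly_holomorphic_modular_function f -> holomorphic_H f.
Proof. intros Hf z Hz; exact (whm_holomorphic f Hf z Hz). Qed.

Lemma holomorphic_H_f_kern (f : C -> C) (w v : R) :
  weakly_holomorphic_modular_function f -> holomorphic_H (fun z => f z * kern w v z)%C.
Proof.
intros Hf; apply holomorphic_H_mult; [now apply whm_holomorphic_H|apply holomorphic_H_kern].
Qed.

(** Both f and the differential [kern] dz are compatible with M, so composing with M transports a
    primitive, and no path has to be moved. *)
Lemma primitive_mobius (f P : C -> C) (M : mat2) (w v : R) :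
  weakly_holomorphic_modular_function f -> nonneg_SL2 M -> w < 0 -> 0 < v ->
  primitive_H (fun z => f z * kern w (mobius_real M v) z)%C P ->
  primitive_H (fun z => f z * kern (mobius_real (mat_adj M) w) v z)%C (fun z => P (mobius M z)).
Proof.
intros Hf HM Hw Hv HP z Hz.
rewrite <- (kern_mobius M w v z) by assumption.
rewrite <- (whm_modular f Hf M z (proj1 HM) Hz) at 1.
match goal with |- is_derive _ _ (?a * (?b * ?c))%C =>
  replace (a * (b * c))%C with (b * (a * c))%C by ring end.
apply (Cderive_comp P (mobius M)); [|now apply Cderive_mobius; [apply HM|]].
apply (HP (mobius M z)). now apply Im_mobius_pos; [apply HM|].
Qed.

(** Go from z0 to M z0 and on to MN z0. The second leg is the image under M of the path from z0 to N
    z0, and pulling it back moves the pole w to M^-1 w. *)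
Lemma cocycle_mul (f : C -> C) (z0 : C) (M N : mat2) (w v : R) :
  weakly_holomorphic_modular_function f -> 0 < Im z0 -> nonneg_SL2 M -> nonneg_SL2 N ->
  w < 0 -> 0 < v ->
  cocycle f z0 (mat_mul M N) w v =
  (cocycle f z0 M w (mobius_real N v) + cocycle f z0 N (mobius_real (mat_adj M) w) v)%C.
Proof.
intros Hf Hz HM HN Hw Hv.
destruct (mobius_real_pos N v HN Hv) as [_ HNv].
unfold cocycle. rewrite mobius_real_mul, mobius_mul by (trivial; apply HM || apply HN).
destruct (exists_primitive_H _ (holomorphic_H_f_kern f w (mobius_real M (mobius_real N v)) Hf))
  as [P HP].
assert (HQ := primitive_mobius f P M w _ Hf HM Hw HNv HP).
assert (Hh := holomorphic_H_f_kern f).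
assert (I1 := Im_mobius_pos N z0 (proj1 HN) Hz).
assert (I2 := Im_mobius_pos M _ (proj1 HM) I1).
assert (I3 := Im_mobius_pos M _ (proj1 HM) Hz).
rewrite !(segment_integral_primitive _ P) by auto.
rewrite (segment_integral_primitive _ _ z0 (mobius N z0) (Hh _ _ Hf) HQ) by assumption. ring.
Qed.

(** When A fixes both poles, P(Az) and P(z) are primitives of the same function, so their difference
    is constant on the half-plane. *)
Lemma cocycle_base_point (f : C -> C) (z0 z1 : C) (A : mat2) (w v : R) :
  weakly_holomorphic_modular_function f -> 0 < Im z0 -> 0 < Im z1 -> nonneg_SL2 A ->
  w < 0 -> 0 < v -> mobius_real (mat_adj A) w = w -> mobius_real A v = v ->
  cocycle f z0 A w v = cocycle f z1 A w v.
Proof.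
intros Hf H0 H1 HA Hw Hv Ew Ev.
assert (Hh := holomorphic_H_f_kern f w v Hf).
destruct (exists_primitive_H _ Hh) as [P HP].
assert (HQ := primitive_mobius f P A w v Hf HA Hw Hv).
rewrite Ew, Ev in HQ. specialize (HQ HP).
assert (E : forall z, 0 < Im z -> cocycle f z A w v = (P (mobius A z) - P z)%C).
{ intros z Hz. unfold cocycle. rewrite Ev.
  apply segment_integral_primitive; trivial. now apply Im_mobius_pos; [apply HA|]. }
rewrite !E by assumption.
apply (primitive_H_increment (fun z => P (mobius A z) - P z)%C); trivial.
intros z Hz.
replace (RtoC 0) with (f z * kern w v z - f z * kern w v z)%C by ring.
apply Cderive_minus; [now apply HQ|now apply HP].
Qed.

(** * Cycle integrals and their growth along powers *)

(** Positive entries give ad = 1 + bc >= 2, hence trace at least 3, and make the actions on the two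
    half-lines contract. *)
Definition pos_SL2 (A : mat2) : Prop :=
  SL2Z A /\ (1 <= m11 A /\ 1 <= m12 A /\ 1 <= m21 A /\ 1 <= m22 A)%Z.

(** The endpoints of the geodesic preserved by A. The fixed point w is expressed through A^-1
    because the cocycle moves it that way. *)
Definition axis (A : mat2) (w v : R) : Prop :=
  w < 0 /\ 0 < v /\ mobius_real (mat_adj A) w = w /\ mobius_real A v = v.

Lemma pos_SL2_nonneg (A : mat2) : pos_SL2 A -> nonneg_SL2 A.
Proof. intros [H1 H2]; split; [exact H1|lia]. Qed.

Lemma pos_SL2_hyperbolic (A : mat2) : pos_SL2 A -> hyperbolic A.
Proof. intros [H1 H2]; split; [exact H1|]. unfold SL2Z, mat_det in H1; unfold mat_tr. nia. Qed.

Lemma pos_SL2_R (A : mat2) : pos_SL2 A ->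
  IZR (m11 A) * IZR (m22 A) - IZR (m12 A) * IZR (m21 A) = 1 /\
  1 <= IZR (m11 A) /\ 1 <= IZR (m12 A) /\ 1 <= IZR (m21 A) /\ 1 <= IZR (m22 A).
Proof.
intros [H (H1 & H2 & H3 & H4)]; split; [now apply SL2Z_R|].
repeat split; now apply IZR_le.
Qed.

Lemma fixed_point_quadratic (A : mat2) (x : R) : fixed_point A x ->
  IZR (m21 A) * x * x + (IZR (m22 A) - IZR (m11 A)) * x - IZR (m12 A) = 0.
Proof.
intros [H1 H2]; unfold mobius_real in H2.
apply (f_equal (fun y => y * (IZR (m21 A) * x + IZR (m22 A)))) in H2.
unfold Rdiv in H2; rewrite Rmult_assoc, Rinv_l, Rmult_1_r in H2 by assumption. lra.
Qed.

Lemma Derive_mobius_real (A : mat2) (x : R) : SL2Z A -> IZR (m21 A) * x + IZR (m22 A) <> 0 ->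
  Derive (mobius_real A) x = / (IZR (m21 A) * x + IZR (m22 A)) ^ 2.
Proof.
intros HA%SL2Z_R Hx; apply is_derive_unique; unfold mobius_real.
auto_derive; [exact Hx|]. field_simplify_eq; [|exact Hx]. nra.
Qed.

(** The roots of c x^2 + (d - a) x - b have product -b / c < 0, hence opposite signs. *)
Lemma exists_axis (A : mat2) : pos_SL2 A -> exists w v, axis A w v /\
  IZR (m21 A) * (w + v) = IZR (m11 A) - IZR (m22 A) /\
  IZR (m21 A) * (w * v) = - IZR (m12 A).
Proof.
intros (H & Ha & Hb & Hc & Hd)%pos_SL2_R. unfold axis, mobius_real, mat_adj.
cbn [m11 m12 m21 m22]. rewrite !opp_IZR.
set (a := IZR (m11 A)) in *; set (b := IZR (m12 A)) in *;
set (c := IZR (m21 A)) in *; set (d := IZR (m22 A)) in *.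
set (D := (a - d) ^ 2 + 4 * (b * c)).
assert (HD : (a - d) ^ 2 < D) by (unfold D; nra).
assert (HD0 := pow2_ge_0 (a - d)).
set (s := sqrt D). assert (Hs : s * s = D) by (apply sqrt_sqrt; lra).
assert (Hs0 : 0 <= s) by apply sqrt_pos.
assert (Hs1 : Rabs (a - d) < s).
{ rewrite <- sqrt_Rsqr_abs. apply sqrt_lt_1_alt. unfold Rsqr. nra. }
apply Rabs_def2 in Hs1.
set (w := (a - d - s) / (2 * c)). set (v := (a - d + s) / (2 * c)).
assert (Hsum : c * (w + v) = a - d) by (unfold w, v; field; lra).
assert (Hprod : c * (w * v) = - b).
{ replace (- b) with (((a - d) ^ 2 - D) / (4 * c)) by (unfold D; field; lra).
  rewrite <- Hs; unfold w, v; field; lra. }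
assert (Hw : w < 0).
{ unfold w; apply Ropp_lt_cancel; rewrite Ropp_0; unfold Rdiv; rewrite Ropp_mult_distr_l.
  apply Rdiv_lt_0_compat; lra. }
assert (Hv : 0 < v) by (unfold v; apply Rdiv_lt_0_compat; lra).
clearbody w v.
exists w, v; repeat split; trivial.
- assert (0 < - c * w + a) by nra.
  apply Rmult_eq_reg_r with (- c * w + a); [|lra].
  unfold Rdiv; rewrite Rmult_assoc, Rinv_l, Rmult_1_r by lra. nra.
- assert (0 < c * v + d) by nra.
  apply Rmult_eq_reg_r with (c * v + d); [|lra].
  unfold Rdiv; rewrite Rmult_assoc, Rinv_l, Rmult_1_r by lra. nra.
Qed.

(** The derivative at x is 1 / (cx + d)^2. Here cv + d > 1, while cw + d is the inverse of a - cw >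
    1. *)
Lemma axis_fixed_points (A : mat2) (w v : R) : pos_SL2 A -> axis A w v ->
  repelling_fixed_point A w /\ attracting_fixed_point A v.
Proof.
intros HA (Hw & Hv & Ew & Ev).
assert (Hn := pos_SL2_nonneg A HA).
destruct (mobius_adj_neg A w Hn Hw) as (H1 & _ & H3 & H4). rewrite Ew in H3, H4.
destruct (mobius_real_pos A v Hn Hv) as [H5 _].
destruct (pos_SL2_R A HA) as (H & Ha & Hb & Hc & Hd).
split; (split; [split|]); trivial; try lra.
- rewrite H3; apply Rinv_neq_0_compat; lra.
- rewrite Derive_mobius_real by (apply HA || (rewrite H3; apply Rinv_neq_0_compat; lra)).
  rewrite H3, <- pow_inv, Rinv_inv, Rabs_pos_eq by apply pow2_ge_0.
  assert (H6 : 1 < IZR (m11 A) - IZR (m21 A) * w) by nra.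
  set (y := IZR (m11 A) - IZR (m21 A) * w) in *. nra.
- rewrite Derive_mobius_real by (apply HA || lra).
  rewrite Rabs_pos_eq by (apply Rlt_le, Rinv_0_lt_compat, pow_lt; lra).
  assert (H6 : 1 < IZR (m21 A) * v + IZR (m22 A)) by nra.
  set (y := IZR (m21 A) * v + IZR (m22 A)) in *.
  rewrite <- Rinv_1. apply Rinv_lt_contravar; nra.
Qed.

Lemma axis_quadratic (A : mat2) (w v : R) : pos_SL2 A -> axis A w v ->
  IZR (m21 A) * (w + v) = IZR (m11 A) - IZR (m22 A) /\
  IZR (m21 A) * (w * v) = - IZR (m12 A).
Proof.
intros HA Hax. destruct (axis_fixed_points A w v HA Hax) as [[F1 _] [F2 _]].
apply fixed_point_quadratic in F1, F2. destruct Hax as (Hw & Hv & _).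
destruct (pos_SL2_R A HA) as (H & Ha & Hb & Hc & Hd).
assert (E : IZR (m21 A) * (w + v) = IZR (m11 A) - IZR (m22 A)).
{ apply Rmult_eq_reg_r with (w - v); [|lra]. nra. }
split; [exact E|]. nra.
Qed.

Lemma fixed_point_axis (A : mat2) (w v x : R) : pos_SL2 A -> axis A w v ->
  fixed_point A x -> x = w \/ x = v.
Proof.
intros HA Hax Hx%fixed_point_quadratic.
destruct (axis_quadratic A w v HA Hax) as [E1 E2].
destruct (pos_SL2_R A HA) as (H & Ha & Hb & Hc & Hd).
assert (E : IZR (m21 A) * ((x - w) * (x - v)) = 0) by nra.
apply Rmult_integral in E as [E|E]; [lra|].
apply Rmult_integral in E as [E|E]; [left|right]; lra.
Qed.

Lemma qeval_real (Q : qform) (x : R) :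
  qeval Q (RtoC x) (RtoC 1) = RtoC (IZR (qa Q) * x * x + IZR (qb Q) * x + IZR (qc Q)).
Proof. unfold qeval; rewrite !RtoC_plus, !RtoC_mult; ring. Qed.

(** The form is the fixed-point quadratic of A divided by the gcd of its coefficients, up to
    sign. *)
Lemma exists_form (A : mat2) : pos_SL2 A -> exists Q, is_form_of A Q.
Proof.
intros HA. destruct (exists_axis A HA) as (w & v & Hax & Es & Ep).
destruct (axis_fixed_points A w v HA Hax) as [F1 F2].
destruct Hax as (Hw & Hv & _).
destruct HA as [HS (Ha & Hb & Hc & Hd)].
set (a := m11 A) in *; set (b := m12 A) in *; set (c := m21 A) in *; set (d := m22 A) in *.
set (g := Z.gcd (Z.gcd c (d - a)) b).
assert (Hg : (0 < g)%Z).
{ assert (H0 := Z.gcd_nonneg (Z.gcd c (d - a)) b). fold g in H0.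
  assert (g <> 0)%Z; [|lia]. intros E. apply Z.gcd_eq_0_r in E. lia. }
destruct (Z.gcd_divide_l (Z.gcd c (d - a)) b) as [k Hk]; fold g in Hk.
destruct (Z.gcd_divide_r (Z.gcd c (d - a)) b) as [b' Hb']; fold g in Hb'.
destruct (Z.gcd_divide_l c (d - a)) as [c1 Hc1].
destruct (Z.gcd_divide_r c (d - a)) as [e1 He1].
rewrite Hk in Hc1, He1.
set (c' := (c1 * k)%Z). set (e' := (e1 * k)%Z).
assert (Hc' : c = (g * c')%Z) by (unfold c'; lia).
assert (He' : (d - a = g * e')%Z) by (unfold e'; lia).
assert (Hb'' : b = (g * b')%Z) by lia.
assert (Hg1 : Z.gcd (Z.gcd c' e') b' = 1%Z).
{ assert (E : g = Z.gcd (Z.gcd c (d - a)) b) by reflexivity.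
  rewrite Hc', He', Hb'' in E at 1.
  rewrite Z.gcd_mul_mono_l_nonneg, Z.gcd_mul_mono_l_nonneg in E by lia. nia. }
(* Negated, because w < 0 < v requires a negative leading coefficient and c' is positive. *)
exists (QForm (- c') (- e') b'). exists w, v.
assert (Hgr : 0 < IZR g) by now apply IZR_lt.
assert (Ec : IZR c = IZR g * IZR c') by (rewrite <- mult_IZR; f_equal; exact Hc').
assert (Ee : IZR d - IZR a = IZR g * IZR e') by (rewrite <- mult_IZR, <- minus_IZR; f_equal; exact He').
assert (Eb : IZR b = IZR g * IZR b') by (rewrite <- mult_IZR; f_equal; exact Hb'').
assert (E1 : IZR c' * (w + v) = - IZR e').
{ apply Rmult_eq_reg_l with (IZR g); [|lra]. rewrite Ec in Es; lra. }
assert (E2 : IZR c' * (w * v) = - IZR b').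
{ apply Rmult_eq_reg_l with (IZR g); [|lra]. rewrite Ec, Eb in Ep; lra. }
split; [exact F1|split; [exact F2|split; [|split; [|split]]]].
- unfold qprimitive; cbn [qa qb qc]. rewrite Z.gcd_opp_l, Z.gcd_opp_r. exact Hg1.
- rewrite qeval_real; cbn [qa qb qc]. rewrite !opp_IZR. f_equal. nra.
- rewrite qeval_real; cbn [qa qb qc]. rewrite !opp_IZR. f_equal. nra.
- cbn [qa]. rewrite (sign_eq_m1 (w - v)) by lra.
  assert (0 < c')%Z by nia. rewrite Z.sgn_neg by lia. reflexivity.
Qed.

(* sqrt(D)/Q(tau,1) = 1/(tau-w) - 1/(tau-v): Q = q (tau-w)(tau-v) with q(w-v) = sqrt(D) > 0. *)
Lemma cycle_integral_cocycle (f : C -> C) (z0 : C) (A : mat2) (w v : R) :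
  pos_SL2 A -> axis A w v -> 0 < Im z0 -> cycle_integral f z0 A = cocycle f z0 A w v.
Proof.
intros HA Hax Hz. unfold cycle_integral.
destruct (excluded_middle_informative (hyperbolic A)) as [_|n];
  [|now elim n; apply pos_SL2_hyperbolic].
assert (HQ : is_form_of A (form_of A)) by 
  (exact (epsilon_spec (inhabits (QForm 0 0 0)) (is_form_of A) (exists_form A HA))).
set (Q := form_of A) in *; clearbody Q.
destruct HQ as (w1 & v1 & [F1 D1] & [F2 D2] & _ & Q1 & Q2 & HS).
destruct (axis_fixed_points A w v HA Hax) as [[_ Dw] [_ Dv]].
(* Each of [w1], [v1] is one of the two fixed points; the derivative tells which. *)
assert (Ew : w1 = w).
{ destruct (fixed_point_axis A w v w1 HA Hax F1) as [|E]; [assumption|rewrite E in D1; lra]. }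
assert (Ev : v1 = v).
{ destruct (fixed_point_axis A w v v1 HA Hax F2) as [E|]; [rewrite E in D2; lra|assumption]. }
rewrite Ew in Q1, HS; rewrite Ev in Q2, HS.
destruct Hax as (Hw & Hv & _ & Efix).
rewrite qeval_real in Q1, Q2. apply RtoC_inj in Q1, Q2.
rewrite sign_eq_m1 in HS by lra. apply eq_IZR in HS.
assert (Hqa : (qa Q < 0)%Z) by (apply Z.sgn_neg_iff; exact HS).
apply IZR_lt in Hqa.
set (q := IZR (qa Q)) in *.
assert (Eb : IZR (qb Q) = - q * (w + v)) by (apply Rmult_eq_reg_r with (w - v); [nra|lra]).
assert (Ec : IZR (qc Q) = q * (w * v)) by nra.
assert (ED : sqrt (IZR (qdisc Q)) = q * (w - v)).
{ unfold qdisc. rewrite minus_IZR, !mult_IZR, Eb, Ec. fold q.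
  replace (- q * (w + v) * (- q * (w + v)) - 4 * (q * (q * (w * v))))
    with ((q * (w - v)) * (q * (w - v))) by ring.
  apply sqrt_square. nra. }
unfold cocycle, segment_integral. rewrite Efix.
apply (RInt_ext (V := C_R_CompleteNormedModule)).
intros t Ht. rewrite Rmin_left, Rmax_right in Ht by lra.
set (z := (z0 + RtoC t * (mobius A z0 - z0))%C).
assert (Hz' : 0 < Im z).
{ apply Im_segment_pos; [lra|exact Hz|apply Im_mobius_pos; [apply HA|exact Hz]]. }
f_equal. rewrite ED.
assert (Eq : qeval Q z (RtoC 1) = (RtoC q * ((z - RtoC w) * (z - RtoC v)))%C).
{ unfold qeval; fold q. rewrite Eb, Ec, !RtoC_mult, RtoC_opp, !RtoC_plus; ring. }
rewrite Eq. unfold kern. rewrite RtoC_mult, RtoC_minus.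
assert (H1 := H_minus_real_neq_0 z w Hz'). assert (H2 := H_minus_real_neq_0 z v Hz').
field. repeat split; trivial. intros E; apply RtoC_inj in E; lra.
Qed.

Lemma mat_pow_nonneg (B : mat2) (m : nat) : nonneg_SL2 B -> nonneg_SL2 (mat_pow B m).
Proof.
intros HB; induction m as [|m IH]; [|now apply nonneg_SL2_mul].
split; [reflexivity|cbn; lia].
Qed.

Lemma cocycle_id (f : C -> C) (z0 : C) (w v : R) :
  weakly_holomorphic_modular_function f -> 0 < Im z0 -> cocycle f z0 mat_id w v = RtoC 0.
Proof.
intros Hf Hz. unfold cocycle.
destruct (exists_primitive_H _ (holomorphic_H_f_kern f w (mobius_real mat_id v) Hf)) as [P HP].
replace (mobius mat_id z0) with z0 by (unfold mobius; cbn; field).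
rewrite (segment_integral_primitive _ P); trivial; [ring|now apply holomorphic_H_f_kern].
Qed.

(** * Contraction and linear growth along powers *)

(** From Bx - v = (x - v) / ((cx + d)(cv + d)), each step contracts at least by 1 / (cv + d). The
    bound is uniform in x because the first application already brings any positive x within 1 + v
    of v; hence the power [S m]. *)
Lemma contraction_pos (B : mat2) (w v : R) : pos_SL2 B -> axis B w v ->
  exists l, 0 <= l < 1 /\ forall m x, 0 < x ->
    Rabs (mobius_real (mat_pow B (S m)) x - v) <= (1 + v) * l ^ m.
Proof.
intros HB (_ & Hv & _ & Ev).
assert (Hn := pos_SL2_nonneg B HB).
destruct (pos_SL2_R B HB) as (H & Ha & Hb & Hc & Hd).
assert (Hdiff : forall x, 0 < x -> mobius_real B x - v =
  (x - v) / ((IZR (m21 B) * x + IZR (m22 B)) * (IZR (m21 B) * v + IZR (m22 B)))).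
{ intros x Hx. rewrite <- Ev at 1. unfold mobius_real.
  transitivity ((IZR (m11 B) * IZR (m22 B) - IZR (m12 B) * IZR (m21 B)) * (x - v) /
    ((IZR (m21 B) * x + IZR (m22 B)) * (IZR (m21 B) * v + IZR (m22 B))));
    [field; split; nra|rewrite H; f_equal; ring]. }
set (c := IZR (m21 B)) in *; set (d := IZR (m22 B)) in *.
assert (Hcv : 1 < c * v + d) by nra.
exists (/ (c * v + d)).
assert (Hl : 0 < / (c * v + d)) by (apply Rinv_0_lt_compat; lra).
assert (Hl1 : / (c * v + d) < 1) by (rewrite <- Rinv_1; apply Rinv_lt_contravar; lra).
split; [lra|].
intros m x Hx; induction m as [|m IH].
- cbn [mat_pow]. rewrite mat_mul_id_r, Hdiff, pow_O, Rmult_1_r by assumption.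
  assert (Hcx : 1 < c * x + d) by nra.
  unfold Rdiv. rewrite Rabs_mult, (Rabs_pos_eq (/ _)) by (apply Rlt_le, Rinv_0_lt_compat; nra).
  apply Rmult_le_reg_r with ((c * x + d) * (c * v + d)); [nra|].
  rewrite Rmult_assoc, Rinv_l, Rmult_1_r by nra.
  apply Rle_trans with (x + v); [apply Rabs_le; lra|].
  apply Rle_trans with ((1 + v) * (c * x + d)); [nra|].
  apply Rmult_le_compat_l; nra.
- change (mat_pow B (S (S m))) with (mat_mul B (mat_pow B (S m))).
  destruct (mobius_real_pos _ x (mat_pow_nonneg B (S m) Hn) Hx) as [_ Hy].
  rewrite mobius_real_mul by (trivial; now apply mat_pow_nonneg).
  set (y := mobius_real (mat_pow B (S m)) x) in *.
  rewrite Hdiff by assumption.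
  assert (Hcy : 1 < c * y + d) by nra.
  unfold Rdiv. rewrite Rinv_mult, !Rabs_mult, !(Rabs_pos_eq (/ _))
    by (apply Rlt_le, Rinv_0_lt_compat; lra).
  assert (Hi : / (c * y + d) <= 1) by (rewrite <- Rinv_1; apply Rinv_le_contravar; lra).
  assert (Hi0 : 0 < / (c * y + d)) by (apply Rinv_0_lt_compat; lra).
  assert (H0 := Rabs_pos (y - v)). simpl pow.
  apply Rle_trans with (Rabs (y - v) * / (c * v + d)); [|nra].
  apply Rmult_le_compat_l; [assumption|]. nra.
Qed.

(** Counterpart for B^-1 on the negative half-line. The first bound drives an induction; the second
    makes its result uniform after one step, however far x is from w. *)
Lemma contraction_neg (B : mat2) (w v : R) : pos_SL2 B -> axis B w v ->
  exists l, 0 <= l < 1 /\ forall x, x < 0 ->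
    Rabs (mobius_real (mat_adj B) x - w) <= l * Rabs (x - w) /\
    Rabs (mobius_real (mat_adj B) x - w) <= 1 - w.
Proof.
intros HB (Hw & _ & Ew & _).
destruct (pos_SL2_R B HB) as (H & Ha & Hb & Hc & Hd).
assert (Hdiff : forall x, x < 0 -> mobius_real (mat_adj B) x - w =
  (x - w) / ((IZR (m11 B) - IZR (m21 B) * x) * (IZR (m11 B) - IZR (m21 B) * w))).
{ intros x Hx. rewrite <- Ew at 1. unfold mobius_real, mat_adj; cbn [m11 m12 m21 m22].
  rewrite !opp_IZR.
  transitivity ((IZR (m11 B) * IZR (m22 B) - IZR (m12 B) * IZR (m21 B)) * (x - w) /
    ((IZR (m11 B) - IZR (m21 B) * x) * (IZR (m11 B) - IZR (m21 B) * w)));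
    [field; repeat split; nra|rewrite H; f_equal; ring]. }
set (c := IZR (m21 B)) in *; set (a := IZR (m11 B)) in *.
assert (Hcw : 1 < a - c * w) by nra.
assert (Hl : 0 < / (a - c * w)) by (apply Rinv_0_lt_compat; lra).
assert (Hl1 : / (a - c * w) < 1) by (rewrite <- Rinv_1; apply Rinv_lt_contravar; lra).
exists (/ (a - c * w)); split; [lra|]; intros x Hx.
rewrite Hdiff by assumption.
assert (Hcx : 1 < a - c * x) by nra.
assert (Hi : / (a - c * x) <= 1) by (rewrite <- Rinv_1; apply Rinv_le_contravar; lra).
assert (Hi0 : 0 < / (a - c * x)) by (apply Rinv_0_lt_compat; lra).
split.
- unfold Rdiv. rewrite Rinv_mult, !Rabs_mult, !(Rabs_pos_eq (/ _)) by lra.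
  assert (H0 := Rabs_pos (x - w)).
  rewrite (Rmult_comm _ (Rabs _)). apply Rmult_le_compat_l; [assumption|]. nra.
- unfold Rdiv. rewrite Rabs_mult, (Rabs_pos_eq (/ _)) by (apply Rlt_le, Rinv_0_lt_compat; nra).
  apply Rmult_le_reg_r with ((a - c * x) * (a - c * w)); [nra|].
  rewrite Rmult_assoc, Rinv_l, Rmult_1_r by nra.
  apply Rle_trans with (- x - w); [apply Rabs_le; lra|].
  apply Rle_trans with ((1 - w) * (a - c * x)); [nra|].
  apply Rmult_le_compat_l; nra.
Qed.

(** Splitting off one B at a time, each factor contributes its cocycle at poles that approach w0
    geometrically from the left end of the word and v0 geometrically from the right end. By the
    Lipschitz bound the total deviation is at most two geometric series. *)
Lemma cocycle_pow_linear (f : C -> C) (z0 : C) (B : mat2) (w0 v0 : R) :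
  weakly_holomorphic_modular_function f -> 0 < Im z0 -> pos_SL2 B -> axis B w0 v0 ->
  exists K, forall m w v, w < 0 -> 0 < v ->
    Cmod (cocycle f z0 (mat_pow B (S m)) w v - RtoC (INR m) * cocycle f z0 B w0 v0) <= K.
Proof.
intros Hf Hz HB Hax.
assert (Hn := pos_SL2_nonneg B HB).
destruct (contraction_pos B w0 v0 HB Hax) as (l & Hl & Hpos).
destruct (contraction_neg B w0 v0 HB Hax) as (u & Hu & Hneg).
destruct Hax as (Hw0 & Hv0 & Ew & Ev).
destruct (segment_kern_bounds f z0 (mobius B z0) (whm_holomorphic_H f Hf) Hz
  (Im_mobius_pos B z0 (proj1 HB) Hz)) as (K & HK0 & HK).
assert (Hcl : 0 <= K * (1 + v0)) by nra.
(* The first summand is the series of errors in w, with ratio u, and the second the partial series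
   of errors in v, with ratio l. *)
assert (Hmain : forall m w v, w < 0 -> 0 < v ->
  Cmod (cocycle f z0 (mat_pow B m) w v - RtoC (INR m) * cocycle f z0 B w0 v0) <=
  K * Rabs (w - w0) / (1 - u) + K * (1 + v0) * ((1 - l ^ m) / (1 - l))).
{ induction m as [|m IH]; intros w v Hw Hv.
  - cbn [mat_pow INR]. rewrite cocycle_id by assumption.
    replace (RtoC 0 - RtoC 0 * cocycle f z0 B w0 v0)%C with (RtoC 0) by ring.
    rewrite Cmod_0, pow_O. replace (1 - 1) with 0 by ring.
    unfold Rdiv at 2; rewrite Rmult_0_l, Rmult_0_r, Rplus_0_r.
    apply Rmult_le_pos; [apply Rmult_le_pos; [exact HK0|apply Rabs_pos]|].
    apply Rlt_le, Rinv_0_lt_compat; lra.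
  - assert (Hm := mat_pow_nonneg B m Hn).
    change (mat_pow B (S m)) with (mat_mul B (mat_pow B m)).
    rewrite cocycle_mul by assumption.
    destruct (mobius_adj_neg B w Hn Hw) as (_ & Hw' & _).
    specialize (IH _ v Hw' Hv).
    set (w' := mobius_real (mat_adj B) w) in *.
    assert (H1 : Cmod (cocycle f z0 B w (mobius_real (mat_pow B m) v) - cocycle f z0 B w0 v0)
      <= K * (Rabs (w - w0) + (1 + v0) * l ^ m)).
    (* The second pole is already the image of v under B^(m+1), so the uniform bound on it applies
       even for m = 0. *)
    { unfold cocycle. rewrite Ev, <- mobius_real_mul by assumption.
      eapply Rle_trans; [apply (proj2 (HK _ _))|].
      apply Rmult_le_compat_l; [exact HK0|]. apply Rplus_le_compat_l.
      exact (Hpos m v Hv). }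
    rewrite S_INR, RtoC_plus.
    match goal with |- Cmod ?e <= _ => replace e with
      ((cocycle f z0 B w (mobius_real (mat_pow B m) v) - cocycle f z0 B w0 v0) +
       (cocycle f z0 (mat_pow B m) w' v - RtoC (INR m) * cocycle f z0 B w0 v0))%C by ring end.
    eapply Rle_trans; [apply Cmod_triangle|].
    eapply Rle_trans; [apply Rplus_le_compat; [exact H1|exact IH]|].
    destruct (Hneg w Hw) as [H2 _]. fold w' in H2.
    assert (H3 : K * Rabs (w' - w0) / (1 - u) <= K * (u * Rabs (w - w0)) / (1 - u)).
    { apply Rmult_le_compat_r; [apply Rlt_le, Rinv_0_lt_compat; lra|].
      apply Rmult_le_compat_l; assumption. }
    eapply Rle_trans; [apply Rplus_le_compat_l, Rplus_le_compat_r, H3|].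
    right. simpl pow. field. lra. }
(* The bound of [Hmain] still depends on w. The leading B is therefore estimated crudely by K, after
   which w has moved within 1 - w0 of w0. *)
exists (K + (K * (1 - w0) / (1 - u) + K * (1 + v0) * / (1 - l))).
intros m w v Hw Hv.
assert (Hm := mat_pow_nonneg B m Hn).
change (mat_pow B (S m)) with (mat_mul B (mat_pow B m)).
rewrite cocycle_mul by assumption.
destruct (mobius_adj_neg B w Hn Hw) as (_ & Hw' & _).
specialize (Hmain m _ v Hw' Hv).
destruct (Hneg w Hw) as [_ H2].
set (w' := mobius_real (mat_adj B) w) in *.
match goal with |- Cmod ?e <= _ => replace e with
  (cocycle f z0 B w (mobius_real (mat_pow B m) v) +
   (cocycle f z0 (mat_pow B m) w' v - RtoC (INR m) * cocycle f z0 B w0 v0))%C by ring end.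
eapply Rle_trans; [apply Cmod_triangle|].
apply Rplus_le_compat; [exact (proj1 (HK _ _))|].
eapply Rle_trans; [exact Hmain|].
apply Rplus_le_compat.
- apply Rmult_le_compat_r; [apply Rlt_le, Rinv_0_lt_compat; lra|].
  apply Rmult_le_compat_l; assumption.
- apply Rmult_le_compat_l; [assumption|].
  rewrite <- (Rmult_1_l (/ (1 - l))). apply Rmult_le_compat_r; [apply Rlt_le, Rinv_0_lt_compat; lra|].
  assert (0 <= l ^ m) by (apply pow_le; lra). lra.
Qed.

(** * Words in T and V, with their length *)

Inductive word : nat -> mat2 -> Prop :=
| word_nil : word 0 mat_id
| word_T n A : word n A -> word (S n) (mat_mul mat_T A)
| word_V n A : word n A -> word (S n) (mat_mul mat_V A).

Lemma mat_T_nonneg : nonneg_SL2 mat_T.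
Proof. split; [reflexivity|cbn; lia]. Qed.

Lemma mat_V_nonneg : nonneg_SL2 mat_V.
Proof. split; [reflexivity|cbn; lia]. Qed.

Lemma word_nonneg (n : nat) (A : mat2) : word n A -> nonneg_SL2 A.
Proof.
induction 1; [split; [reflexivity|cbn; lia]| |];
  apply nonneg_SL2_mul; trivial; [exact mat_T_nonneg|exact mat_V_nonneg].
Qed.

Lemma word_mul (n k : nat) (A B : mat2) : word n A -> word k B -> word (n + k) (mat_mul A B).
Proof.
intros HA HB; induction HA; simpl.
- now rewrite mat_mul_id_l.
- rewrite <- mat_mul_assoc; now constructor.
- rewrite <- mat_mul_assoc; now constructor.
Qed.

Lemma word_cocycle_bound (f : C -> C) (z0 : C) :
  weakly_holomorphic_modular_function f -> 0 < Im z0 ->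
  exists K, 0 <= K /\ forall n A, word n A -> forall w v, w < 0 -> 0 < v ->
    Cmod (cocycle f z0 A w v) <= K * INR n.
Proof.
intros Hf Hz.
assert (Hb : forall M, nonneg_SL2 M -> exists K, 0 <= K /\ forall w v, Cmod (cocycle f z0 M w v) <= K).
{ intros M HM.
  destruct (segment_kern_bounds f z0 (mobius M z0) (whm_holomorphic_H f Hf) Hz
    (Im_mobius_pos M z0 (proj1 HM) Hz)) as (K & HK0 & HK).
  exists K; split; [exact HK0|]; intros w v; exact (proj1 (HK _ _)). }
destruct (Hb _ mat_T_nonneg) as (K1 & HK1 & H1).
destruct (Hb _ mat_V_nonneg) as (K2 & HK2 & H2).
exists (K1 + K2); split; [lra|].
induction 1 as [|n A HA IH|n A HA IH]; intros w v Hw Hv.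
- rewrite cocycle_id, Cmod_0 by assumption. simpl; lra.
- rewrite cocycle_mul by (trivial; exact mat_T_nonneg || exact (word_nonneg _ _ HA)).
  destruct (mobius_adj_neg _ w mat_T_nonneg Hw) as (_ & Hw' & _).
  specialize (IH _ v Hw' Hv). specialize (H1 w (mobius_real A v)).
  eapply Rle_trans; [apply Cmod_triangle|]. rewrite S_INR. lra.
- rewrite cocycle_mul by (trivial; exact mat_V_nonneg || exact (word_nonneg _ _ HA)).
  destruct (mobius_adj_neg _ w mat_V_nonneg Hw) as (_ & Hw' & _).
  specialize (IH _ v Hw' Hv). specialize (H2 w (mobius_real A v)).
  eapply Rle_trans; [apply Cmod_triangle|]. rewrite S_INR. lra.
Qed.

(** Determinant 1 excludes a zero row of M, so each entry of the product is at least some entry of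
    N. The mirror statement uses the columns. *)
Lemma pos_SL2_mul_l (M N : mat2) : nonneg_SL2 M -> pos_SL2 N -> pos_SL2 (mat_mul M N).
Proof.
intros [H1 H1'] [H2 H2']; split; [now apply SL2Z_mul|].
unfold SL2Z, mat_det in H1.
assert (1 <= m11 M + m12 M /\ 1 <= m21 M + m22 M)%Z by nia.
unfold mat_mul; cbn [m11 m12 m21 m22]; nia.
Qed.

Lemma pos_SL2_mul_r (M N : mat2) : pos_SL2 M -> nonneg_SL2 N -> pos_SL2 (mat_mul M N).
Proof.
intros [H1 H1'] [H2 H2']; split; [now apply SL2Z_mul|].
unfold SL2Z, mat_det in H2.
assert (1 <= m11 N + m21 N /\ 1 <= m12 N + m22 N)%Z by nia.
unfold mat_mul; cbn [m11 m12 m21 m22]; nia.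
Qed.

(** The product is evaluated at its own axis (w, v), about which only w < 0 < v is used: the bounds
    for P, for the power of B and for [S'] hold at all poles of these signs. *)
Lemma cycle_integral_word_pow (f : C -> C) (z0 : C) (B P : mat2) (p L : nat) :
  weakly_holomorphic_modular_function f -> 0 < Im z0 -> pos_SL2 B -> word p P ->
  exists K, forall m s S', word s S' -> (s <= L)%nat ->
    Cmod (cycle_integral f z0 (mat_mul P (mat_mul (mat_pow B (S m)) S'))
          - RtoC (INR m) * cycle_integral f z0 B) <= K.
Proof.
intros Hf Hz HB HP.
destruct (exists_axis B HB) as (w0 & v0 & Hax0 & _).
destruct (cocycle_pow_linear f z0 B w0 v0 Hf Hz HB Hax0) as (K1 & HK1).
destruct (word_cocycle_bound f z0 Hf Hz) as (K2 & HK20 & HK2).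
rewrite (cycle_integral_cocycle f z0 B w0 v0) by assumption.
exists (K2 * INR p + (K1 + K2 * INR L)); intros m s S' HS Hs.
assert (HPn := word_nonneg _ _ HP). assert (HSn := word_nonneg _ _ HS).
assert (HBn := mat_pow_nonneg B (S m) (pos_SL2_nonneg B HB)).
assert (HBp : pos_SL2 (mat_pow B (S m)))
  by (apply pos_SL2_mul_r; [exact HB|apply mat_pow_nonneg, pos_SL2_nonneg, HB]).
assert (HA : pos_SL2 (mat_mul P (mat_mul (mat_pow B (S m)) S'))).
{ apply pos_SL2_mul_l; [exact HPn|]. now apply pos_SL2_mul_r. }
destruct (exists_axis _ HA) as (w & v & Hax & _).
rewrite (cycle_integral_cocycle f z0 _ w v) by assumption.
destruct Hax as (Hw & Hv & _).
rewrite cocycle_mul by (trivial; now apply nonneg_SL2_mul).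
destruct (mobius_adj_neg P w HPn Hw) as (_ & Hw1 & _).
rewrite cocycle_mul by trivial.
destruct (mobius_adj_neg _ _ HBn Hw1) as (_ & Hw2 & _).
destruct (mobius_real_pos S' v HSn Hv) as [_ Hv1].
set (w1 := mobius_real (mat_adj P) w) in *.
set (w2 := mobius_real (mat_adj (mat_pow B (S m))) w1) in *.
assert (B1 := HK2 _ _ HP w (mobius_real (mat_mul (mat_pow B (S m)) S') v) Hw
  (proj2 (mobius_real_pos _ v (nonneg_SL2_mul _ _ HBn HSn) Hv))).
assert (B2 := HK1 m w1 _ Hw1 Hv1).
assert (B3 := HK2 _ _ HS w2 v Hw2 Hv).
assert (B4 : K2 * INR s <= K2 * INR L) by (apply Rmult_le_compat_l; [assumption|now apply le_INR]).
match goal with |- Cmod (?x + (?y + ?z) - ?i) <= _ =>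
  replace (x + (y + z) - i)%C with (x + ((y - i) + z))%C by ring end.
eapply Rle_trans; [apply Cmod_triangle|]. apply Rplus_le_compat; [exact B1|].
eapply Rle_trans; [apply Cmod_triangle|]. lra.
Qed.

(** * The arc from rho to rho + 1 *)

Definition arc (t : R) : C := (cos t, sin t).
Notation rho := (arc (2 * PI / 3)).

Lemma arc_rho : rho = (-1/2, sqrt 3 / 2).
Proof.
unfold arc. replace (2 * PI / 3) with (2 * (PI / 3)) by field.
now rewrite cos_2PI3, sin_2PI3.
Qed.

Lemma arc_PI3 : arc (PI / 3) = (1/2, sqrt 3 / 2).
Proof. unfold arc; now rewrite cos_PI3, sin_PI3. Qed.

Lemma Im_arc_pos (t : R) : PI / 3 <= t <= 2 * PI / 3 -> 0 < Im (arc t).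
Proof. intros Ht; assert (H := PI_RGT_0); apply sin_gt_0; lra. Qed.

Lemma Im_rho_pos : 0 < Im rho.
Proof. apply Im_arc_pos; assert (H := PI_RGT_0); lra. Qed.

Lemma mobius_T_eq (z : C) : mobius mat_T z = (z + 1)%C.
Proof. unfold mobius; cbn; field. Qed.

Lemma mobius_T_rho : mobius mat_T rho = arc (PI / 3).
Proof. rewrite mobius_T_eq, arc_rho, arc_PI3; apply injective_projections; simpl; field. Qed.

(** From rho^2 + rho + 1 = 0 one gets (rho + 1)^2 = rho, that is rho / (rho + 1) = rho + 1. *)
Lemma mobius_V_rho : mobius mat_V rho = arc (PI / 3).
Proof.
assert (Hs : sqrt 3 * sqrt 3 = 3) by (apply sqrt_sqrt; lra).
assert (Hn : (rho + 1)%C <> RtoC 0).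
{ rewrite arc_rho; intros E; apply (f_equal Re) in E; unfold Re in E; simpl in E; lra. }
transitivity (rho / (rho + 1))%C; [unfold mobius; cbn; f_equal; [ring|f_equal; ring]|].
transitivity (arc (PI / 3) * (rho + 1) / (rho + 1))%C; [|field; exact Hn].
f_equal. rewrite arc_rho, arc_PI3; apply injective_projections; simpl; nra.
Qed.

Lemma Rderive_C_arc (t : R) : Rderive_C arc t (Ci * arc t)%C.
Proof.
replace (Ci * arc t)%C with (- sin t, cos t) by (apply injective_projections; simpl; ring).
apply (Rderive_C_pair cos sin); [apply is_derive_cos|apply is_derive_sin].
Qed.

(** The real part of i e^(it) / (e^(it) - u), with denominator |e^(it) - u|^2. For 0 < t < PI it has
    the sign of u. *)
Definition pole_weight (t u : R) : R := sin t * (u / (1 - 2 * u * cos t + u ^ 2)).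

Lemma pole_weight_den_pos (t u : R) : 0 < sin t -> 0 < 1 - 2 * u * cos t + u ^ 2.
Proof.
intros Hs; assert (H := sin2_cos2 t); unfold Rsqr in H.
assert (H1 := pow2_ge_0 (u - cos t)). assert (H2 := Rmult_lt_0_compat _ _ Hs Hs). nra.
Qed.

(** On the unit circle |e^(it) - 1/u| = |e^(it) - u| / |u|, so numerator and denominator scale
    alike. The symmetry between T and V comes from here. *)
Lemma pole_weight_inv (t u : R) : 0 < sin t -> u <> 0 -> pole_weight t (/ u) = pole_weight t u.
Proof.
intros Hs Hu; unfold pole_weight; f_equal.
assert (H := pole_weight_den_pos t u Hs).
set (X := 1 - 2 * u * cos t + u ^ 2) in *.
replace (1 - 2 * / u * cos t + (/ u) ^ 2) with (X / u ^ 2) by (unfold X; field; exact Hu).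
field; split; [lra|exact Hu].
Qed.

Lemma Re_pole (t u : R) : 0 < sin t ->
  Re (Ci * arc t * / (arc t - RtoC u))%C = pole_weight t u.
Proof.
intros Hs. unfold pole_weight. assert (H := pole_weight_den_pos t u Hs).
assert (H1 := sin2_cos2 t); unfold Rsqr in H1.
unfold arc, Re; simpl. set (s := sin t) in *; set (c := cos t) in *.
assert (E : (c + - u) ^ 2 + (s + - 0) ^ 2 = 1 - 2 * u * c + u ^ 2) by nra.
simpl in E. rewrite E. field_simplify_eq; [|simpl in H; lra]. nra.
Qed.

Definition arc_real (f : C -> C) : Prop := forall t, PI / 3 <= t <= 2 * PI / 3 ->
  Im (f (arc t)) = 0 /\ 0 <= Re (f (arc t)).

(** The segment integral is an increment of a primitive P, and P may be followed along the arc
    instead. There f is real and leaves the real part, so the derivative of Re P factors. *)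
Lemma arc_segment (f : C -> C) (w v : R) :
  weakly_holomorphic_modular_function f -> arc_real f ->
  exists phi : R -> R,
    Re (segment_integral (fun z => f z * kern w v z)%C rho (arc (PI / 3)))
      = phi (2 * PI / 3) - phi (PI / 3) /\
    forall t, PI / 3 <= t <= 2 * PI / 3 ->
      is_derive phi t (Re (f (arc t)) * (pole_weight t v - pole_weight t w)).
Proof.
intros Hf Hr. assert (HPI := PI_RGT_0).
destruct (exists_primitive_H _ (holomorphic_H_f_kern f w v Hf)) as [P HP].
(* From [rho] to rho + 1 the angle decreases from [2 * PI / 3] to [PI / 3], whence the sign. *)
exists (fun t => - Re (P (arc t))); split.
- rewrite (segment_integral_primitive _ P); trivial;
    [|now apply holomorphic_H_f_kern|exact Im_rho_pos|apply Im_arc_pos; lra].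
  unfold Cminus, Re; simpl; ring.
- intros t Ht.
  assert (Hs : 0 < sin t) by (apply sin_gt_0; lra).
  assert (Hd := Rderive_C_Re _ _ _
    (Rderive_C_comp P arc t _ _ (HP _ (Im_arc_pos t Ht)) (Rderive_C_arc t))).
  apply (is_derive_opp (fun t => Re (P (arc t)))) in Hd.
  match type of Hd with is_derive _ _ ?l =>
    replace (Re (f (arc t)) * _) with l; [exact Hd|] end.
  destruct (Hr t Ht) as [Hi _].
  rewrite <- !Re_pole by exact Hs.
  assert (Ef : f (arc t) = RtoC (Re (f (arc t))))
    by (apply injective_projections; [reflexivity|exact Hi]).
  rewrite Ef. unfold kern.
  set (F := Re (f (arc t))). set (X := (/ (arc t - RtoC w))%C). set (Y := (/ (arc t - RtoC v))%C).
  replace (Ci * arc t * (RtoC F * (X - Y)))%C with (RtoC F * (Ci * arc t * X - Ci * arc t * Y))%C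
    by ring.
  set (X' := (Ci * arc t * X)%C). set (Y' := (Ci * arc t * Y)%C).
  unfold opp, Re; simpl. ring.
Qed.

Lemma arc_segment_inv (f : C -> C) (w v : R) :
  weakly_holomorphic_modular_function f -> arc_real f -> w <> 0 -> v <> 0 ->
  Re (segment_integral (fun z => f z * kern (/ w) (/ v) z)%C rho (arc (PI / 3))) =
  Re (segment_integral (fun z => f z * kern w v z)%C rho (arc (PI / 3))).
Proof.
intros Hf Hr Hw Hv. assert (HPI := PI_RGT_0).
destruct (arc_segment f w v Hf Hr) as (p & -> & Hp).
destruct (arc_segment f (/ w) (/ v) Hf Hr) as (q & -> & Hq).
assert (Hd : forall t, PI / 3 <= t <= 2 * PI / 3 -> is_derive (fun s => q s - p s) t 0).
{ intros t Ht. assert (Hs : 0 < sin t) by (apply sin_gt_0; lra).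
  specialize (Hp t Ht); specialize (Hq t Ht). rewrite !pole_weight_inv in Hq by assumption.
  assert (H := is_derive_minus _ _ _ _ _ Hq Hp). rewrite minus_eq_zero in H. exact H. }
destruct (MVT_gen (fun s => q s - p s) (PI / 3) (2 * PI / 3) (fun _ => 0)) as (x & _ & Hx).
- rewrite Rmin_left, Rmax_right by lra. intros t Ht; apply Hd; lra.
- rewrite Rmin_left, Rmax_right by lra. intros t Ht.
  apply derivable_continuous_pt; exists 0; apply is_derive_Reals; apply Hd; lra.
- lra.
Qed.

Definition arc_nonzero (f : C -> C) : Prop :=
  exists t, PI / 3 < t < 2 * PI / 3 /\ f (arc t) <> RtoC 0.

(** The function [p] is nondecreasing. If its total increment were 0 it would be constant, with
    derivative 0 at the interior point [t0], where the weight is positive and f is not 0. *)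
Lemma arc_segment_pos (f : C -> C) (w v : R) :
  weakly_holomorphic_modular_function f -> arc_real f -> arc_nonzero f -> w < 0 -> 0 < v ->
  0 < Re (segment_integral (fun z => f z * kern w v z)%C rho (arc (PI / 3))).
Proof.
intros Hf Hr (t0 & Ht0 & Hn) Hw Hv. assert (HPI := PI_RGT_0).
destruct (arc_segment f w v Hf Hr) as (p & -> & Hp).
assert (Hwt : forall t, PI / 3 <= t <= 2 * PI / 3 -> 0 < pole_weight t v - pole_weight t w).
{ intros t Ht. assert (Hs : 0 < sin t) by (apply sin_gt_0; lra).
  assert (Hdv := pole_weight_den_pos t v Hs). assert (Hdw := pole_weight_den_pos t w Hs).
  unfold pole_weight. rewrite <- Rmult_minus_distr_l. apply Rmult_lt_0_compat; [exact Hs|].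
  assert (0 < v / (1 - 2 * v * cos t + v ^ 2)) by (apply Rdiv_lt_0_compat; lra).
  assert (0 < (- w) / (1 - 2 * w * cos t + w ^ 2)) by (apply Rdiv_lt_0_compat; lra).
  unfold Rdiv in *; lra. }
assert (Hmono : forall a b, PI / 3 <= a -> a <= b -> b <= 2 * PI / 3 -> p a <= p b).
{ intros a b Ha Hab Hb.
  destruct (MVT_gen p a b (fun t => Re (f (arc t)) * (pole_weight t v - pole_weight t w)))
    as (x & Hx & E).
  - rewrite Rmin_left, Rmax_right by lra. intros t Ht; apply Hp; lra.
  - rewrite Rmin_left, Rmax_right by lra. intros t Ht.
    apply derivable_continuous_pt; eexists; apply is_derive_Reals; apply Hp; lra.
  - rewrite Rmin_left, Rmax_right in Hx by lra.
    assert (H1 := Hwt x ltac:(lra)). assert (H2 := proj2 (Hr x ltac:(lra))).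
    assert (0 <= Re (f (arc x)) * (pole_weight x v - pole_weight x w) * (b - a)).
    { apply Rmult_le_pos; [apply Rmult_le_pos; lra|lra]. }
    lra. }
assert (H0 := Hmono (PI / 3) (2 * PI / 3) ltac:(lra) ltac:(lra) ltac:(lra)).
destruct (Rle_lt_or_eq_dec _ _ H0) as [H|E]; [lra|exfalso].
assert (Hc : forall t, PI / 3 <= t <= 2 * PI / 3 -> p t = p t0).
{ intros t Ht.
  assert (A1 := Hmono (PI / 3) t ltac:(lra) ltac:(lra) ltac:(lra)).
  assert (A2 := Hmono t (2 * PI / 3) ltac:(lra) ltac:(lra) ltac:(lra)).
  assert (A3 := Hmono (PI / 3) t0 ltac:(lra) ltac:(lra) ltac:(lra)).
  assert (A4 := Hmono t0 (2 * PI / 3) ltac:(lra) ltac:(lra) ltac:(lra)). lra. }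
assert (Hd0 : is_derive p t0 0).
{ apply (is_derive_ext_loc (fun _ => p t0)); 
    [|apply (is_derive_const (K := R_AbsRing) (V := R_NormedModule))].
  apply (locally_interval _ t0 (PI / 3) (2 * PI / 3)); simpl; try lra.
  intros y H1 H2; symmetry; apply Hc; lra. }
assert (Hd1 := Hp t0 ltac:(lra)).
apply is_derive_unique in Hd0, Hd1. rewrite Hd0 in Hd1.
assert (Hw0 := Hwt t0 ltac:(lra)).
symmetry in Hd1; apply Rmult_integral in Hd1 as [Hd1|Hd1]; [|lra].
apply Hn. apply injective_projections; [exact Hd1|exact (proj1 (Hr t0 ltac:(lra)))].
Qed.

(** * Exchanging T and V *)

(** Conjugation by the permutation matrix that acts as x -> 1/x. *)
Definition mat_swap (A : mat2) : mat2 := Mat2 (m22 A) (m21 A) (m12 A) (m11 A).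

Lemma mat_swap_mul (A B : mat2) : mat_swap (mat_mul A B) = mat_mul (mat_swap A) (mat_swap B).
Proof. unfold mat_swap, mat_mul; cbn; f_equal; ring. Qed.

Lemma word_swap (n : nat) (A : mat2) : word n A -> word n (mat_swap A).
Proof. induction 1; [constructor| |]; rewrite mat_swap_mul; now constructor. Qed.

Lemma nonneg_SL2_swap (A : mat2) : nonneg_SL2 A -> nonneg_SL2 (mat_swap A).
Proof.
unfold nonneg_SL2, SL2Z, mat_det, mat_swap; cbn [m11 m12 m21 m22].
intros [H1 H2]; split; [rewrite <- H1; ring|lia].
Qed.

Lemma pos_SL2_swap (A : mat2) : pos_SL2 A -> pos_SL2 (mat_swap A).
Proof.
unfold pos_SL2, SL2Z, mat_det, mat_swap; cbn [m11 m12 m21 m22].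
intros [H1 H2]; split; [rewrite <- H1; ring|lia].
Qed.

Lemma mobius_real_swap (A : mat2) (v : R) : nonneg_SL2 A -> 0 < v ->
  mobius_real (mat_swap A) (/ v) = / mobius_real A v.
Proof.
intros HA Hv. destruct (mobius_real_pos A v HA Hv) as [H1 H2].
destruct (mobius_real_pos _ _ (nonneg_SL2_swap A HA) (Rinv_0_lt_compat v Hv)) as [H3 _].
unfold mobius_real, mat_swap in *; cbn [m11 m12 m21 m22] in *.
set (a := IZR (m11 A)) in *; set (b := IZR (m12 A)) in *;
set (c := IZR (m21 A)) in *; set (d := IZR (m22 A)) in *.
assert (H4 : 0 < a * v + b).
{ replace (a * v + b) with ((a * v + b) / (c * v + d) * (c * v + d)) by (field; lra).
  now apply Rmult_lt_0_compat. }
field; repeat split; lra.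
Qed.

Lemma mobius_adj_swap (A : mat2) (w : R) : nonneg_SL2 A -> w < 0 ->
  mobius_real (mat_adj (mat_swap A)) (/ w) = / mobius_real (mat_adj A) w.
Proof.
intros HA Hw. destruct (mobius_adj_neg A w HA Hw) as (H1 & H2 & _).
destruct (mobius_adj_neg _ _ (nonneg_SL2_swap A HA) (Rinv_lt_0_compat w Hw)) as (H3 & _).
unfold mobius_real, mat_adj, mat_swap in *; cbn [m11 m12 m21 m22] in *.
rewrite !opp_IZR in *.
set (a := IZR (m11 A)) in *; set (b := IZR (m12 A)) in *;
set (c := IZR (m21 A)) in *; set (d := IZR (m22 A)) in *.
assert (H4 : d * w + - b < 0).
{ replace (d * w + - b) with ((d * w + - b) / (- c * w + a) * (- c * w + a)) by (field; lra).
  nra. }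
field; repeat split; lra.
Qed.

(** Stated for all poles of the right signs because splitting off a letter moves them. Nonnegativity
    is kept separately, since the remaining word may be empty. *)
Lemma word_cocycle_rho (f : C -> C) (n : nat) (A : mat2) :
  weakly_holomorphic_modular_function f -> arc_real f -> arc_nonzero f -> word n A ->
  forall w v, w < 0 -> 0 < v ->
  0 <= Re (cocycle f rho A w v) /\ ((0 < n)%nat -> 0 < Re (cocycle f rho A w v)) /\
  Re (cocycle f rho (mat_swap A) (/ w) (/ v)) = Re (cocycle f rho A w v).
Proof.
intros Hf Hr Hn HA. assert (Hz := Im_rho_pos).
assert (Hstep : forall M k A, nonneg_SL2 M -> mobius M rho = arc (PI / 3) ->
  mobius (mat_swap M) rho = arc (PI / 3) -> word k A ->
  (forall w v, w < 0 -> 0 < v ->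
  0 <= Re (cocycle f rho A w v) /\ ((0 < k)%nat -> 0 < Re (cocycle f rho A w v)) /\
  Re (cocycle f rho (mat_swap A) (/ w) (/ v)) = Re (cocycle f rho A w v)) ->
  forall w v, w < 0 -> 0 < v ->
  0 <= Re (cocycle f rho (mat_mul M A) w v) /\
  ((0 < S k)%nat -> 0 < Re (cocycle f rho (mat_mul M A) w v)) /\
  Re (cocycle f rho (mat_swap (mat_mul M A)) (/ w) (/ v)) = Re (cocycle f rho (mat_mul M A) w v)).
{ clear n A HA. intros M k A HM HM1 HM2 HA IH w v Hw Hv.
  assert (HAn := word_nonneg _ _ HA).
  assert (Hw' := Rinv_lt_0_compat w Hw). assert (Hv' := Rinv_0_lt_compat v Hv).
  rewrite mat_swap_mul, !cocycle_mul by (trivial; now apply nonneg_SL2_swap).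
  rewrite mobius_real_swap, mobius_adj_swap by assumption.
  destruct (mobius_adj_neg M w HM Hw) as (_ & Hw1 & _).
  destruct (mobius_real_pos A v HAn Hv) as [_ Hv1].
  destruct (mobius_real_pos M _ HM Hv1) as [_ Hv2].
  specialize (IH _ v Hw1 Hv). destruct IH as (I1 & _ & I2).
  (* These occurrences belong to the leading letter. Each becomes an integral from [rho] to rho + 1,
     while the rest stays folded for the induction hypothesis. *)
  unfold cocycle at 1 3 5 7. rewrite HM1, HM2, mobius_real_swap by assumption.
  assert (HP := arc_segment_pos f w (mobius_real M (mobius_real A v)) Hf Hr Hn Hw Hv2).
  assert (HI := arc_segment_inv f w (mobius_real M (mobius_real A v)) Hf Hr
    (Rlt_not_eq _ _ Hw) (Rgt_not_eq _ _ Hv2)).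
  assert (ReD : forall x y : C, Re (x + y)%C = Re x + Re y) by reflexivity.
  rewrite !ReD, HI, I2. repeat split; lra. }
induction HA as [|n A HA IH|n A HA IH].
- intros w v Hw Hv. change (mat_swap mat_id) with mat_id.
  rewrite !cocycle_id by assumption. repeat split; [simpl; lra|lia].
- apply Hstep; trivial; [exact mat_T_nonneg|exact mobius_T_rho|exact mobius_V_rho].
- apply Hstep; trivial; [exact mat_V_nonneg|exact mobius_V_rho|exact mobius_T_rho].
Qed.

Lemma axis_swap (A : mat2) (w v : R) : pos_SL2 A -> axis A w v -> axis (mat_swap A) (/ w) (/ v).
Proof.
intros HA%pos_SL2_nonneg (Hw & Hv & Ew & Ev); split; [now apply Rinv_lt_0_compat|].
split; [now apply Rinv_0_lt_compat|].
rewrite mobius_adj_swap, mobius_real_swap, Ew, Ev by assumption; split; reflexivity.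
Qed.

(** The endpoints of the axis are fixed, so the base point may be moved to [rho], where every letter
    contributes the same arc. *)
Lemma cycle_integral_word (f : C -> C) (z0 : C) (n : nat) (A : mat2) :
  weakly_holomorphic_modular_function f -> arc_real f -> arc_nonzero f -> 0 < Im z0 ->
  (0 < n)%nat -> word n A -> pos_SL2 A ->
  0 < Re (cycle_integral f z0 A) /\
  Re (cycle_integral f z0 (mat_swap A)) = Re (cycle_integral f z0 A).
Proof.
intros Hf Hr Hn Hz Hlt HA Hp.
destruct (exists_axis A Hp) as (w & v & Hax & _).
assert (Hax' := axis_swap A w v Hp Hax). assert (Hp' := pos_SL2_swap A Hp).
rewrite (cycle_integral_cocycle f z0 A w v), (cycle_integral_cocycle f z0 _ _ _ Hp' Hax') by assumption.
assert (Hb : forall B w v, pos_SL2 B -> axis B w v -> cocycle f z0 B w v = cocycle f rho B w v).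
{ intros B w1 v1 HB (H1 & H2 & H3 & H4).
  apply cocycle_base_point; trivial; [exact Im_rho_pos|now apply pos_SL2_nonneg]. }
rewrite (Hb A), (Hb (mat_swap A)) by assumption.
destruct Hax as (Hw & Hv & _).
destruct (word_cocycle_rho f n A Hf Hr Hn HA w v Hw Hv) as (_ & H1 & H2).
split; [now apply H1|exact H2].
Qed.

(** * Non-vanishing on the arc *)

Lemma nome_plus (a b : C) : nome (a + b) = (nome a * nome b)%C.
Proof.
unfold nome. destruct a as [x y], b as [x' y']; unfold Re, Im; simpl.
replace (- (2 * PI * (y + y'))) with (- (2 * PI * y) + - (2 * PI * y')) by ring.
rewrite exp_plus, !Rmult_plus_distr_l, cos_plus, sin_plus.
apply injective_projections; simpl; ring.
Qed.

Lemma Cmod_nome (z : C) : Cmod (nome z) = exp (- (2 * PI * Im z)).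
Proof.
unfold nome, Cmod; cbn [fst snd].
set (r := exp _). set (x := 2 * PI * Re z).
assert (H := sin2_cos2 x); unfold Rsqr in H.
replace ((r * cos x) ^ 2 + (r * sin x) ^ 2) with (r * r) by nra.
apply sqrt_square, Rlt_le, exp_pos.
Qed.

Lemma nome_IZR (k : Z) : nome (RtoC (IZR k)) = RtoC 1.
Proof.
unfold nome. unfold Re, Im; cbn [fst snd RtoC].
rewrite Rmult_0_r, Ropp_0, exp_0.
replace (2 * PI * IZR k) with (IZR (2 * k) * PI) by (rewrite mult_IZR; ring).
rewrite (sin_eq_0_1 (IZR (2 * k) * PI)) by now exists (2 * k)%Z.
assert (Hc : cos (IZR (2 * k) * PI) = 1).
{ replace (IZR (2 * k) * PI) with (2 * (IZR k * PI)) by (rewrite mult_IZR; ring).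
  rewrite cos_2a_sin, (sin_eq_0_1 (IZR k * PI)) by now exists k. ring. }
rewrite Hc; apply injective_projections; simpl; ring.
Qed.

Lemma is_derive_0_bound (u : R -> R) (l eta : R) : is_derive u 0 l -> 0 < eta ->
  exists delta, 0 < delta /\ forall x, Rabs x < delta -> Rabs (u x - u 0 - x * l) <= eta * Rabs x.
Proof.
intros [_ H] He.
destruct (H 0 (fun P HP => HP) (mkposreal eta He)) as [d Hd].
exists d; split; [apply cond_pos|intros x Hx].
specialize (Hd x). change (Rabs (x - 0) < d ->
  Rabs (u x - u 0 - (x - 0) * l) <= eta * Rabs (x - 0)) in Hd.
rewrite Rminus_0_r in Hd; now apply Hd.
Qed.

(** The only point where the derivative needs estimates: multiplicativity of [nome] carries it to
    every other point. *)
Lemma Cderive_nome_0 : Cderive nome (RtoC 0) (RtoC (2 * PI) * Ci)%C.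
Proof.
apply Cderive_iff; intros eps He.
(* With 2 PI <= 8 both |X| and |Y| are at most 8 |h|. The remainder is at most eta (|X| + 5 |Y|),
   that is 48 eta |h|, so 80 leaves room. *)
set (eta := Rmin 1 (eps / 80)).
assert (Heta : 0 < eta) by (apply Rmin_pos; lra).
assert (Heta1 : eta <= 1) by apply Rmin_l.
assert (Heta2 : eta <= eps / 80) by apply Rmin_r.
assert (De := is_derive_exp 0); rewrite exp_0 in De.
assert (Dc := is_derive_cos 0); rewrite sin_0, Ropp_0 in Dc.
assert (Ds := is_derive_sin 0); rewrite cos_0 in Ds.
destruct (is_derive_0_bound exp 1 eta De Heta) as (d1 & Hd1 & H1).
destruct (is_derive_0_bound cos 0 eta Dc Heta) as (d2 & Hd2 & H2).
destruct (is_derive_0_bound sin 1 eta Ds Heta) as (d3 & Hd3 & H3).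
assert (HPI := PI_RGT_0). assert (HPI4 := PI_4).
set (d := Rmin (Rmin d1 d2) (Rmin d3 (eta / 2))).
assert (Hd : 0 < d) by (repeat apply Rmin_pos; lra).
assert (D1 : d <= d1) by (eapply Rle_trans; [apply Rmin_l|apply Rmin_l]).
assert (D2 : d <= d2) by (eapply Rle_trans; [apply Rmin_l|apply Rmin_r]).
assert (D3 : d <= d3) by (eapply Rle_trans; [apply Rmin_r|apply Rmin_l]).
assert (D4 : d <= eta / 2) by (eapply Rle_trans; [apply Rmin_r|apply Rmin_r]).
exists (d / 8); split; [lra|intros h Hh].
replace (h - RtoC 0)%C with h in * by ring.
assert (Hre := re_le_Cmod h). assert (Him := im_le_Cmod h).
set (X := - (2 * PI * Im h)). set (Y := 2 * PI * Re h).
assert (HX : Rabs X <= 8 * Cmod h).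
{ unfold X; rewrite Rabs_Ropp, Rabs_mult, Rabs_pos_eq by lra.
  assert (H0 := Rabs_pos (Im h)); nra. }
assert (HY : Rabs Y <= 8 * Cmod h).
{ unfold Y; rewrite Rabs_mult, Rabs_pos_eq by lra. assert (H0 := Rabs_pos (Re h)); nra. }
specialize (H1 X ltac:(lra)); specialize (H2 Y ltac:(lra)); specialize (H3 Y ltac:(lra)).
rewrite exp_0 in H1; rewrite cos_0 in H2; rewrite sin_0 in H3.
replace (exp X - 1 - X * 1) with (exp X - 1 - X) in H1 by ring.
replace (cos Y - 1 - Y * 0) with (cos Y - 1) in H2 by ring.
replace (sin Y - 0 - Y * 1) with (sin Y - Y) in H3 by ring.
assert (E : (nome h - nome 0 - h * (RtoC (2 * PI) * Ci))%C =
  ((exp X - 1 - X) * cos Y + (1 + X) * (cos Y - 1), (exp X - 1) * sin Y + (sin Y - Y))).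
{ rewrite (nome_IZR 0). unfold nome. fold X Y.
  replace (h * (RtoC (2 * PI) * Ci))%C with (X, Y)
    by (unfold X, Y; destruct h; apply injective_projections; unfold Re, Im; simpl; ring).
  apply injective_projections; simpl; ring. }
rewrite E. eapply Rle_trans; [apply Cmod_le_sum|]. unfold Re, Im; cbn [fst snd].
assert (P1 := Rabs_pos X). assert (P2 := Rabs_pos Y).
assert (Hc : Rabs (cos Y) <= 1) by (apply Rabs_le; split; apply COS_bound).
assert (Hs : Rabs (sin Y) <= 2 * Rabs Y).
{ replace (sin Y) with ((sin Y - Y) + Y) by ring. eapply Rle_trans; [apply Rabs_triang|]. nra. }
assert (He1 : Rabs (exp X - 1) <= eta).
{ replace (exp X - 1) with ((exp X - 1 - X) + X) by ring.
  eapply Rle_trans; [apply Rabs_triang|]. nra. }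
assert (H1X : Rabs (1 + X) <= 2).
{ eapply Rle_trans; [apply Rabs_triang|]. rewrite Rabs_R1; lra. }
assert (T1 : Rabs ((exp X - 1 - X) * cos Y) <= eta * Rabs X).
{ rewrite Rabs_mult, <- (Rmult_1_r (eta * _)). apply Rmult_le_compat; trivial; apply Rabs_pos. }
assert (T2 : Rabs ((1 + X) * (cos Y - 1)) <= 2 * (eta * Rabs Y)).
{ rewrite Rabs_mult. apply Rmult_le_compat; trivial; apply Rabs_pos. }
assert (T3 : Rabs ((exp X - 1) * sin Y) <= eta * (2 * Rabs Y)).
{ rewrite Rabs_mult. apply Rmult_le_compat; trivial; apply Rabs_pos. }
assert (T4 := Rabs_triang ((exp X - 1 - X) * cos Y) ((1 + X) * (cos Y - 1))).
assert (T5 := Rabs_triang ((exp X - 1) * sin Y) (sin Y - Y)).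
assert (Hm := Cmod_ge_0 h).
apply Rle_trans with (eta * (Rabs X + 5 * Rabs Y)); [lra|].
apply Rle_trans with (eps / 80 * (80 * Cmod h)); [|right; field].
apply Rmult_le_compat; lra.
Qed.

Lemma Cderive_nome (z : C) : Cderive nome z (RtoC (2 * PI) * Ci * nome z)%C.
Proof.
assert (E : forall t, (nome z * nome (1 * t + - z))%C = nome t)
  by (intros t; rewrite <- nome_plus; f_equal; ring).
eapply (is_derive_ext (K := C_AbsRing) (V := C_NormedModule)); [exact E|].
assert (Hin : Cderive (fun t => 1 * t + - z)%C z (RtoC 1)) by apply Cderive_affine.
assert (H0 : Cderive nome (1 * z + - z)%C (RtoC (2 * PI) * Ci)%C)
  by (replace (1 * z + - z)%C with (RtoC 0) by ring; exact Cderive_nome_0).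
assert (H := Cderive_mult (fun _ => nome z) _ z _ _ (Cderive_const (nome z) z)
  (Cderive_comp nome _ z _ _ H0 Hin)).
match type of H with is_derive _ _ ?l =>
  replace (RtoC (2 * PI) * Ci * nome z)%C with l; [exact H|ring] end.
Qed.

(** q^k as an exponential in kz, which treats negative k without inverses. *)
Definition nome_pow (k : Z) (z : C) : C := nome (RtoC (IZR k) * z).

Lemma holomorphic_nome_pow (k : Z) : holomorphic_H (nome_pow k).
Proof.
intros z _; eexists; unfold nome_pow.
apply (Cderive_comp nome (fun t => RtoC (IZR k) * t)%C); [apply Cderive_nome|].
apply (Cderive_mult (fun _ => RtoC (IZR k)) (fun t => t)); [apply Cderive_const|apply Cderive_id].
Qed.

Lemma nome_pow_nat (n : nat) (z : C) : nome_pow (Z.of_nat n) z = (nome z ^ n)%C.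
Proof.
induction n as [|n IH].
- unfold nome_pow; simpl Z.of_nat. rewrite Cmult_0_l. exact (nome_IZR 0).
- rewrite Nat2Z.inj_succ; unfold nome_pow in *.
  replace (RtoC (IZR (Z.succ (Z.of_nat n))) * z)%C with (z + RtoC (IZR (Z.of_nat n)) * z)%C
    by (rewrite succ_IZR, RtoC_plus; ring).
  rewrite nome_plus, IH. reflexivity.
Qed.

Lemma nome_pow_plus (j k : Z) (z : C) : nome_pow (j + k) z = (nome_pow j z * nome_pow k z)%C.
Proof. unfold nome_pow; rewrite <- nome_plus, plus_IZR, RtoC_plus; f_equal; ring. Qed.

Lemma nome_pow_periodic (k : Z) (z : C) : nome_pow k (z + 1) = nome_pow k z.
Proof.
unfold nome_pow. replace (RtoC (IZR k) * (z + 1))%C with (RtoC (IZR k) * z + RtoC (IZR k))%C by ring.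
rewrite nome_plus, nome_IZR; ring.
Qed.

Lemma nome_neq_0 (z : C) : nome z <> RtoC 0.
Proof. apply Cmod_gt_0; rewrite Cmod_nome; apply exp_pos. Qed.

(** * Estimates for complex series *)

Lemma is_series_C_lim (a : nat -> C) (l : C) :
  is_series (K := C_AbsRing) (V := C_NormedModule) a l ->
  forall eps, 0 < eps -> exists N, forall n, (N <= n)%nat ->
    Cmod (sum_n (G := C_AbelianMonoid) a n - l) < eps.
Proof.
intros H eps He.
(* Halving absorbs the factor sqrt 2 lost between the balls and the modulus. *)
assert (He2 : 0 < eps / 2) by lra.
destruct (proj1 (filterlim_locally _ _) H (mkposreal _ He2)) as [N HN].
exists N; intros n Hn. specialize (HN n Hn).
apply C_NormedModule_mixin_compat2 in HN. simpl in HN.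
assert (Hs : sqrt 2 < 2) by (rewrite <- (sqrt_square 2) at 2 by lra; apply sqrt_lt_1_alt; lra).
assert (Hs0 := sqrt_pos 2).
eapply Rlt_trans; [exact HN|]. nra.
Qed.

Lemma is_series_C_terms_bounded (a : nat -> C) (l : C) :
  is_series (K := C_AbsRing) (V := C_NormedModule) a l ->
  exists M, 0 < M /\ forall n, Cmod (a n) <= M.
Proof.
intros H. destruct (is_series_C_lim a l H 1 Rlt_0_1) as [N HN].
assert (Hf : exists M, 0 < M /\ forall n, (n <= N)%nat -> Cmod (a n) <= M).
{ clear HN. induction N as [|N (M & HM & IH)].
  - exists (Cmod (a O) + 1); split; [generalize (Cmod_ge_0 (a O)); lra|].
    intros n Hn; replace n with O by lia; lra.
  - exists (M + Cmod (a (S N))). assert (H0 := Cmod_ge_0 (a (S N))). split; [lra|].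
    intros n Hn. destruct (Nat.eq_dec n (S N)) as [->|]; [lra|].
    specialize (IH n ltac:(lia)); lra. }
destruct Hf as (M & HM & Hf). exists (M + 2); split; [lra|]; intros n.
destruct (Nat.le_gt_cases n N) as [Hn|Hn]; [specialize (Hf n Hn); lra|].
destruct n as [|n]; [lia|].
assert (H1 := HN n ltac:(lia)). assert (H2 := HN (S n) ltac:(lia)).
rewrite sum_Sn in H2. change plus with Cplus in H2.
set (s := sum_n a n) in *.
replace (a (S n)) with ((s + a (S n) - l) + - (s - l))%C by ring.
eapply Rle_trans; [apply Cmod_triangle|]. rewrite Cmod_opp.
change (Cmod (s + a (S n) - l)) with (Cmod (Cplus s (a (S n)) - l)%C) in *. lra.
Qed.

Lemma is_series_C_bound (a : nat -> C) (l b : C) (B : R) (N : nat) :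
  is_series (K := C_AbsRing) (V := C_NormedModule) a l ->
  (forall n, (N <= n)%nat -> Cmod (sum_n (G := C_AbelianMonoid) a n - b) <= B) -> Cmod (l - b) <= B.
Proof.
intros H HB. apply le_epsilon; intros eps He.
destruct (is_series_C_lim a l H eps He) as [N' HN'].
specialize (HN' (N + N')%nat ltac:(lia)). specialize (HB (N + N')%nat ltac:(lia)).
set (s := sum_n a (N + N')) in *.
replace (l - b)%C with ((s - b) + - (s - l))%C by ring.
eapply Rle_trans; [apply Cmod_triangle|]. rewrite Cmod_opp. lra.
Qed.

(** For x <= 1/2 the tail M x^(m+1) (1 + x + ...) is at most 2 M x^(m+1). *)
Lemma is_series_C_leading_term (a : nat -> C) (l : C) (m : nat) (M x : R) :
  is_series (K := C_AbsRing) (V := C_NormedModule) a l -> 0 <= M -> 0 < x <= / 2 ->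
  (forall n, (n < m)%nat -> a n = RtoC 0) -> (forall n, Cmod (a n) <= M * x ^ n) ->
  Cmod (l - a m) <= 2 * M * x ^ S m.
Proof.
intros H HM Hx Ha Hb.
assert (Hm : forall n, (n < m)%nat -> sum_n (G := C_AbelianMonoid) a n = RtoC 0).
{ induction n as [|n IH]; intros Hn; [rewrite sum_O; now apply Ha|].
  rewrite sum_Sn, IH, Ha by lia. exact (Cplus_0_l _). }
assert (Hm' : sum_n (G := C_AbelianMonoid) a m = a m).
{ destruct m as [|m]; [apply sum_O|]. rewrite sum_Sn, Hm by lia. exact (Cplus_0_l _). }
apply (is_series_C_bound a l (a m) _ m H).
intros n Hn. replace n with (m + (n - m))%nat by lia. generalize (n - m)%nat; clear n Hn; intros k.
assert (Hxm : 0 < x ^ S m) by (apply pow_lt; lra).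
(* The strengthening that makes the induction on k work: x^k <= 2 (x^k - x^(k+1)). *)
apply Rle_trans with (2 * M * x ^ S m * (1 - x ^ k)).
- induction k as [|k IH].
  + rewrite Nat.add_0_r, Hm'. replace (a m - a m)%C with (RtoC 0) by ring.
    rewrite Cmod_0; simpl; lra.
  + rewrite Nat.add_succ_r, sum_Sn. change plus with Cplus.
    set (s := sum_n a (m + k)) in *.
    replace (Cplus s (a (S (m + k))) - a m)%C with ((s - a m) + a (S (m + k)))%C by ring.
    eapply Rle_trans; [apply Cmod_triangle|].
    specialize (Hb (S (m + k))). replace (S (m + k)) with (S m + k)%nat in * by lia.
    rewrite pow_add in Hb.
    assert (Hxk : 0 < x ^ k) by (apply pow_lt; lra).
    assert (H1 : M * (x ^ S m * x ^ k) * (1 - 2 * (1 - x)) <= 0).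
    { rewrite <- (Rmult_0_r (M * (x ^ S m * x ^ k))). apply Rmult_le_compat_l; [|lra].
      apply Rmult_le_pos; [exact HM|nra]. }
    replace (x ^ S k) with (x * x ^ k) by reflexivity. lra.
- assert (0 < x ^ k) by (apply pow_lt; lra).
  rewrite <- (Rmult_1_r (2 * M * x ^ S m)) at 2. apply Rmult_le_compat_l; [nra|lra].
Qed.

(* The Fourier coefficient of f q^k over a horizontal period equals the integral over the arc
   from rho to rho + 1, since the vertical sides cancel. *)
Lemma horizontal_period_zero (f : C -> C) (k : Z) (y : R) :
  weakly_holomorphic_modular_function f ->
  (forall t, PI / 3 < t < 2 * PI / 3 -> f (arc t) = RtoC 0) -> 0 < y ->
  segment_integral (fun z => f z * nome_pow k z)%C (0, y) ((0, y) + 1)%C = RtoC 0.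
Proof.
intros Hf H0 Hy. assert (HPI := PI_RGT_0).
set (g := fun z => (f z * nome_pow k z)%C).
assert (Hg : holomorphic_H g)
  by (apply holomorphic_H_mult; [now apply whm_holomorphic_H|apply holomorphic_nome_pow]).
destruct (exists_primitive_H g Hg) as [P HP].
assert (HI1 : forall z, Im (z + 1)%C = Im z) by (intros [a b]; unfold Im; simpl; ring).
assert (HQ : primitive_H (fun _ => RtoC 0) (fun z => P (z + 1) - P z)%C).
{ intros z Hz.
  assert (Eg : g (z + 1)%C = g z).
  { unfold g. rewrite nome_pow_periodic, <- mobius_T_eq, (whm_modular f Hf mat_T z) by
      (trivial; reflexivity). reflexivity. }
  replace (RtoC 0) with (RtoC 1 * g z - g z)%C by ring.
  apply (Cderive_minus (fun z => P (z + 1)%C) P); [|now apply HP].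
  rewrite <- Eg.
  apply (Cderive_comp P (fun z => z + 1)%C); [apply HP; now rewrite HI1|].
  assert (E : forall t, (1 * t + 1)%C = (t + 1)%C) by (intros; ring).
  eapply (is_derive_ext (K := C_AbsRing) (V := C_NormedModule)); [exact E|apply Cderive_affine]. }
rewrite (segment_integral_primitive g P) by (trivial; rewrite HI1; exact Hy).
(* Parametrised by p so that the mean value theorem serves for the real and the imaginary part. *)
assert (Harc : forall (p : C -> R) (c : R -> R),
  (forall t, PI / 3 <= t <= 2 * PI / 3 ->
     is_derive (fun s => p (P (arc s))) t (c t)) ->
  (forall t, PI / 3 < t < 2 * PI / 3 -> c t = 0) ->
  p (P (arc (PI / 3))) = p (P rho)).
{ intros p c Hd Hc.
  destruct (MVT_gen (fun s => p (P (arc s))) (PI / 3) (2 * PI / 3) (fun _ => 0)) as (x & _ & Hx).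
  - rewrite Rmin_left, Rmax_right by lra. intros t Ht. rewrite <- (Hc t Ht); apply Hd; lra.
  - rewrite Rmin_left, Rmax_right by lra. intros t Ht.
    apply derivable_continuous_pt; eexists; apply is_derive_Reals; apply Hd; lra.
  - lra. }
assert (HdP : forall t, PI / 3 <= t <= 2 * PI / 3 ->
  Rderive_C (fun s => P (arc s)) t (Ci * arc t * g (arc t))%C).
{ intros t Ht. apply (Rderive_C_comp P arc); [apply HP; now apply Im_arc_pos|apply Rderive_C_arc]. }
assert (Hg0 : forall t, PI / 3 < t < 2 * PI / 3 -> (Ci * arc t * g (arc t))%C = RtoC 0).
{ intros t Ht; unfold g; rewrite H0 by exact Ht; ring. }
assert (E1 : P (arc (PI / 3)) = P rho).
{ apply injective_projections.
  - apply (Harc Re (fun t => Re (Ci * arc t * g (arc t))%C)).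
    + intros t Ht; apply Rderive_C_Re, HdP, Ht.
    + intros t Ht; rewrite Hg0 by exact Ht; reflexivity.
  - apply (Harc Im (fun t => Im (Ci * arc t * g (arc t))%C)).
    + intros t Ht; apply Rderive_C_Im, HdP, Ht.
    + intros t Ht; rewrite Hg0 by exact Ht; reflexivity. }
transitivity (P (rho + 1) - P rho)%C.
- apply (primitive_H_increment _ rho (0, y) HQ Im_rho_pos Hy).
- rewrite <- mobius_T_eq, mobius_T_rho, E1; ring.
Qed.

(** Strong induction: once the earlier coefficients vanish, f q^(N-m) is within eps of c_m on a high
    enough horizontal line. Its integral over a period is 0, so |c_m| <= eps, with no interchange of
    sum and integral. *)
Lemma cusp_coefficients_zero (f : C -> C) (N : nat) (c : nat -> C) :
  weakly_holomorphic_modular_function f ->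
  (forall t, PI / 3 < t < 2 * PI / 3 -> f (arc t) = RtoC 0) ->
  (forall tau : C, 0 < Im tau ->
      is_series (K := C_AbsRing) (V := C_NormedModule)
        (fun n => (c n * nome tau ^ n)%C) (nome tau ^ N * f tau)%C) ->
  forall m, c m = RtoC 0.
Proof.
intros Hf H0 Hs m. assert (HPI := PI_RGT_0).
induction m as [m IH] using (well_founded_induction lt_wf).
apply Cmod_eq_0, Rle_antisym; [|apply Cmod_ge_0]. apply le_epsilon; intros eps He.
rewrite Rplus_0_l.
(* Convergence at i alone bounds all coefficients: |c_n| r^n <= M with r = |q(i)|. *)
destruct (is_series_C_terms_bounded _ _ (Hs Ci ltac:(simpl; lra))) as (M & HM & Hb).
set (r := exp (- (2 * PI))).
assert (Hr : 0 < r) by apply exp_pos.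
assert (Hri : Cmod (nome Ci) = r).
{ rewrite Cmod_nome. unfold r; f_equal; unfold Im; simpl; ring. }
assert (Hc : forall n, Cmod (c n) * r ^ n <= M).
{ intros n. specialize (Hb n). now rewrite Cmod_mult, Cmod_pow, Hri in Hb. }
assert (Hrm : 0 < r ^ m) by (apply pow_lt; lra).
(* The second bound makes the relative tail 2 M x / r^m at most eps. *)
set (x := Rmin (/ 2) (eps * r ^ m / (2 * M))).
assert (Hx0 : 0 < x).
{ apply Rmin_pos; [lra|]. apply Rdiv_lt_0_compat; [nra|lra]. }
assert (Hx1 : x <= / 2) by apply Rmin_l.
assert (Hx2 : 2 * M * x <= eps * r ^ m).
{ apply Rle_trans with (2 * M * (eps * r ^ m / (2 * M))); [|right; field; lra].
  apply Rmult_le_compat_l; [lra|apply Rmin_r]. }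
(* The height at which |q| = r x, so that the n-th term is at most M x^n. *)
set (y := 1 - ln x / (2 * PI)).
assert (Hln : ln x < 0) by (rewrite <- ln_1; apply ln_increasing; lra).
assert (Hy : 1 < y).
{ unfold y. assert (0 < (- ln x) / (2 * PI)) by (apply Rdiv_lt_0_compat; lra).
  unfold Rdiv in *; lra. }
assert (Hq : forall z, Im z = y -> Cmod (nome z) = r * x).
{ intros z Hz. rewrite Cmod_nome, Hz. unfold r. rewrite <- (exp_ln x Hx0).
  rewrite <- exp_plus. f_equal. unfold y; field; lra. }
set (k := (Z.of_nat N - Z.of_nat m)%Z).
set (g := fun z => (f z * nome_pow k z)%C).
assert (Hg : holomorphic_H g)
  by (apply holomorphic_H_mult; [now apply whm_holomorphic_H|apply holomorphic_nome_pow]).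
assert (Hclose : forall z, Im z = y -> Cmod (g z - c m) <= eps).
{ intros z Hz. assert (Hz0 : 0 < Im z) by lra.
  assert (HL : Cmod (nome z ^ N * f z - c m * nome z ^ m) <= 2 * M * x ^ S m).
  { apply (is_series_C_leading_term _ _ m M x (Hs z Hz0) (Rlt_le _ _ HM) (conj Hx0 Hx1)).
    - intros n Hn. rewrite (IH n Hn); ring.
    - intros n. rewrite Cmod_mult, Cmod_pow, Hq, Rpow_mult_distr, <- Rmult_assoc by exact Hz.
      apply Rmult_le_compat_r; [apply pow_le; lra|apply Hc]. }
  assert (Hqm : (nome z ^ m)%C <> RtoC 0).
  { apply Cmod_gt_0; rewrite Cmod_pow, Hq by exact Hz. apply pow_lt; nra. }
  assert (E : (nome z ^ N * f z - c m * nome z ^ m)%C = (nome z ^ m * (g z - c m))%C).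
  { unfold g. replace (nome z ^ N)%C with (nome z ^ m * nome_pow k z)%C; [ring|].
    rewrite <- !nome_pow_nat, <- nome_pow_plus. f_equal; unfold k; lia. }
  rewrite E, Cmod_mult, Cmod_pow, Hq, Rpow_mult_distr in HL by exact Hz.
  assert (Hxm : 0 < x ^ m) by (apply pow_lt; lra).
  apply Rmult_le_reg_l with (r ^ m * x ^ m); [nra|].
  eapply Rle_trans; [exact HL|].
  replace (2 * M * x ^ S m) with (2 * M * x * x ^ m) by (simpl; ring).
  replace (r ^ m * x ^ m * eps) with (eps * r ^ m * x ^ m) by ring.
  apply Rmult_le_compat_r; lra. }
assert (Hy0 : 0 < y) by lra.
assert (HI : segment_integral g (0, y) ((0, y) + 1)%C = RtoC 0)
  by (now apply horizontal_period_zero).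
assert (HI1 : Im ((0, y) + 1)%C = y) by (unfold Im; simpl; ring).
destruct (exists_primitive_H g Hg) as [P HP].
rewrite (segment_integral_primitive g P) in HI by (trivial; rewrite HI1; exact Hy0).
(* Over one period the primitive P(z) - c_m z of [g2] changes by -c_m, since the increment of P
   vanishes. *)
set (g2 := fun z => (g z - c m)%C).
assert (Hg2 : holomorphic_H g2).
{ intros z Hz. destruct (Hg z Hz) as [l Hl]. eexists.
  apply (Cderive_minus g (fun _ => c m)); [exact Hl|apply Cderive_const]. }
assert (HP2 : primitive_H g2 (fun z => P z - (c m * z + 0))%C).
{ intros z Hz. apply (Cderive_minus P (fun z => c m * z + 0)%C); [now apply HP|apply Cderive_affine]. }
assert (HB := segment_integral_bound g2 (0, y) ((0, y) + 1)%C eps Hg2 Hy0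
  ltac:(rewrite HI1; exact Hy0)).
rewrite (segment_integral_primitive g2 _ _ _ Hg2 HP2) in HB by (trivial; rewrite HI1; exact Hy0).
replace ((0, y) + 1 - (0, y))%C with (RtoC 1) in HB by ring. rewrite Cmod_1, Rmult_1_r in HB.
replace (c m) with (- (P ((0, y) + 1)%C - (c m * ((0, y) + 1) + 0) - (P (0, y) - (c m * (0, y) + 0))))%C
  by (match goal with |- _ = ?r => transitivity (r - (P ((0, y) + 1) - P (0, y)))%C;
        [ring|rewrite HI; ring] end).
rewrite Cmod_opp. apply HB. intros t Ht. apply Hclose.
unfold Im; simpl; ring.
Qed.

Lemma exists_arc_nonzero (f : C -> C) :
  weakly_holomorphic_modular_function f ->
  (exists tau : C, 0 < Im tau /\ f tau <> RtoC 0) -> arc_nonzero f.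
Proof.
intros Hf (tau & Htau & Hn).
destruct (excluded_middle_informative (arc_nonzero f)) as [H|H]; [exact H|exfalso].
assert (H0 : forall t, PI / 3 < t < 2 * PI / 3 -> f (arc t) = RtoC 0).
{ intros t Ht. destruct (excluded_middle_informative (f (arc t) = RtoC 0)) as [|n]; [assumption|].
  elim H; now exists t. }
destruct (whm_cusp f Hf) as (N & c & Hs).
assert (Hc := cusp_coefficients_zero f N c Hf H0 Hs).
assert (E := is_series_C_bound _ _ (RtoC 0) 0 O (Hs tau Htau)).
assert (E0 : (nome tau ^ N * f tau - 0)%C = RtoC 0).
{ apply Cmod_eq_0, Rle_antisym; [|apply Cmod_ge_0]. apply E. intros n _.
  assert (Es : sum_n (G := C_AbelianMonoid) (fun n => c n * nome tau ^ n)%C n = RtoC 0).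
  { induction n as [|n IH]; [rewrite sum_O, Hc; apply Cmult_0_l|].
    rewrite sum_Sn, IH, Hc, Cmult_0_l. exact (Cplus_0_l _). }
  rewrite Es. replace (0 - 0)%C with (RtoC 0) by ring. rewrite Cmod_0; lra. }
apply Hn. replace (nome tau ^ N * f tau - 0)%C with (nome tau ^ N * f tau)%C in E0 by ring.
assert (Hq : (nome tau ^ N)%C <> RtoC 0).
{ apply Cmod_gt_0; rewrite Cmod_pow; apply pow_lt, Cmod_gt_0, nome_neq_0. }
transitivity (/ nome tau ^ N * (nome tau ^ N * f tau))%C; [field; exact Hq|].
rewrite E0; ring.
Qed.

(** * Continued fractions and words in T and V *)

Definition irrational (x : R) : Prop := forall p q : Z, q <> 0%Z -> x <> IZR p / IZR q.

Lemma cf_convergent_ge_1 (c : nat -> nat) (n : nat) :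
  (forall i, (1 <= c i)%nat) -> 1 <= cf_convergent c n.
Proof.
revert c; induction n as [|n IH]; intros c Hc; cbn [cf_convergent].
- apply (le_INR 1), Hc.
- assert (H := IH (fun i => c (S i)) (fun i => Hc (S i))).
  assert (H1 := le_INR 1 (c O) (Hc O)). simpl in H1.
  assert (0 < / cf_convergent (fun i => c (S i)) n) by (apply Rinv_0_lt_compat; lra). lra.
Qed.

(** The convergents are c_0 + 1 / u_n with u_n >= 1, so x lies in [c_0, c_0 + 1]. Irrationality
    excludes both ends, which identifies c_0 as the integer part and allows passing to the limit in
    u_n. It is inherited by the next quotient, so the step can be iterated. *)
Lemma cf_first_quotient (c : nat -> nat) (x : R) : is_cf c x -> irrational x ->
  Int_part x = Z.of_nat (c O) /\
  is_lim_seq (cf_convergent (fun i => c (S i))) (/ frac_part x) /\ irrational (/ frac_part x).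
Proof.
intros [Hc Hl] Hx.
set (u := cf_convergent (fun i => c (S i))).
assert (Hu : forall n, 1 <= u n) by (intros n; now apply cf_convergent_ge_1).
apply is_lim_seq_incr_1 in Hl. cbn [cf_convergent] in Hl.
set (a := INR (c O)) in *.
assert (Hinv : forall n, 0 <= / u n <= 1).
{ intros n; specialize (Hu n). split; [apply Rlt_le, Rinv_0_lt_compat; lra|].
  rewrite <- Rinv_1; apply Rinv_le_contravar; lra. }
assert (Ea : a = IZR (Z.of_nat (c O))) by apply INR_IZR_INZ.
assert (H1 : a <= x).
{ apply (is_lim_seq_le (fun _ => a) (fun n => a + / u n) a x); [|apply is_lim_seq_const|exact Hl].
  intros n; specialize (Hinv n); lra. }
assert (H2 : x <= a + 1).
{ apply (is_lim_seq_le (fun n => a + / u n) (fun _ => a + 1) x (a + 1)); [|exact Hl|apply is_lim_seq_const].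
  intros n; specialize (Hinv n); lra. }
assert (H3 : x <> a) by (rewrite Ea, <- (Rdiv_1_r (IZR _)); now apply (Hx _ 1%Z)).
assert (H4 : x <> a + 1).
{ rewrite Ea, <- plus_IZR, <- (Rdiv_1_r (IZR _)); now apply (Hx _ 1%Z). }
assert (HI : Int_part x = Z.of_nat (c O)) by (symmetry; apply Int_part_spec; lra).
split; [exact HI|].
unfold frac_part; rewrite HI, <- Ea. split.
- assert (Hl' : is_lim_seq (fun n => / u n) (x - a)).
  { apply (is_lim_seq_ext (fun n => (a + / u n) - a)); [intros; ring|].
    apply is_lim_seq_minus'; [exact Hl|apply is_lim_seq_const]. }
  apply (is_lim_seq_inv _ (x - a)) in Hl'; [|intros E; injection E; lra].
  apply (is_lim_seq_ext (fun n => / / u n)); [|exact Hl'].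
  intros n; apply Rinv_inv.
- intros p q Hq E.
  assert (Hqr : IZR q <> 0) by now apply not_0_IZR.
  assert (Hp : p <> 0%Z).
  { intros ->. unfold Rdiv in E; rewrite Rmult_0_l in E.
    apply (Rinv_neq_0_compat (x - a)); [lra|exact E]. }
  assert (Hpr : IZR p <> 0) by now apply not_0_IZR.
  apply (Hx (Z.of_nat (c O) * p + q)%Z p Hp).
  rewrite plus_IZR, mult_IZR, <- Ea.
  apply (f_equal Rinv) in E. rewrite Rinv_inv in E.
  replace x with (a + (x - a)) by ring. rewrite E. field; split; assumption.
Qed.

Lemma partial_quotient_cf (c : nat -> nat) (x : R) : is_cf c x -> irrational x ->
  partial_quotient x = c.
Proof.
intros Hc Hx; apply functional_extensionality; intros i. unfold partial_quotient.
assert (H : is_cf (fun j => c (i + j)%nat) (complete_quotient x i) /\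
            irrational (complete_quotient x i)).
{ induction i as [|i [IH1 IH2]]; [now split|].
  destruct (cf_first_quotient _ _ IH1 IH2) as (_ & H1 & H2).
  split; [|exact H2]. split.
  - intros j. replace (S i + S j)%nat with (S (i + S j)) by lia. apply Hc.
  - replace (fun j => c (S i + j)%nat) with (fun j => c (i + S j)%nat); [exact H1|].
    apply functional_extensionality; intros j; f_equal; lia. }
destruct (cf_first_quotient _ _ (proj1 H) (proj2 H)) as (-> & _ & _).
rewrite Nat2Z.id, Nat.add_0_r; reflexivity.
Qed.

(** A block pattern read from position r on: for odd r the letters T and V change roles. *)
Definition twist (r : nat) (A : mat2) : mat2 := if Nat.even r then A else mat_swap A.

Lemma twist_mul (r : nat) (A B : mat2) : twist r (mat_mul A B) = mat_mul (twist r A) (twist r B).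
Proof. unfold twist; destruct (Nat.even r); [reflexivity|apply mat_swap_mul]. Qed.

Lemma twist_id (r : nat) : twist r mat_id = mat_id.
Proof. unfold twist; now destruct (Nat.even r). Qed.

Lemma twist_pow (r : nat) (A : mat2) (k : nat) : twist r (mat_pow A k) = mat_pow (twist r A) k.
Proof.
induction k as [|k IH]; cbn [mat_pow]; [apply twist_id|now rewrite twist_mul, IH].
Qed.

Lemma word_twist (r n : nat) (A : mat2) : word n A -> word n (twist r A).
Proof. unfold twist; destruct (Nat.even r); [trivial|apply word_swap]. Qed.

Lemma letter_add (r j : nat) : letter (r + j) = twist r (letter j).
Proof.
unfold letter, twist; rewrite Nat.even_add.
destruct (Nat.even r), (Nat.even j); reflexivity.
Qed.

Lemma cf_word_add (c : nat -> nat) (r i : nat) :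
  cf_word c (r + i) = mat_mul (cf_word c r) (twist r (cf_word (fun j => c (r + j)%nat) i)).
Proof.
induction i as [|i IH].
- cbn [cf_word]. now rewrite Nat.add_0_r, twist_id, mat_mul_id_r.
- rewrite Nat.add_succ_r; cbn [cf_word].
  now rewrite IH, letter_add, twist_mul, twist_pow, mat_mul_assoc.
Qed.

Lemma quotient_sum_add (c : nat -> nat) (r i : nat) :
  quotient_sum c (r + i) = (quotient_sum c r + quotient_sum (fun j => c (r + j)%nat) i)%nat.
Proof.
induction i as [|i IH]; [cbn; now rewrite !Nat.add_0_r|].
rewrite Nat.add_succ_r; cbn [quotient_sum]. rewrite IH; lia.
Qed.

Lemma quotient_sum_le (c : nat -> nat) (i j : nat) :
  (i <= j)%nat -> (quotient_sum c i <= quotient_sum c j)%nat.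
Proof. intros H; replace j with (i + (j - i))%nat by lia; apply quotient_sum_mono. Qed.

(** An even period leaves the roles of T and V unchanged, so consecutive periods give equal
    matrices. *)
Lemma periodic_word (c : nat -> nat) (l m s : nat) :
  (forall j, c (l + j)%nat = c j) -> Nat.even l = true ->
  cf_word c (m * l + s) = mat_mul (mat_pow (cf_word c l) m) (cf_word c s) /\
  quotient_sum c (m * l + s) = (m * quotient_sum c l + quotient_sum c s)%nat.
Proof.
intros Hc Hl. apply functional_extensionality in Hc.
induction m as [|m [IH1 IH2]].
- cbn [Nat.mul Nat.add mat_pow]. now rewrite mat_mul_id_l.
- replace (S m * l + s)%nat with (l + (m * l + s))%nat by lia.
  rewrite cf_word_add, quotient_sum_add, Hc, IH1, IH2.
  unfold twist; rewrite Hl. cbn [mat_pow]. rewrite mat_mul_assoc. split; [reflexivity|lia].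
Qed.

Lemma word_pow_letter (i k : nat) : word k (mat_pow (letter i) k).
Proof.
induction k as [|k IH]; [constructor|]. cbn [mat_pow].
unfold letter in *; destruct (Nat.even i); now constructor.
Qed.

Lemma word_cf_word (c : nat -> nat) (i : nat) : word (quotient_sum c i) (cf_word c i).
Proof.
induction i as [|i IH]; [constructor|]; cbn [cf_word quotient_sum].
apply word_mul; [exact IH|apply word_pow_letter].
Qed.

Lemma quotient_sum_split (c : nat -> nat) (n : nat) : (forall j, (1 <= c (S j))%nat) ->
  exists i k, (n = quotient_sum c i + k)%nat /\ (k <= c i)%nat.
Proof.
intros Hc; induction n as [|n (i & k & E & Hk)].
- exists O, O; split; [reflexivity|lia].
- destruct (Nat.eq_dec k (c i)) as [Hki|Hki].
  (* The next letter opens a new block, which is nonempty because only the block of index 0 may be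
     empty. *)
  + exists (S i), 1%nat; split; [cbn; lia|apply Hc].
  + exists i, (S k); lia.
Qed.

(** The position of the n-th letter is located by its block. Dividing the block index by the even
    period length gives the number m of full periods, and the rest is a prefix of one period. *)
Lemma cf_matrix_decompose (c d : nat -> nat) (r l n : nat) :
  (forall j, (1 <= c (S j))%nat) -> (forall j, c (r + j)%nat = d j) ->
  (forall j, d (l + j)%nat = d j) -> Nat.even l = true -> (0 < l)%nat ->
  (quotient_sum c r < n)%nat ->
  exists m s S', word s S' /\ (s <= quotient_sum d l)%nat /\
    (n = quotient_sum c r + m * quotient_sum d l + s)%nat /\
    cf_matrix c n =
      mat_mul (cf_word c r) (mat_mul (mat_pow (twist r (cf_word d l)) m) S').
Proof.
intros Hc Hd Hp He Hl Hn.
destruct (quotient_sum_split c n Hc) as (i & k & En & Hk).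
assert (Hi : (r <= i)%nat).
{ destruct (Nat.le_gt_cases r i) as [|Hlt]; [assumption|exfalso].
  assert (H := quotient_sum_le c (S i) r Hlt). cbn in H; lia. }
set (j := (i - r)%nat). assert (Ei : i = (r + j)%nat) by (unfold j; lia).
assert (Ej := Nat.div_mod_eq j l). set (m := (j / l)%nat) in *. set (s := (j mod l)%nat) in *.
assert (Hs : (s < l)%nat) by (apply Nat.mod_upper_bound; lia).
assert (Ej' : j = (m * l + s)%nat) by lia.
destruct (periodic_word d l m s Hp He) as [W1 W2].
assert (Hdj : d j = d s).
{ rewrite Ej'. clear - Hp. induction m as [|m IH]; [reflexivity|].
  rewrite <- IH, <- (Hp (m * l + s)%nat). f_equal; lia. }
exists m, (quotient_sum d s + k)%nat, (twist r (mat_mul (cf_word d s) (mat_pow (letter j) k))).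
assert (Hks : (k <= d s)%nat) by (rewrite <- Hdj, <- Hd, <- Ei; exact Hk).
assert (Hcd : (fun j => c (r + j)%nat) = d) by (now apply functional_extensionality).
split; [|split; [|split]].
- apply word_twist, word_mul; [apply word_cf_word|apply word_pow_letter].
- assert (H := quotient_sum_le d (S s) l Hs). cbn in H; lia.
- rewrite En, Ei, quotient_sum_add, Hcd, Ej', W2. lia.
- rewrite En, cf_matrix_spec by assumption.
  rewrite Ei, cf_word_add, Hcd, letter_add, <- twist_pow, <- mat_mul_assoc, <- twist_mul.
  rewrite Ej' at 1. rewrite W1, !twist_mul, twist_pow, !mat_mul_assoc. reflexivity.
Qed.

Lemma mat_pow_T (n : nat) : mat_pow mat_T n = Mat2 1 (Z.of_nat n) 0 1.
Proof.
induction n as [|n IH]; [reflexivity|]. cbn [mat_pow]; rewrite IH.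
unfold mat_mul, mat_T; cbn [m11 m12 m21 m22]; f_equal; lia.
Qed.

Lemma mat_pow_V (n : nat) : mat_pow mat_V n = Mat2 1 0 (Z.of_nat n) 1.
Proof.
induction n as [|n IH]; [reflexivity|]. cbn [mat_pow]; rewrite IH.
unfold mat_mul, mat_V; cbn [m11 m12 m21 m22]; f_equal; lia.
Qed.

(** The first two blocks already multiply to a positive matrix: T^a V^b has entries 1 + ab, a, b,
    1. *)
Lemma pos_SL2_cf_word (c : nat -> nat) (i : nat) :
  (1 <= c 0)%nat -> (1 <= c 1)%nat -> (2 <= i)%nat -> pos_SL2 (cf_word c i).
Proof.
intros H0 H1 Hi. replace i with (2 + (i - 2))%nat by lia. rewrite cf_word_add.
apply pos_SL2_mul_r.
- cbn [cf_word letter Nat.even]. rewrite mat_mul_id_l.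
  change (letter 0) with mat_T; change (letter 1) with mat_V. rewrite mat_pow_T, mat_pow_V.
  split; [unfold SL2Z, mat_det, mat_mul; cbn [m11 m12 m21 m22]; ring|].
  unfold mat_mul; cbn [m11 m12 m21 m22]; nia.
- eapply word_nonneg, word_twist, word_cf_word.
Qed.

Lemma quotient_sum_nth (b : list nat) :
  quotient_sum (fun i => nth i b O) (length b) = list_sum b.
Proof.
induction b as [|k b IH]; [reflexivity|].
change (length (k :: b)) with (1 + length b)%nat. rewrite quotient_sum_add.
change (quotient_sum (fun j => nth (1 + j) (k :: b) O) (length b))
  with (quotient_sum (fun j => nth j b O) (length b)).
rewrite IH. reflexivity.
Qed.

Lemma quotient_sum_ext (c d : nat -> nat) (i : nat) :
  (forall j, (j < i)%nat -> c j = d j) -> quotient_sum c i = quotient_sum d i.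
Proof.
induction i as [|i IH]; intros H; [reflexivity|]; cbn.
now rewrite IH, H by (intros; auto with arith).
Qed.

Lemma cf_word_ext (c d : nat -> nat) (i : nat) :
  (forall j, (j < i)%nat -> c j = d j) -> cf_word c i = cf_word d i.
Proof.
induction i as [|i IH]; intros H; [reflexivity|]; cbn.
now rewrite IH, H by (intros; auto with arith).
Qed.

Lemma is_lim_seq_mean (u : nat -> R) (l K : R) (N : nat) :
  (forall n, (N <= n)%nat -> Rabs (u n - INR n * l) <= K) ->
  is_lim_seq (fun n => u n / INR n) l.
Proof.
intros H.
assert (Hi : is_lim_seq (fun n => / INR n) 0).
{ apply (is_lim_seq_inv INR p_infty); [exact is_lim_seq_INR|discriminate]. }
assert (HK : forall C, is_lim_seq (fun n => l + C * / INR n) l).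
{ intros C. replace (Finite l) with (Finite (l + C * 0)) by (f_equal; ring).
  apply is_lim_seq_plus'; [apply is_lim_seq_const|].
  apply (is_lim_seq_scal_l (fun n => / INR n) C 0), Hi. }
apply (is_lim_seq_le_le_loc (fun n => l + - K * / INR n) _ (fun n => l + K * / INR n)); [|apply HK|apply HK].
exists (S N); intros n Hn. specialize (H n ltac:(lia)).
assert (Hn0 : 0 < INR n) by (apply lt_0_INR; lia).
apply Rabs_le_between in H.
assert (Hin : 0 < / INR n) by now apply Rinv_0_lt_compat.
assert (E : u n / INR n = l + (u n - INR n * l) * / INR n) by (field; lra).
rewrite E; split; apply Rplus_le_compat_l, Rmult_le_compat_r; lra.
Qed.

Theorem theorem1p6 (f : C -> C) (tau0 : C) (a b : list nat) (x : R)
    (f_modular : weakly_holomorphic_modular_function f)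
    (f_nonzero : exists tau : C, 0 < Im tau /\ f tau <> RtoC 0)
    (f_arc : forall t : R, PI / 3 <= t <= 2 * PI / 3 ->
      Im (f (cos t, sin t)) = 0 /\ 0 <= Re (f (cos t, sin t)))
    (tau0_upper : 0 < Im tau0)
    (a_pos : List.Forall (fun m => (1 <= m)%nat) (tl a))
    (b_pos : List.Forall (fun m => (1 <= m)%nat) b)
    (b_length : (2 <= length b)%nat)
    (b_even : Nat.Even (length b))
    (x_pos : 0 < x)
    (x_quadratic : quadratic_irrational x)
    (x_cf : is_cf (eventually_periodic a b) x) :
  lyapunov f tau0 x =
    Finite (Re (cycle_integral f tau0
                  (cf_word (fun i => nth i b O) (length b)))
            / INR (list_sum b)) /\
  Rbar_lt (Finite 0) (lyapunov f tau0 x).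
Proof.
set (c := eventually_periodic a b) in *. set (l := length b) in *. set (r := length a).
(* The purely periodic tail of the quotients. *)
set (d := fun j => nth (j mod l) b O).
assert (Hcd : forall j, c (r + j)%nat = d j).
{ intros j. unfold c, eventually_periodic, d. fold r l.
  rewrite (proj2 (Nat.ltb_ge (r + j) r)) by lia. f_equal. f_equal. lia. }
assert (Hdp : forall j, d (l + j)%nat = d j).
{ intros j; unfold d. f_equal. replace (l + j)%nat with (j + 1 * l)%nat by lia.
  apply Nat.Div0.mod_add. }
assert (Hdb : forall j, (j < l)%nat -> d j = nth j b O)
  by (intros j Hj; unfold d; now rewrite Nat.mod_small).
assert (Hb : forall j, (j < l)%nat -> (1 <= nth j b O)%nat)
  by (intros j Hj; exact (proj1 (Forall_nth _ b) b_pos j O Hj)).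
set (B := cf_word (fun i => nth i b O) l).
assert (HB : cf_word d l = B) by now apply cf_word_ext.
assert (HL : quotient_sum d l = list_sum b).
{ rewrite <- quotient_sum_nth; now apply quotient_sum_ext. }
assert (HBw : word (list_sum b) B)
  by (rewrite <- HB, <- HL; apply word_cf_word).
assert (HBp : pos_SL2 B) by (apply pos_SL2_cf_word; trivial; apply Hb; lia).
assert (HLpos : (0 < list_sum b)%nat).
{ rewrite <- HL. assert (H := quotient_sum_le d 1 l ltac:(lia)). cbn [quotient_sum] in H.
  rewrite (Hdb O) in H by lia. specialize (Hb O ltac:(lia)). lia. }
set (L := list_sum b) in *.
assert (Hnz := exists_arc_nonzero f f_modular f_nonzero).
destruct (cycle_integral_word f tau0 L B f_modular f_arc Hnz tau0_upper HLpos HBw HBp)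
  as [Hpos Hswap].
(* What is repeated in A_n is the period with T and V exchanged if r is odd. The real part of its
   cycle integral is the same. *)
set (B' := twist r B).
assert (HB'p : pos_SL2 B')
  by (unfold B', twist; destruct (Nat.even r); [exact HBp|now apply pos_SL2_swap]).
assert (HB' : Re (cycle_integral f tau0 B') = Re (cycle_integral f tau0 B))
  by (unfold B', twist; destruct (Nat.even r); [reflexivity|exact Hswap]).
set (I := Re (cycle_integral f tau0 B)) in *.
set (p := quotient_sum c r).
destruct (cycle_integral_word_pow f tau0 B' (cf_word c r) p L f_modular tau0_upper HB'p
  (word_cf_word c r)) as [K HK].
assert (HLr : 0 < INR L) by now apply lt_0_INR.
assert (Hlim : is_lim_seq (fun n =>
  Re (cycle_integral f tau0 (cf_matrix (partial_quotient x) n)) / INR n) (I / INR L)).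
{ rewrite (partial_quotient_cf c x x_cf (proj1 x_quadratic)).
  (* Since n = p + (m + 1) L + s with s <= L, replacing m I by n I / L costs at most (I / L)(p + 2
     L). The threshold [S (p + L)] forces at least one full period, as s <= L. *)
  apply (is_lim_seq_mean _ _ (K + I / INR L * (INR p + 2 * INR L)) (S (p + L))).
  intros n Hn.
  assert (He : Nat.even l = true) by now apply Nat.even_spec.
  destruct (cf_matrix_decompose c d r l n (proj1 x_cf) Hcd Hdp He ltac:(lia) ltac:(fold p; lia))
    as (m & s & S' & HS & Hs & En & ->).
  rewrite HB. fold B'. fold p in En. rewrite HL in Hs, En.
  destruct m as [|m]; [lia|].
  specialize (HK m s S' HS Hs).
  assert (HK' := Rle_trans _ _ _ (re_le_Cmod _) HK).
  match type of HK' with Rabs (Re (?u - RtoC ?v * ?w)%C) <= _ =>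
    replace (Re (u - RtoC v * w)%C) with (Re u - v * Re w) in HK'
      by (unfold Cminus, Re; simpl; ring) end.
  rewrite HB' in HK'.
  match type of HK' with Rabs (?u - _) <= _ => set (J := u) in * end.
  assert (Enr : INR n = INR p + (INR m + 1) * INR L + INR s)
    by (rewrite En, !plus_INR, mult_INR, S_INR; reflexivity).
  assert (Hsr : 0 <= INR s <= INR L) by (split; [apply pos_INR|now apply le_INR]).
  assert (Hpr := pos_INR p).
  set (q := I / INR L). assert (Hq : 0 < q) by now apply Rdiv_lt_0_compat.
  assert (EI : I = q * INR L) by (unfold q; field; lra).
  replace (J - INR n * q) with ((J - INR m * I) + - (q * (INR p + INR L + INR s)))
    by (rewrite Enr, EI; ring).
  eapply Rle_trans; [apply Rabs_triang|]. apply Rplus_le_compat; [exact HK'|].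
  rewrite Rabs_Ropp, Rabs_pos_eq by nra. apply Rmult_le_compat_l; lra. }
assert (E : lyapunov f tau0 x = Finite (I / INR L))
  by (apply is_LimSup_seq_unique, is_lim_LimSup_seq, Hlim).
split; [exact E|]. rewrite E. now apply Rdiv_lt_0_compat.
Qed.
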